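(* For $d\ge2$ the coefficient $\phi(\beta;d)$ satisfies: (i) $\phi(0;d)=1/d$; (ii) $\phi(\beta;d)<1$ for all $\beta\in(0,1)$; (iii) $\phi(\beta;d)=1$ for all $\beta\ge1$. In particular, for any $d\ge2$, any $\beta\in[0,1)$ and $\kappa\ge1$, and any $(\beta,\kappa;\theta_q)$-outstretched box $\Lambda=\Lambda_q$, the Dirichlet eigenvalue satisfies $\lambda^D(\Lambda)\gg\gamma_1$ as $q\to0$ (i.e. $\lambda^D(\Lambda_q)/\gamma_1\to+\infty$).
   Context: Let $q\in(0,1)$, $p=1-q$, $\theta_q=|\log_2q|$, $\mathbb Z^d_+=\{x\in\mathbb Z^d:x_i\ge0\ \forall i\}$, $\mathcal B$ the canonical basis of $\mathbb Z^d$. East chain in finite volume. For finite $V\subset\mathbb Z^d_+$ with $0\in V$, the East chain in $V$ with boundary conditions identically equal to $1$ is the continuous-time chain on $\{0,1\}^V$ with generator $\mathcal L_Vf(\omega)=\sum_{x\in V}c_x^V(\omega)[\omega_xq+(1-\omega_x)p][f(\omega^x)-f(\omega)]$, where $\omega^x$ is $\omega$ flipped at $x$ and $c^V_x(\omega)=1$ if $x=0$ or $\omega_{x-\mathbf e}=0$ for some $\mathbf e\in\mathcal B$ with $x-\mathbf e\in V$, and $c_x^V(\omega)=0$ otherwise. It is reversible w.r.t. the product measure $\mu_V$ with $\mu_V(\omega_x=1)=p$; its Dirichlet form is $\mathcal D_V(f)=\sum_{x\in V}\mu_V(c_x^V\mathrm{Var}_x(f))$, with $\mathrm{Var}_x$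 the variance w.r.t. $\omega_x$ only. $\gamma(V)$ is its spectral gap, $\gamma(V)=\inf\{\mathcal D_V(f)/\mathrm{Var}_V(f): f \text{ non-constant}\}$. Boxes. For non-negative integers $L_1,\dots,L_d$ the box with side lengths $(L_1,\dots,L_d)$ is $\Lambda=\prod_{i=1}^d\{0,\dots,L_i\}$, and $x_\Lambda=(L_1,\dots,L_d)$. For $\beta\ge0$, $\kappa\ge1$ the box is $(\beta,\kappa;\theta_q)$-outstretched if $\max_{i,j}\frac{\max(L_i,1)}{\max(L_j,1)}\le\kappa2^{\beta\theta_q}$. Dirichlet eigenvalue. $\lambda^D(\Lambda)=\inf\{\mathcal D_\Lambda(f)/\mu_\Lambda(f^2):\ f:\{0,1\}^\Lambda\to\mathbb R,\ f\not\equiv0,\ f(\omega)=0 \text{ whenever }\omega_{x_\Lambda}=0\}$. Condition $\mathcal H(\beta)$. Given $\beta\ge0$, $\lambda>0$ satisfies $\mathcal H(\beta)$ (written $\lambda\sim\mathcal H(\beta)$) if for any $\kappa\ge1$, $\varepsilon>0$ there is $q(\beta,\kappa,\varepsilon)>0$ such that for all $q\le q(\beta,\kappa,\varepsilon)$ and every $(\beta,\kappa;\theta_q)$-outstretched box $\Lambda\subset\mathbb Z^d_+$ there exists $V\subset\Lambda$ with $V\supset\{0,x_\Lambda\}$ and $\gamma(V)\ge2^{-(1+\varepsilon)\lambda\theta_q^2/2}$. Define $\phi(\beta;d)=\min\{\lambda>0:\lambda\sim\mathcal H(\beta)\}$. $\gamma_1=\gamma_1(q)>0$ is the spectral gap of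 the one dimensional East process on $\mathbb Z$ (each vertex $x$ is resampled at rate one from the Bernoulli($p$) measure iff the state at $x-1$ is $0$); it is known that $\gamma_1=2^{-\frac{\theta_q^2}{2}(1+o(1))}$ as $q\to0$. *)

(* Defs.v *)
From HB Require Import structures.
From mathcomp Require Import all_boot all_order all_algebra finmap.
From mathcomp Require Import all_classical all_reals all_analysis.

Set Implicit Arguments.
Unset Strict Implicit.
Unset Printing Implicit Defensive.

Import Order.TTheory GRing.Theory Num.Theory.
Import numFieldNormedType.Exports.
Local Open Scope classical_set_scope.
Local Open Scope ring_scope.

(* {0,1}^S, with [true] standing for 1 and [false] for 0 (a facilitating
   vacancy). *)
Definition cfg (S : finType) : finType := {ffun S -> bool}.

Section FiniteProduct.
Variables (R : realType) (S : finType) (q : R).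
Implicit Types (f : cfg S -> R) (x : S) (w : cfg S).

(* Product Bernoulli(p) measure, p = 1 - q. *)
Definition mu w : R := \prod_(x : S) (if w x then 1 - q else q).

Definition mean f : R := \sum_(w : cfg S) mu w * f w.

Definition variance f : R := mean (fun w => f w ^+ 2) - mean f ^+ 2.

Definition set_at x (b : bool) w : cfg S :=
  [ffun y => if y == x then b else w y].

Definition mean_at x f w : R :=
  (1 - q) * f (set_at x true w) + q * f (set_at x false w).

(* Var_x: variance with respect to the coordinate at x, the others frozen. *)
Definition variance_at x f w : R :=
  mean_at x (fun w' => f w' ^+ 2) w - mean_at x f w ^+ 2.

Definition dirichlet (c : S -> cfg S -> bool) f : R :=
  \sum_(x : S) mean (fun w => (c x w)%:R * variance_at x f w).

End FiniteProduct.

Definition nonconstant (T : Type) (R : realType) (f : T -> R) : Prop :=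
  exists w w', f w != f w'.

(* Z^d_+ *)
Definition site (d : nat) := {ffun 'I_d -> nat}.

Definition origin (d : nat) : site d := [ffun=> 0%N].

Definition shift (d : nat) (i : 'I_d) (x : site d) : site d :=
  [ffun j => (x j + (j == i))%N].

(* x - e in V for a basis vector e = e_i is expressed as x = y + e_i, y in V. *)
Definition east_constraint (d : nat) (V : {fset site d}) (x : V) (w : cfg V)
    : bool :=
  (val x == origin d) ||
  [exists y : V, [exists i : 'I_d, (val x == shift i (val y)) && ~~ w y]].

Definition gap (R : realType) (d : nat) (q : R) (V : {fset site d}) : R :=
  inf [set dirichlet q (@east_constraint d V) f / variance q f
      | f in [set f : cfg V -> R | nonconstant f]].

Definition site_of_ords (d n : nat) (y : {ffun 'I_d -> 'I_n}) : site d :=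
  [ffun i => nat_of_ord (y i)].

(* A box is encoded by its side lengths L, i.e. by its upper corner x_Lambda. *)
Definition box (d : nat) (L : site d) : {fset site d} :=
  [fset site_of_ords y
  | y in [pred y : {ffun 'I_d -> 'I_(\max_(i < d) L i).+1}
         | [forall i, (y i <= L i)%N]]]%fset.

Lemma mem_box (d : nat) (L x : site d) :
  (x \in box L) = [forall i, (x i <= L i)%N].
Proof.
apply/imfsetP/forallP => /= [[y /forallP le_yL ->] i|le_xL].
  by rewrite ffunE.
have lt_x i : (x i < (\max_(i < d) L i).+1)%N.
  by rewrite ltnS (leq_trans (le_xL i)) // (leq_bigmax i).
exists [ffun i => inord (x i)].
  by apply/forallP => i; rewrite ffunE inordK.
by apply/ffunP => i; rewrite !ffunE inordK.
Qed.

Definition theta (R : realType) (q : R) : R := `|ln q / ln 2|.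

Definition outstretched (R : realType) (d : nat) (beta kappa q : R)
    (L : site d) : Prop :=
  forall i j : 'I_d,
    (maxn (L i) 1)%:R / (maxn (L j) 1)%:R <= kappa * 2 `^ (beta * theta q).

Definition lambdaD (R : realType) (d : nat) (q : R) (L : site d) : R :=
  inf [set dirichlet q (@east_constraint d (box L)) f
             / mean q (fun w => f w ^+ 2)
      | f in [set f : cfg (box L) -> R |
               (exists w, f w != 0) /\
               (forall (x : box L) (w : cfg (box L)),
                  val x = L -> ~~ w x -> f w = 0)]].

Definition calH (R : realType) (d : nat) (beta lambda : R) : Prop :=
  forall kappa eps : R, 1 <= kappa -> 0 < eps ->
  exists2 q0 : R, 0 < q0 &
  forall q : R, 0 < q < 1 -> q <= q0 ->
  forall L : site d, outstretched beta kappa q L ->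
  exists V : {fset site d},
    [/\ {subset V <= box L}, origin d \in V, L \in V &
        2 `^ (- ((1 + eps) * lambda * theta q ^+ 2 / 2)) <= gap q V].

Definition admissible (R : realType) (d : nat) (beta : R) : set R :=
  [set lambda | 0 < lambda /\ calH d beta lambda].

Definition is_minimum (R : realType) (A : set R) (m : R) : Prop :=
  A m /\ lbound A m.

(* The minimum of the admissible set; the value 0 is a dummy, used only if the
   minimum does not exist. *)
Definition phi (R : realType) (d : nat) (beta : R) : R :=
  xget 0 (is_minimum (admissible d beta)).

(* The East process on Z.  The Dirichlet form of the infinite-volume process is
   the closure of its restriction to the local functions, i.e. those depending
   on the coordinates in a finite A, so the infimum defining the gap can be
   taken over them.  For such a function, the constraints involve only the
   further coordinates in A - 1, and all the averages are over the marginal of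
   the product measure on A \cup (A - 1). *)
Definition depends_on (R : realType) (A : {fset int})
    (f : (int -> bool) -> R) : Prop :=
  forall w w' : int -> bool, {in A, w =1 w'} -> f w = f w'.

Definition window (A : {fset int}) : {fset int} :=
  (A `|` [fset (x - 1)%R | x in A])%fset.

(* The value outside W is irrelevant for f local on A and W = window A. *)
Definition extend (W : {fset int}) (w : cfg W) : int -> bool :=
  fun x => if insub x is Some y then w y else true.

Definition restrict_to (R : realType) (W : {fset int})
    (f : (int -> bool) -> R) : cfg W -> R := fun w => f (extend w).

(* For x in A, x - 1 is in window A; for x in window A outside A, the local
   variance at x of a function depending on A vanishes. *)
Definition eastZ_constraint (W : {fset int}) (x : W) (w : cfg W) : bool :=
  ~~ extend w (val x - 1).

Definition gamma1 (R : realType) (q : R) : R :=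
  inf [set r : R | exists (A : {fset int}) (f : (int -> bool) -> R),
      [/\ depends_on A f, nonconstant f &
          r = dirichlet q (@eastZ_constraint (window A))
                (@restrict_to R (window A) f)
              / variance q (@restrict_to R (window A) f)]].

(* Main.v *)
(* Upper bounds on phi.  If a vacancy at x lets a set Y relax in time T, and a
   vacancy at any site of Y lets Z relax in time T, then a vacancy at x lets Z
   relax in time O(T / P(Y contains a vacancy)), because each time that Y is
   resampled there is a chance that it helps Z.  Applied to the middle element
   of a chain of 2^m translates of a box of side l = 2^(mk), this costs a factor
   1 / min(1, q l^D) for each of the m bisections and leads from the scale l to
   the scale 2^m l.  Iterating over J scales up to volume about 1/q gives the
   relaxation time 2^((1 + O(1/J)) theta^2 / (2D)); beyond that volume each box
   contains a vacancy with probability at least 7/8, and a chain of boxes has a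
   spectral gap without further loss.  The set V is the union of the sites
   visited by these moves.  Taking D = 1 along a monotone path of unit steps
   gives phi <= 1, and D = d gives phi(0) <= 1/d.  For 0 < beta < 1 one uses
   boxes with the proportions of Lambda, whose volume exceeds 1/q as soon as
   their longest side is 2^(b theta) with b > (1 + beta) / 2; as b can be taken
   smaller than 1, joining consecutive boxes by one-dimensional moves gives an
   exponent smaller than 1.

   Lower bounds.  To bring a vacancy at distance 2^n from the origin, n
   simultaneous vacancies are necessary: a configuration reachable with at most
   n vacancies is dismantlable, that is, its vacancies can be removed one by one
   with the last but j at distance at most 2^(n-j-1) from a remaining one.
   Counting the dismantlable configurations with exactly n vacancies in a box of
   dimension D with n about theta / D gives phi >= 1/D, with D = d for every beta
   and with D = 1, in a segment, for beta >= 1.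

   Dirichlet eigenvalue.  A function vanishing whenever there is a vacancy at
   x_Lambda has variance at least q times its second moment, so that lambdaD is
   at least q times the gap of V.  The bottleneck in a segment also bounds gamma_1. *)

(* Bisecting with single sites only would cost 1/q for each of about theta / D bisections, an
   exponent theta^2 / D. When the blocks grow, the cost of a bisection falls from 1/q to O(1),
   linearly in the logarithm of the scale; its average is the square root of 1/q, which halves the
   exponent. Factors 2^(O(theta)), such as the size of a block or a bounded number of passages
   through a single site, are negligible against 2^(eps theta^2).

   The obstacle is that the helping vacancy of Y sits at a random site, and that relaxing Z from
   there must not use sites already revealed. Constraints point towards larger l1 norm; hence
   [reach] allows any weight depending on lower sites, and Y is explored from below. The weighted
   energies of the cases then add up, and no factor |Y| is lost.

   The gap of V also requires every auxiliary site to relax, not only the targets. Hence a gadget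
   carries two times, the second one larger by a factor 2^(O(theta)) per level, and its estimates
   hold in every V containing its sites, so that gadgets can be superposed. *)
Require Import Defs.
From mathcomp Require Import all_boot all_order all_algebra finmap.
From mathcomp Require Import all_classical all_reals all_analysis.
From mathcomp Require Import ring lra zify.
Import Order.TTheory GRing.Theory Num.Theory.
Import numFieldNormedType.Exports.
Local Open Scope classical_set_scope.
Local Open Scope ring_scope.

Set Implicit Arguments.
Unset Strict Implicit.
Unset Printing Implicit Defensive.

(* [shift] and [variance] are shadowed by the libraries. *)
Import Defs.

(** * Averages under the product measure *)

Section Averages.
Variables (R : realType) (S : finType) (q : R).
Hypothesis hq : 0 < q < 1.
Implicit Types (f g h : cfg S -> R) (x y : S) (w : cfg S) (s t : seq S).

Let q0 : 0 < q. Proof. by case/andP: hq. Qed.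
Let p0 : 0 < 1 - q. Proof. by rewrite subr_gt0; case/andP: hq. Qed.

Lemma set_at_id x b b' w : set_at x b (set_at x b' w) = set_at x b w.
Proof. by apply/ffunP => y; rewrite !ffunE; case: eqP. Qed.

Lemma set_atC x y b b' w : x != y ->
  set_at x b (set_at y b' w) = set_at y b' (set_at x b w).
Proof.
move=> nxy; apply/ffunP => z; rewrite !ffunE.
by case: (eqVneq z x) => [->|//]; rewrite (negPf nxy).
Qed.

Lemma set_at_same x w : set_at x (w x) w = w.
Proof. by apply/ffunP => y; rewrite ffunE; case: eqP => [->|]. Qed.

Lemma set_at_eq x b w : set_at x b w x = b.
Proof. by rewrite ffunE eqxx. Qed.

Lemma set_at_neq x y b w : y != x -> set_at x b w y = w y.
Proof. by move=> nyx; rewrite ffunE (negPf nyx). Qed.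

Lemma mu_gt0 w : 0 < mu q w.
Proof. by apply: prodr_gt0 => x _; case: (w x). Qed.

Lemma eq_mean f g : f =1 g -> mean q f = mean q g.
Proof. by move=> fg; apply: eq_bigr => w _; rewrite fg. Qed.

Lemma meanD f g : mean q (fun w => f w + g w) = mean q f + mean q g.
Proof. by rewrite /mean -big_split; apply: eq_bigr => w _ /=; ring. Qed.

Lemma meanB f g : mean q (fun w => f w - g w) = mean q f - mean q g.
Proof. by rewrite /mean -sumrB; apply: eq_bigr => w _ /=; ring. Qed.

Lemma meanZ a f : mean q (fun w => a * f w) = a * mean q f.
Proof. by rewrite /mean mulr_sumr; apply: eq_bigr => w _ /=; ring. Qed.

Lemma mean_sum (I : Type) (r : seq I) (P : pred I) (F : I -> cfg S -> R) :
  mean q (fun w => \sum_(i <- r | P i) F i w) = \sum_(i <- r | P i) mean q (F i).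
Proof. by rewrite /mean exchange_big; apply: eq_bigr => w _; rewrite mulr_sumr. Qed.

Lemma ler_mean f g : (forall w, f w <= g w) -> mean q f <= mean q g.
Proof. by move=> fg; apply: ler_sum => w _; rewrite ler_wpM2l // ltW ?mu_gt0. Qed.

Lemma mean_ge0 f : (forall w, 0 <= f w) -> 0 <= mean q f.
Proof. by move=> f0; apply: sumr_ge0 => w _; rewrite mulr_ge0 // ltW ?mu_gt0. Qed.

Lemma sum_mu : \sum_(w : cfg S) mu q w = 1.
Proof.
rewrite /mu -(bigA_distr_bigA (fun (x : S) (b : bool) => if b then 1 - q else q)).
by rewrite big1 // => x _; rewrite big_bool /=; ring.
Qed.

Lemma mean_cst a : mean q (fun _ : cfg S => a) = a.
Proof. by rewrite /mean -mulr_suml sum_mu mul1r. Qed.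

Lemma mean_mean_at x f : mean q (mean_at q x f) = mean q f.
Proof.
pose m (w : cfg S) := \prod_(y | y != x) (if w y then 1 - q else q).
have muE (w : cfg S) : mu q w = (if w x then 1 - q else q) * m w.
  by rewrite /mu (bigD1 x).
have mE b (w : cfg S) : m (set_at x b w) = m w.
  by apply: eq_bigr => y nyx; rewrite set_at_neq.
have split (F : cfg S -> R) :
    \sum_w F w = \sum_(w : cfg S | w x) (F w + F (set_at x false w)).
  rewrite (bigID (fun w : cfg S => w x)) big_split /=; congr (_ + _).
  rewrite (reindex_onto (set_at x false) (set_at x true)) /= => [|w nwx].
    apply: eq_bigl => w; rewrite set_at_eq set_at_id /=.
    apply/eqP/idP => [<-|wx]; first by rewrite set_at_eq.
    by rewrite -[RHS](set_at_same x) wx.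
  by rewrite set_at_id -[RHS](set_at_same x) (negPf nwx).
rewrite /mean !split; apply: eq_bigr => w wx.
have w1 : set_at x true w = w by rewrite -wx set_at_same.
by rewrite /mean_at !muE !set_at_id !set_at_eq !mE wx w1; ring.
Qed.

Definition indep x f := forall b w, f (set_at x b w) = f w.

Lemma indep_mul x f g : indep x f -> indep x g -> indep x (fun w => f w * g w).
Proof. by move=> hf hg b w; rewrite hf hg. Qed.

Lemma indep_mean_at x f : indep x (mean_at q x f).
Proof. by move=> b w; rewrite /mean_at !set_at_id. Qed.

Lemma indep_mean_at2 x y f : indep x f -> indep x (mean_at q y f).
Proof.
move=> hf; have [->|nxy] := eqVneq x y; first exact: indep_mean_at.
by move=> b w; rewrite /mean_at !(@set_atC y x) 1?eq_sym // !hf.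
Qed.

Lemma mean_atC x y f : mean_at q x (mean_at q y f) =1 mean_at q y (mean_at q x f).
Proof.
move=> w; have [->//|nxy] := eqVneq x y.
by rewrite /mean_at !(@set_atC y x) 1?eq_sym //; ring.
Qed.

(** Conditional expectation given the coordinates outside [s]. One-site averages commute and are
    idempotent, so order and repetitions in [s] do not matter. *)
Definition avg s f : cfg S -> R := foldr (fun x => mean_at q x) f s.

Lemma avg_cat s t f : avg (s ++ t) f = avg s (avg t f).
Proof. by rewrite /avg foldr_cat. Qed.

Lemma mean_avg s f : mean q (avg s f) = mean q f.
Proof. by elim: s => //= x s IH; rewrite mean_mean_at. Qed.

Lemma avgB s f g : avg s (fun w => f w - g w) =1 fun w => avg s f w - avg s g w.
Proof. by elim: s => //= x s IH w; rewrite /mean_at !IH; ring. Qed.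

Lemma avg_cst s a : avg s (fun _ => a) =1 fun _ => a.
Proof. by elim: s => //= x s IH w; rewrite /mean_at !IH; ring. Qed.

Lemma avg_pull s f h : {in s, forall x, indep x h} ->
  avg s (fun w => h w * f w) =1 fun w => h w * avg s f w.
Proof.
elim: s => //= x s IH hs w.
rewrite /mean_at !IH; try by move=> y ys; apply: hs; rewrite inE ys orbT.
by rewrite !(hs x) ?mem_head //; ring.
Qed.

Lemma avg_indep s f : {in s, forall x, indep x f} -> avg s f = f.
Proof.
move=> hs; apply: funext => w.
rewrite (_ : f = fun w => f w * 1); last by apply: funext => ?; rewrite mulr1.
by rewrite (avg_pull (fun _ => 1)) ?avg_cst // => x xs; under eq_fun do rewrite mulr1; exact: hs.
Qed.

Lemma indep_avg_mem s x f : x \in s -> indep x (avg s f).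
Proof.
elim: s => //= y s IH; rewrite inE; have [<- _|nxy /= xs] := eqVneq x y.
  exact: indep_mean_at.
by apply: indep_mean_at2; exact: IH.
Qed.

Lemma avgC s t f : avg s (avg t f) = avg t (avg s f).
Proof.
have mC x u g : mean_at q x (avg u g) = avg u (mean_at q x g).
  elim: u => //= y u IH.
  by rewrite -IH; apply: funext => w; rewrite mean_atC.
by elim: s => //= x s ->; rewrite mC.
Qed.

Lemma avg_sub s t f : {subset s <= t} -> avg s (avg t f) = avg t f.
Proof. by move=> st; rewrite avg_indep // => x /st; exact: indep_avg_mem. Qed.

(** [avg q s f] is constant: any [w'] turns into [w] by resetting the sites of [s] one at a time, to
    which it is insensitive. *)
Lemma avg_all s f w : (forall x, x \in s) -> avg s f w = mean q f.
Proof.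
move=> sT; rewrite -(mean_avg s) -(mean_cst (avg s f w)); apply: eq_mean => w'.
pose u (r : seq S) := foldr (fun x v => set_at x (w x) v) w' r.
have uE r x : x \in r -> u r x = w x.
  elim: r => //= y r IH; rewrite inE ffunE; case: eqP => [->|] //=.
have <- : u s = w by apply/ffunP => x; rewrite uE.
by elim: {2}s => //= x r <-; rewrite (indep_avg_mem (x := x)).
Qed.

(* [nrm h f] is the squared norm of [f] in L^2(h mu). *)
Definition nrm h f : R := mean q (fun w => h w * f w ^+ 2).

Lemma nrm_ge0 h f : (forall w, 0 <= h w) -> 0 <= nrm h f.
Proof. by move=> h0; apply: mean_ge0 => w; rewrite mulr_ge0 ?sqr_ge0. Qed.

Lemma nrmDh h h' f : nrm (fun w => h w + h' w) f = nrm h f + nrm h' f.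
Proof. by rewrite /nrm -meanD; apply: eq_mean => w; ring. Qed.

Lemma ler_nrmh h h' f : (forall w, h w <= h' w) -> nrm h f <= nrm h' f.
Proof. by move=> hh'; apply: ler_mean => w; rewrite ler_wpM2r ?sqr_ge0. Qed.

Lemma mean_avg_orth s h f g : {in s, forall x, indep x h} ->
  mean q (fun w => h w * avg s f w * g w) =
  mean q (fun w => h w * avg s f w * avg s g w).
Proof.
move=> hs; rewrite -(mean_avg s); apply: eq_mean => w.
rewrite (@avg_pull s g (fun w => h w * avg s f w)) // => x xs.
by apply: indep_mul; [exact: hs | exact: indep_avg_mem].
Qed.

(** As [h] ignores the sites of [s], [avg q s] is an orthogonal projection of L^2(h mu). This is why
    the weights below come with independence hypotheses. *)
Lemma nrm_pyth s h f : {in s, forall x, indep x h} ->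
  nrm h f = nrm h (avg s f) + nrm h (fun w => f w - avg s f w).
Proof.
move=> hs; have := mean_avg_orth f f hs.
rewrite /nrm => H.
have -> : mean q (fun w => h w * f w ^+ 2) =
  mean q (fun w => h w * (f w - avg s f w) ^+ 2)
  + (mean q (fun w => h w * avg s f w * f w)
  + mean q (fun w => h w * avg s f w * f w)
  - mean q (fun w => h w * avg s f w * avg s f w)).
  by rewrite -meanD -meanB -meanD; apply: eq_mean => w; ring.
rewrite H addrK addrC; congr (_ + _); apply: eq_mean => w; ring.
Qed.

Lemma nrm_avg_le s h f : (forall w, 0 <= h w) -> {in s, forall x, indep x h} ->
  nrm h (avg s f) <= nrm h f.
Proof. by move=> h0 hs; rewrite [leRHS](nrm_pyth f hs) lerDl nrm_ge0. Qed.

Lemma nrm_sub_avg_le s h f : (forall w, 0 <= h w) -> {in s, forall x, indep x h} ->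
  nrm h (fun w => f w - avg s f w) <= nrm h f.
Proof. by move=> h0 hs; rewrite [leRHS](nrm_pyth f hs) lerDr nrm_ge0. Qed.

Lemma nrm_var_sub s t h f : (forall w, 0 <= h w) -> {in t, forall x, indep x h} ->
  {subset s <= t} ->
  nrm h (fun w => f w - avg s f w) <= nrm h (fun w => f w - avg t f w).
Proof.
move=> h0 ht st.
have hs : {in s, forall x, indep x h} by move=> x /st; exact: ht.
have <- : nrm h (fun w => f w - avg t f w - avg s (fun w => f w - avg t f w) w)
        = nrm h (fun w => f w - avg s f w).
  by apply: eq_mean => w; rewrite avgB avg_sub //; congr (_ * _ ^+ 2); ring.
exact: nrm_sub_avg_le.
Qed.

(** Decompose [f - avg q (s ++ t) f] along the projection [avg q s]: one part is the fluctuation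
    over [s], the other a contraction of the fluctuation over [t]. *)
Lemma nrm_var_cat s t h f : (forall w, 0 <= h w) -> {in s, forall x, indep x h} ->
  nrm h (fun w => f w - avg (s ++ t) f w) <=
  nrm h (fun w => f w - avg s f w) + nrm h (fun w => f w - avg t f w).
Proof.
move=> h0 hs; rewrite avg_cat (nrm_pyth _ hs) addrC.
have e1 w : avg s (fun w => f w - avg s (avg t f) w) w =
            avg s (fun w => f w - avg t f w) w.
  by rewrite !avgB (avg_sub (s := s) (t := s)).
apply: lerD.
  rewrite le_eqVlt; apply/orP; left; apply/eqP.
  apply: eq_mean => w; rewrite e1 avgB; congr (_ * _ ^+ 2); ring.
rewrite (_ : nrm _ _ = nrm h (avg s (fun w => f w - avg t f w))).
  exact: nrm_avg_le.
by apply: eq_mean => w; rewrite e1.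
Qed.

Lemma nrm_var_sum s h f : (forall w, 0 <= h w) -> {in s, forall x, indep x h} ->
  nrm h (fun w => f w - avg s f w) <=
  \sum_(x <- s) nrm h (fun w => f w - mean_at q x f w).
Proof.
move=> h0; elim: s => [_|x s IH hs].
  rewrite big_nil /nrm (eq_mean (g := fun _ => 0)) ?mean_cst // => w /=.
  by rewrite subrr expr0n mulr0.
rewrite big_cons (le_trans (nrm_var_cat (s := [:: x]) s f h0 _)) //.
  by move=> y; rewrite inE => /eqP ->; apply: hs; rewrite mem_head.
by rewrite lerD2l IH // => y ys; apply: hs; rewrite inE ys orbT.
Qed.

(* A function whose fluctuations over [s] are controlled needs to be controlled
   only on an [s]-measurable event of probability [a]. *)
Lemma nrm_two_block s t h G f (a : R) :
  (forall w, 0 <= h w) -> {in s, forall x, indep x h} ->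
  {in t, forall x, indep x h} -> (forall w, 0 <= G w <= 1) ->
  avg s G =1 (fun _ => a) -> 0 < a ->
  nrm h (fun w => f w - avg t f w) <=
  a^-1 * (6 * nrm h (fun w => f w - avg s f w)
       + 4 * nrm (fun w => h w * G w) (fun w => f w - avg t f w)).
Proof.
move=> h0 hs ht G01 aG a0.
have a1 : a <= 1.
  rewrite -(mean_cst a) -(eq_mean aG) mean_avg -[leRHS](mean_cst 1).
  by apply: ler_mean => w; case/andP: (G01 w).
pose F w := f w - avg t f w.
pose D w := F w - avg s F w.
rewrite -/F.
have hD : nrm h D <= nrm h (fun w => f w - avg s f w).
  rewrite (_ : nrm h D = nrm h (fun w => (f w - avg s f w)
                          - avg t (fun w => f w - avg s f w) w)).
    exact: nrm_sub_avg_le.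
  apply: eq_mean => w; rewrite /D /F !avgB avgC; congr (_ * _ ^+ 2); ring.
(* [avg s F] is insensitive to [s], so averaging over [s] replaces [G] by [a]: on this part the
   restriction to the event costs exactly the factor [a]. *)
have hE : a * nrm h (avg s F) = nrm (fun w => h w * G w) (avg s F).
  rewrite /nrm -[RHS](mean_avg s) -meanZ; apply: eq_mean => w.
  rewrite (_ : (fun w => h w * G w * avg s F w ^+ 2) =
     (fun w => (h w * avg s F w ^+ 2) * G w)); last by apply: funext => ?; ring.
  rewrite (@avg_pull s G (fun w => h w * avg s F w ^+ 2)) ?aG; first by ring.
  move=> x xs; apply: indep_mul; first exact: hs.
  by move=> b w'; rewrite (indep_avg_mem _ xs).
have hG0 w : 0 <= h w * G w by rewrite mulr_ge0 //; case/andP: (G01 w).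
have hGh : nrm (fun w => h w * G w) D <= nrm h D.
  by apply: ler_nrmh => w; rewrite ler_piMr //; case/andP: (G01 w).
have sq (k : cfg S -> R) (u v r : cfg S -> R) : (forall w, 0 <= k w) ->
   (forall w, u w = v w + r w \/ u w = v w - r w) -> nrm k u <= 2 * nrm k v + 2 * nrm k r.
  move=> k0 uvr; rewrite /nrm -!meanZ -meanD; apply: ler_mean => w.
  have := mulr_ge0 (k0 w) (sqr_ge0 (v w - r w)).
  have := mulr_ge0 (k0 w) (sqr_ge0 (v w + r w)).
  by case: (uvr w) => ->; lra.
(* [F] and [avg s F] are exchanged twice, up to [D] and a factor 2 each time; with a <= 1 this gives
   6 = 2 + 2 * 2 and 4 = 2 * 2. *)
have b1 : nrm h F <= 2 * nrm h D + 2 * nrm h (avg s F).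
  by apply: sq => // w; left; rewrite /D; ring.
have b2 : nrm (fun w => h w * G w) (avg s F) <= 2 * nrm (fun w => h w * G w) F
    + 2 * nrm (fun w => h w * G w) D.
  by apply: sq => // w; right; rewrite /D; ring.
have n0 := nrm_ge0 D h0.
rewrite ler_pdivlMl //.
have : a * nrm h D <= nrm h D by rewrite ler_piMl.
nra.
Qed.

End Averages.

(** * Relaxation from a vacancy *)

Section Reach.
Variables (R : realType) (S : finType) (q : R).
Hypothesis hq : 0 < q < 1.
Variables (c : S -> cfg S -> bool) (key : S -> nat).
Implicit Types (f g h : cfg S -> R) (x y : S) (w : cfg S) (s t Y Z : seq S).
Implicit Types (U : pred S) (T : R).

Let q0 : 0 < q. Proof. by case/andP: hq. Qed.

Definition energy h f x : R :=
  nrm q (fun w => h w * (c x w)%:R) (fun w => f w - mean_at q x f w).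

Lemma energy_ge0 h f x : (forall w, 0 <= h w) -> 0 <= energy h f x.
Proof. by move=> h0; apply: nrm_ge0 => // w; rewrite mulr_ge0. Qed.

Lemma energyDh h h' f x :
  energy (fun w => h w + h' w) f x = energy h f x + energy h' f x.
Proof. by rewrite /energy -nrmDh; apply: eq_mean => w; ring. Qed.

Definition zero x w : R := (~~ w x)%:R.

Lemma indep_zero x y : y != x -> indep y (zero x).
Proof. by move=> nyx b w; rewrite /zero set_at_neq // eq_sym. Qed.

Lemma zero_ge0 x w : 0 <= zero x w. Proof. exact: ler0n. Qed.

(* A vacancy at [x] allows the chain restricted to the sites of [U] above [x]
   to relax the block [Z] in a time [T]; the weight [h] freezes an arbitrary
   event depending on the sites up to [x]. *)
Definition reach U x Z T := forall f h, (forall w, 0 <= h w) ->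
  (forall y, (key x < key y)%N -> indep y h) ->
  nrm q (fun w => h w * zero x w) (fun w => f w - avg q Z f w) <=
  T * \sum_(y | U y && (key x < key y)%N) energy (fun w => h w * zero x w) f y.

Lemma key_neq x y : (key x < key y)%N -> y != x.
Proof. by apply: contraTneq => ->; rewrite ltnn. Qed.

Lemma reach_mono U U' x Z T T' : (forall y, U y -> U' y) -> T <= T' -> 0 <= T ->
  reach U x Z T -> reach U' x Z T'.
Proof.
move=> UU' TT' T0 H f h h0 hi; apply: le_trans (H f h h0 hi) _.
have e0 y : 0 <= energy (fun w => h w * zero x w) f y.
  by apply: energy_ge0 => w; rewrite mulr_ge0 ?zero_ge0.
apply: ler_pM => //; first exact: sumr_ge0.
rewrite big_mkcond [leRHS]big_mkcond; apply: ler_sum => y _.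
case: (boolP (U y)) => [/UU' ->//|_ /=]; by case: ifP.
Qed.

Lemma indep_h_zero x h y : (forall y, (key x < key y)%N -> indep y h) ->
  (key x < key y)%N -> indep y (fun w => h w * zero x w).
Proof.
by move=> hi xy; apply: indep_mul; [exact: hi | exact/indep_zero/key_neq].
Qed.

Lemma reach_sub U x Z Z' T : {subset Z' <= Z} ->
  (forall z, z \in Z -> (key x < key z)%N) -> reach U x Z T -> reach U x Z' T.
Proof.
move=> ZZ' xZ H f h h0 hi; apply: le_trans (H f h h0 hi).
apply: nrm_var_sub => // [w|z /xZ]; first by rewrite mulr_ge0 ?zero_ge0.
exact: indep_h_zero.
Qed.

Lemma reach_sum U x Z T : (forall z, z \in Z -> (key x < key z)%N) ->
  (forall z, z \in Z -> reach U x [:: z] T) -> reach U x Z ((size Z)%:R * T).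
Proof.
move=> xZ H f h h0 hi.
have hz z : z \in Z -> indep z (fun w => h w * zero x w).
  by move/xZ; exact: indep_h_zero.
apply: le_trans (nrm_var_sum _ _ _ _) _ => // [w|].
  by rewrite mulr_ge0 ?zero_ge0.
rewrite -mulrA mulr_natl -[X in _ *+ X]sum1_size -sumrMnr big_seq [leRHS]big_seq.
by apply: ler_sum => z zZ; rewrite mulr1n; exact: (H _ zZ).
Qed.

Lemma reach_adj U x y : (key x < key y)%N -> U y ->
  (forall w, ~~ w x -> c y w) -> reach U x [:: y] 1.
Proof.
move=> xy Uy xcy f h h0 hi.
rewrite mul1r (bigD1 y) /= ?Uy // -[leLHS]addr0; apply: lerD.
  apply: ler_nrmh => // w; rewrite /zero; have := h0 w.
  by case: (boolP (w x)) => [|/xcy ->]; rewrite ?mulr0 ?mul0r ?mulr1.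
by apply: sumr_ge0 => z _; apply: energy_ge0 => w; rewrite mulr_ge0 ?zero_ge0.
Qed.

Definition some_zero Y w : R := (has (fun y => ~~ w y) Y)%:R.

Lemma avg_some_zero Y : uniq Y ->
  avg q Y (some_zero Y) =1 fun _ => 1 - (1 - q) ^+ size Y.
Proof.
move=> uY w.
have -> : some_zero Y = fun w => 1 - (all (fun y => w y) Y)%:R.
  apply: funext => w'; rewrite /some_zero -[has _ _]negbK -all_predC.
  rewrite (eq_all (a2 := fun y => w' y)); last by move=> y /=; rewrite negbK.
  by case: all; rewrite ?subrr ?subr0.
rewrite avgB avg_cst; congr (_ - _).
elim: Y uY w => // y Y IH /= /andP[yY uY] w.
have -> : avg q Y (fun w => (w y && all (fun y => w y) Y)%:R : R) =
   fun w => (w y)%:R * (1 - q) ^+ size Y.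
  apply: funext => w'; rewrite -(IH uY w').
  rewrite -(@avg_pull R S q Y _ (fun w => (w y)%:R)); last first.
    move=> x xY b w''; rewrite set_at_neq //.
    by apply: contraNneq yY => ->.
  by congr (avg q Y _ w'); apply: funext => w''; rewrite -mulnb natrM.
by rewrite /mean_at !set_at_eq exprS /= mul1r mul0r mulr0 addr0.
Qed.

(* Decomposition according to the lowest vacancy of [Y]: the sites that this
   event reveals are below those needed to relax [Z]. *)
Lemma nrm_some_zero U (P : pred S) Y Z T f h : 0 <= T ->
  sorted (fun y y' => (key y <= key y')%N) Y ->
  (forall w, 0 <= h w) ->
  (forall y x, y \in Y -> (key y < key x)%N -> indep x h) ->
  (forall y x, y \in Y -> U x -> (key y < key x)%N -> P x) ->
  (forall y, y \in Y -> reach U y Z T) ->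
  nrm q (fun w => h w * some_zero Y w) (fun w => f w - avg q Z f w) <=
  T * \sum_(x | P x) energy h f x.
Proof.
move=> T0; elim: Y h => [|y Y IH] h sY h0 hi UP H.
  rewrite [X in X <= _](_ : _ = 0); last first.
    by rewrite /nrm -[RHS](@mean_cst R S q); apply: eq_mean => w; rewrite /some_zero /= mulr0 mul0r.
  by rewrite mulr_ge0 // sumr_ge0 // => x _; exact: energy_ge0.
have yY : y \in y :: Y by rewrite mem_head.
have YY z : z \in Y -> z \in y :: Y by rewrite inE => ->; rewrite orbT.
have -> : (fun w => h w * some_zero (y :: Y) w) =
   fun w => h w * zero y w + h w * (w y)%:R * some_zero Y w.
  apply: funext => w; rewrite /some_zero /zero /=.
  by case: (w y) => /=; rewrite ?mulr0 ?mulr1 ?add0r ?mul0r ?addr0.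
(* The weights of the two cases sum to [h], hence so do the energies: the recursion over [Y] keeps
   the same constant [T]. *)
have hE w : h w = h w * zero y w + h w * (w y)%:R.
  by rewrite /zero; case: (w y); rewrite ?mulr0 ?mulr1 ?addr0 ?add0r.
have e0 k f' x : (forall w, 0 <= k w) -> 0 <= energy k f' x by exact: energy_ge0.
rewrite nrmDh (_ : energy h f = fun x => energy (fun w => h w * zero y w) f x
    + energy (fun w => h w * (w y)%:R) f x); last first.
  by apply: funext => x; rewrite -energyDh; congr energy; apply: funext.
rewrite big_split mulrDr /=; apply: lerD.
  apply: le_trans (H y yY f h h0 (fun x => @hi y x yY)) _.
  apply: ler_wpM2l => //; rewrite big_mkcond [leRHS]big_mkcond.
  apply: ler_sum => x _; have z0 : 0 <= energy (fun w => h w * zero y w) f x.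
    by apply: e0 => w; rewrite mulr_ge0 ?zero_ge0.
  case: ifP => [/andP[Ux yx]|_]; last by case: ifP.
  by rewrite (UP y x).
apply: IH => //.
- exact: (path_sorted sY).
- by move=> w; rewrite mulr_ge0.
(* By sortedness a site strictly above [z] is strictly above [y], so having revealed a one at [y] is
   an admissible weight for the later vacancies. *)
- move=> z x zY zx; apply: indep_mul; first by apply: (hi z) => //; exact: YY.
  move=> b w; rewrite set_at_neq //; apply: contraTneq zx => <-.
  have tr : transitive (fun y y' : S => (key y <= key y')%N).
    by move=> ? ? ?; exact: leq_trans.
  by rewrite -leqNgt; have /allP := order_path_min tr sY; apply.
- by move=> z x /YY; exact: UP.
- by move=> z /YY; exact: H.
Qed.

Lemma nrm_some_zero_unsorted U (P : pred S) Y Z T f h : 0 <= T ->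
  (forall w, 0 <= h w) ->
  (forall y x, y \in Y -> (key y < key x)%N -> indep x h) ->
  (forall y x, y \in Y -> U x -> (key y < key x)%N -> P x) ->
  (forall y, y \in Y -> reach U y Z T) ->
  nrm q (fun w => h w * some_zero Y w) (fun w => f w - avg q Z f w) <=
  T * \sum_(x | P x) energy h f x.
Proof.
move=> T0 h0 hi UP H.
pose Y' := sort (fun y y' => (key y <= key y')%N) Y.
have YE : Y' =i Y by move=> y; rewrite mem_sort.
rewrite (_ : some_zero Y = some_zero Y').
  apply: (nrm_some_zero (U := U)) => //.
  - by apply: sort_sorted => y y'; exact: leq_total.
  - by move=> y x; rewrite YE; exact: hi.
  - by move=> y x; rewrite YE; exact: UP.
  - by move=> y; rewrite YE; exact: H.
by apply: funext => w; rewrite /some_zero (eq_has_r YE).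
Qed.

(** [nrm_two_block] for the event that [Y] contains a vacancy: both terms are at most [T] times the
    energy, and 10 = 6 + 4. *)
Lemma reach_trans U x Y Z T a : 0 <= T -> uniq Y ->
  0 < a -> a <= 1 - (1 - q) ^+ size Y ->
  (forall y, y \in Y -> (key x < key y)%N) ->
  (forall z, z \in Z -> (key x < key z)%N) ->
  reach U x Y T -> (forall y, y \in Y -> reach U y Z T) ->
  reach U x Z (10 / a * T).
Proof.
move=> T0 uY a0 aY xY xZ HY HZ f h h0 hi.
pose k w := h w * zero x w.
have k0 w : 0 <= k w by rewrite mulr_ge0 ?zero_ge0.
have ki y : (key x < key y)%N -> indep y k by exact: indep_h_zero.
have aY0 : 0 < 1 - (1 - q) ^+ size Y by exact: lt_le_trans aY.
have := @nrm_two_block R S q hq Y Z k (some_zero Y) f _ k0 _ _ _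
  (avg_some_zero uY) aY0.
move=> /(_ (fun y yY => ki y (xY y yY)) (fun z zZ => ki z (xZ z zZ))).
have G01 w : 0 <= some_zero Y w <= 1.
  by rewrite /some_zero; case: has; rewrite /= lexx ler01.
move=> /(_ G01) /le_trans; apply.
set E := \sum_(_ | _) _.
have E0 : 0 <= E by apply: sumr_ge0 => y _; exact: energy_ge0.
have h1 : nrm q k (fun w => f w - avg q Y f w) <= T * E by exact: HY.
have h2 : nrm q (fun w => k w * some_zero Y w) (fun w => f w - avg q Z f w) <= T * E.
  apply: (nrm_some_zero_unsorted (U := U)) => //.
    by move=> y z yY yz; apply: ki; exact: ltn_trans (xY _ yY) yz.
  by move=> y z yY -> yz; exact: ltn_trans (xY _ yY) yz.
have TE0 : 0 <= T * E by exact: mulr_ge0.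
rewrite (_ : 10 / a * T * E = a^-1 * (10 * (T * E))); last by ring.
apply: ler_pM; first by rewrite invr_ge0 ltW.
- apply: addr_ge0; apply: mulr_ge0 => //; apply: nrm_ge0 => // w.
  by rewrite mulr_ge0 //; case/andP: (G01 w).
- by rewrite lef_pV2.
by lra.
Qed.

Lemma reach_trans1 U x y Z T : 0 <= T -> (key x < key y)%N ->
  (forall z, z \in Z -> (key x < key z)%N) ->
  reach U x [:: y] T -> reach U y Z T -> reach U x Z (10 / q * T).
Proof.
move=> T0 xy xZ Hy HZ; apply: (reach_trans (Y := [:: y])) => //.
- by rewrite expr1 opprB addrC subrK.
- by move=> z; rewrite inE => /eqP ->.
- by move=> z; rewrite inE => /eqP ->.
Qed.

(** Start of the propagation, with no vacancy given. The unconstrained site [o] plays the role of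
    the block [Y], and its own energy term relaxes it. *)
Lemma reach_free U o Z T f : 1 <= T -> U o -> (forall w, c o w) ->
  (forall z, z \in Z -> (key o < key z)%N) ->
  reach U o Z T ->
  nrm q (fun _ => 1) (fun w => f w - avg q Z f w) <=
  10 / q * T * \sum_(x | U x) energy (fun _ => 1) f x.
Proof.
move=> T1 Uo co oZ H.
have i1 y : indep y (fun _ : cfg S => 1 : R) by [].
have T0 : 0 <= T by exact: le_trans T1.
have G01 w : 0 <= some_zero [:: o] w <= 1.
  by rewrite /some_zero; case: has; rewrite /= lexx ler01.
have a0 : 0 < 1 - (1 - q) ^+ size [:: o] by rewrite expr1 opprB addrC subrK.
have := @nrm_two_block R S q hq [:: o] Z _ (some_zero [:: o]) f _ (fun _ => ler01)
  (fun y _ => i1 y) (fun y _ => i1 y) G01 (avg_some_zero (Y := [:: o]) isT) a0.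
move=> /le_trans; apply.
set E := \sum_(_ | _) _.
have e0 x : 0 <= energy (fun=> 1) f x by exact: energy_ge0.
have E0 : 0 <= E by apply: sumr_ge0.
have h1 : nrm q (fun=> 1) (fun w => f w - avg q [:: o] f w) <= E.
  rewrite /E (bigD1 o) //= -[leLHS]addr0; apply: lerD; last exact: sumr_ge0.
  by apply: ler_nrmh => // w; rewrite co mulr1.
have h2 : nrm q (fun w => 1 * some_zero [:: o] w) (fun w => f w - avg q Z f w)
    <= T * E.
  apply: (nrm_some_zero_unsorted (U := U)) => // y; rewrite inE => /eqP -> //.
have h3 : E <= T * E by rewrite ler_peMl.
have TE0 : 0 <= T * E by exact: mulr_ge0.
rewrite (_ : 10 / q * T * E = q^-1 * (10 * (T * E))); last by ring.
rewrite expr1 opprB addrC subrK; apply: ler_wpM2l; first by rewrite invr_ge0 ltW.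
by lra.
Qed.

End Reach.

(** * Chains of blocks *)

Section Chain.
Variables (R : realType) (S : finType) (q : R).
Hypothesis hq : 0 < q < 1.
Implicit Types (f g h B : cfg S -> R) (x : S) (s t : seq S).

Notation nrm1 := (nrm q (fun _ => 1)).

(** Conditional Cauchy-Schwarz: averaging over [s] what happens on an event of conditional
    probability at most [e] gains the factor [e] on the squared norm. *)
Lemma nrm1_avg_weight s B (e : R) f : (forall w, 0 <= B w <= 1) ->
  0 < e -> (exists2 e', e' <= e & avg q s B =1 fun _ => e') ->
  nrm1 (avg q s (fun w => B w * f w)) <= e * nrm1 f.
Proof.
move=> B01 e0 [e' e'e Be]; set u := avg _ _ _.
have i1 : {in s, forall x, indep x (fun _ : cfg S => 1 : R)} by [].
have e1 : nrm1 u = mean q (fun w => u w * (B w * f w)).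
  have := mean_avg_orth q (fun w => B w * f w) (fun w => B w * f w) i1.
  rewrite -/u => H; rewrite /nrm.
  transitivity (mean q (fun w => 1 * u w * u w)); first by apply: eq_mean => w; ring.
  by rewrite -H; apply: eq_mean => w; ring.
have e2 : mean q (fun w => u w ^+ 2 * B w) = e' * nrm1 u.
  rewrite -(mean_avg _ s) /nrm -meanZ; apply: eq_mean => w.
  rewrite (@avg_pull _ _ _ s B (fun w => u w ^+ 2)) ?Be; first by ring.
  by move=> x xs b w'; rewrite /u indep_avg_mem.
have e3 : 2 * mean q (fun w => u w * (B w * f w)) <=
    e^-1 * mean q (fun w => u w ^+ 2 * B w) + e * nrm1 f.
  rewrite /nrm -!meanZ -meanD; apply: ler_mean => // w; rewrite mul1r.
  have /andP[b0 b1] := B01 w.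
  have h1 : 0 <= B w * (e^-1 * (u w - e * f w) ^+ 2).
    by apply: mulr_ge0 => //; apply: mulr_ge0; [rewrite invr_ge0 ltW | exact: sqr_ge0].
  have h2 : B w * (e * f w ^+ 2) <= e * f w ^+ 2.
    by rewrite ler_piMl //; apply: mulr_ge0; [exact: ltW | exact: sqr_ge0].
  have h3 : B w * (e^-1 * (u w - e * f w) ^+ 2) = e^-1 * (u w ^+ 2 * B w)
     - 2 * (u w * (B w * f w)) + B w * (e * f w ^+ 2).
    by field; rewrite gt_eqF.
  by lra.
have n0 : 0 <= nrm1 u by exact: nrm_ge0.
have e4 : e^-1 * (e' * nrm1 u) <= nrm1 u.
  by rewrite ler_pdivrMl // ler_wpM2r.
by move: e3; rewrite -e1 e2; lra.
Qed.

Lemma ler_nrm1D f g : nrm1 (fun w => f w + g w) <= 2 * nrm1 f + 2 * nrm1 g.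
Proof.
rewrite /nrm -!meanZ -meanD; apply: ler_mean => // w; rewrite !mul1r.
by have := sqr_ge0 (f w - g w); lra.
Qed.

Variable W : nat -> seq S.

Fixpoint blocks_below j : seq S :=
  if j is k.+1 then W k ++ blocks_below k else [::].

(** Here [s] is a block, [t] the blocks below, [r] the next block and [B] its bad event. In [key],
    the good event contributes a restricted fluctuation of [f] over [r], and the bad event only a
    fluctuation over [s], weighted by e <= 1/8. The constant 49/64 is (1 - 1/8)^2. *)
Lemma chain_step t s r B e f : (forall w, 0 <= B w <= 1) ->
  e <= 8^-1 -> avg q s B =1 (fun _ => e) ->
  {in t, forall x, indep x B} ->
  49 / 64 * nrm1 (fun w => avg q (s ++ t) f w - avg q r (avg q (s ++ t) f) w) <=
  2 * nrm q (fun w => 1 - B w) (fun w => f w - avg q r f w)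
  + 4^-1 * nrm1 (fun w => avg q t f w - avg q s (avg q t f) w).
Proof.
move=> B01 e8 Be tB.
pose phi w := f w - avg q r f w.
pose psi := avg q t phi.
pose D w := avg q (s ++ t) f w - avg q r (avg q (s ++ t) f) w.
have DE : D = avg q s psi.
  apply: funext => w; rewrite /D /psi -(avg_cat _ s t) /phi avgB; congr (_ - _).
  by rewrite avgC.
have psiE : psi = fun w => avg q t f w - avg q r (avg q t f) w.
  by apply: funext => w; rewrite /psi /phi avgB avgC.
pose eta w := psi w - avg q s psi w.
have i1 : forall s, {in s, forall x, indep x (fun _ : cfg S => 1 : R)} by [].
have key : (fun w => (1 - e) * D w) =
    fun w => avg q (s ++ t) (fun w => (1 - B w) * phi w) w
             + avg q s (fun w => B w * eta w) w.
  apply: funext => w; rewrite DE avg_cat.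
  have -> : avg q t (fun w => (1 - B w) * phi w) = fun w => psi w - B w * psi w.
    apply: funext => w'; rewrite (@avg_pull _ _ _ t phi (fun w => 1 - B w)).
      by rewrite -/psi; ring.
    by move=> x xt b w''; rewrite tB.
  have -> : (fun w => B w * eta w) = fun w => B w * psi w - avg q s psi w * B w.
    by apply: funext => w'; rewrite /eta; ring.
  rewrite !avgB (@avg_pull _ _ _ s B (avg q s psi)) ?Be; first by ring.
  by move=> x xs; exact: indep_avg_mem.
have a1 : nrm1 (avg q (s ++ t) (fun w => (1 - B w) * phi w)) <=
    nrm q (fun w => 1 - B w) phi.
  apply: le_trans (nrm_avg_le _ _ _ _) _ => //.
  apply: ler_mean => // w; have /andP[b0 b1] := B01 w.
  have b1' : 0 <= 1 - B w by rewrite subr_ge0.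
  by have := mulr_ge0 (mulr_ge0 b0 b1') (sqr_ge0 (phi w)); lra.
have a2 : nrm1 (avg q s (fun w => B w * eta w)) <= 8^-1 * nrm1 eta.
  by apply: nrm1_avg_weight => //; exists e.
have a3 : nrm1 eta <= nrm1 (fun w => avg q t f w - avg q s (avg q t f) w).
  rewrite (_ : nrm1 eta = nrm1 (fun w => (avg q t f w - avg q s (avg q t f) w)
    - avg q r (fun w => avg q t f w - avg q s (avg q t f) w) w)).
    exact: nrm_sub_avg_le.
  apply: eq_mean => w; rewrite /eta psiE !avgB (avgC q s r).
  by congr (_ * _ ^+ 2); ring.
have a4 : (1 - e) ^+ 2 * nrm1 D <= 2 * nrm q (fun w => 1 - B w) phi
    + 2 * (8^-1 * nrm1 eta).
  rewrite (_ : _ * nrm1 D = nrm1 (fun w => (1 - e) * D w)); last first.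
    by rewrite /nrm -meanZ; apply: eq_mean => w; ring.
  by rewrite key; apply: le_trans (ler_nrm1D _ _) _; lra.
have n0 : 0 <= nrm1 D by exact: nrm_ge0.
have h2 : 49 / 64 <= (1 - e) ^+ 2 by nra.
have h3 : 49 / 64 * nrm1 D <= (1 - e) ^+ 2 * nrm1 D by rewrite ler_wpM2r.
by rewrite -/phi; move: h3 a4 a3; rewrite /D; lra.
Qed.

(* A chain of blocks in which each block is allowed to relax when the previous
   one is not in its bad event has a spectral gap bounded away from zero as soon
   as the bad events have probability at most 1/8. *)
Lemma chain_gap n (B : nat -> cfg S -> R) f :
  (forall j w, 0 <= B j w <= 1) ->
  B 0%N =1 (fun _ => 0) ->
  (forall j, (j.+1 < n)%N ->
     exists2 e, e <= 8^-1 & avg q (W j) (B j.+1) =1 fun _ => e) ->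
  (forall j, (j.+1 < n)%N ->
     {in blocks_below j, forall x, indep x (B j.+1)}) ->
  (forall x, x \in blocks_below n) ->
  Defs.variance q f <=
  4 * \sum_(j < n) nrm q (fun w => 1 - B j w) (fun w => f w - avg q (W j) f w).
Proof.
move=> B01 B0 eB iB WT.
pose F j := avg q (blocks_below j) f.
pose a j := nrm1 (fun w => F j w - avg q (W j) (F j) w).
pose b j := nrm q (fun w => 1 - B j w) (fun w => f w - avg q (W j) f w).
have a0 j : 0 <= a j by exact: nrm_ge0.
have b0 j : 0 <= b j.
  by apply: nrm_ge0 => // w; have /andP[_] := B01 j w; lra.
(* Martingale decomposition: [a j] is the variance carried by block [j] once the blocks below it
   have been averaged. *)
have tel m : nrm1 f = nrm1 (F m) + \sum_(j < m) a j.
  elim: m => [|m ->]; first by rewrite big_ord0 addr0.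
  have -> : nrm1 (F m) = nrm1 (F m.+1) + a m.
    by rewrite [LHS](@nrm_pyth _ _ _ (W m)) // [F m.+1]avg_cat.
  by rewrite big_ord_recr /=; ring.
have varE : Defs.variance q f = \sum_(j < n) a j.
  rewrite /Defs.variance (_ : mean q (fun w => f w ^+ 2) = nrm1 f); last first.
    by apply: eq_mean => w; rewrite mul1r.
  have -> : nrm1 f = mean q f ^+ 2 + \sum_(j < n) a j.
    rewrite (tel n); congr (_ + _).
    rewrite /nrm -[RHS](@mean_cst R S q); apply: eq_mean => w.
    by rewrite mul1r /F avg_all.
  by ring.
rewrite varE.
(* The surplus a_m / 2 absorbs the a_m / 4 of [chain_step], since 3/2 * 64/49 < 2; the bound 1/8 on
   the bad events leaves this room. *)
have main m : (m < n)%N -> \sum_(j < m.+1) a j + 2^-1 * a m <= 4 * \sum_(j < m.+1) b j.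
  elim: m => [_|m IH mn].
    rewrite !big_ord1 (_ : b 0%N = a 0%N); last first.
      by apply: eq_mean => w; rewrite B0 subr0.
    by have := a0 0%N; lra.
  rewrite big_ord_recr [in leRHS]big_ord_recr /=.
  have := IH (ltnW mn).
  have [e e8 Be] := eB m mn.
  have := @chain_step (blocks_below m) (W m) (W m.+1) (B m.+1) e f (B01 _) e8 Be (iB m mn).
  rewrite -/(a m) -[nrm1 _]/(a m.+1) -/(b m.+1).
  have := a0 m.+1; have := b0 m.+1; have := a0 m; lra.
case: n {varE WT eB iB} main => [_|n main]; first by rewrite !big_ord0 mulr0.
by apply: le_trans (main n (ltnSn n)); rewrite lerDl mulr_ge0.
Qed.

End Chain.

(** * Moving a vacancy *)

Ltac nat_lia :=
  repeat match goal with
  | H : is_true (leq _ _) |- _ => revert H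
  | H : is_true (andb (leq _ _) (leq _ _)) |- _ => revert H
  | H : @eq nat _ _ |- _ => revert H
  end; clear; lia.

Section Gadgets.
Variables (R : realType) (d : nat) (q : R).
Hypothesis hq : 0 < q < 1.
Implicit Types (x y z u : site d) (V : {fset site d}) (T : R).

Let q0 : 0 < q. Proof. by case/andP: hq. Qed.
Let q1 : q < 1. Proof. by case/andP: hq. Qed.

(** The l1 norm. A site is facilitated only by sites of norm one less, which makes it a suitable
    [key] for [reach]. *)
Definition rank x : nat := (\sum_(i < d) x i)%N.

Lemma rank_origin : rank (origin d) = 0%N.
Proof. by rewrite /rank big1 // => i _; rewrite ffunE. Qed.

Definition sle x y : bool := [forall i, (x i <= y i)%N].

Lemma sle_refl x : sle x x. Proof. by apply/forallP. Qed.

Lemma sle_trans y x z : sle x y -> sle y z -> sle x z.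
Proof.
by move=> /forallP xy /forallP yz; apply/forallP => i; exact: leq_trans (yz i).
Qed.

Lemma sle_rank x y : sle x y -> (rank x <= rank y)%N.
Proof. by move=> /forallP xy; apply: leq_sum. Qed.

Lemma rank_shift i x : rank (shift i x) = (rank x).+1.
Proof.
rewrite /rank (bigD1 i) //= [in RHS](bigD1 i) //= ffunE eqxx addn1 addSn.
by congr (_ + _).+1; apply: eq_bigr => j ji; rewrite ffunE (negPf ji) addn0.
Qed.

Definition vkey V (v : V) : nat := rank (val v).

Definition vreach V := @reach R V q (@east_constraint d V) (@vkey V).

Definition lift_seq V (s : seq (site d)) : seq V := enum [pred v : V | val v \in s].

Lemma mem_lift V s v : (v \in lift_seq V s) = (val v \in s).
Proof. by rewrite mem_enum. Qed.

Lemma size_lift V s : uniq s -> {subset s <= V} -> size (lift_seq V s) = size s.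
Proof.
move=> us sV; rewrite -(size_map val); apply/perm_size/uniq_perm => //.
  by rewrite map_inj_uniq ?enum_uniq //; exact: val_inj.
move=> x; apply/mapP/idP => [[v]|xs]; first by rewrite mem_lift => vs ->.
by exists [` sV x xs]%fset => //; rewrite mem_lift.
Qed.

(* [U] is the set of sites used to bring a vacancy from [x] to [z], in a time
   [T]; in the same way each site of [U] is reached in a time [T']. *)
Definition gadget_on (U : seq (site d)) x z T T' :=
  [/\ uniq U, z \in U, (forall u, u \in U -> [/\ sle x u, sle u z & (rank x < rank u)%N])
    & forall V, x \in V -> {subset U <= V} -> forall vx vu : V, val vx = x ->
      val vu \in U -> vreach (fun v => val v \in U) vx [:: vu] T' /\
      (val vu = z -> vreach (fun v => val v \in U) vx [:: vu] T)].

(** The sites used are hidden, but the estimates hold in every [V] that contains them, so several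
    gadgets can share one [V]. *)
Definition gadget x z T T' := exists U, gadget_on U x z T T'.

Lemma gadget_mono x z T1 T1' T T' : 0 <= T1 -> 0 <= T1' -> T1 <= T -> T1' <= T' ->
  gadget x z T1 T1' -> gadget x z T T'.
Proof.
move=> T10 T10' TT TT' [U [uU zU xUz H]]; exists U; split=> // V xV UV vx vu ex vuU.
have [h1 h2] := H V xV UV vx vu ex vuU; split; first exact: reach_mono h1.
by move=> /h2; exact: reach_mono.
Qed.

Lemma gadget_rank x z T T' : gadget x z T T' -> (rank x < rank z)%N.
Proof. by move=> [U [_ zU /(_ _ zU)[]]]. Qed.

Lemma gadget_shift i x : gadget x (shift i x) 1 1.
Proof.
exists [:: shift i x]; split=> //; first by rewrite mem_head.
  move=> u; rewrite inE => /eqP ->; split; last by rewrite rank_shift.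
    by apply/forallP => j; rewrite ffunE leq_addr.
  exact: sle_refl.
move=> V xV UV vx vu ex; rewrite inE => /eqP eu.
have H : vreach (fun v => val v \in [:: shift i x]) vx [:: vu] 1.
  apply: reach_adj => //; first by rewrite /vkey ex eu rank_shift.
    by rewrite inE eu.
  move=> w nw; apply/orP; right; apply/existsP; exists vx.
  by apply/existsP; exists i; rewrite nw ex eu eqxx.
by [].
Qed.

(** Gadgets join all pairs of sites of consecutive blocks, because the vacancy found in a block may
    be at any of its sites. *)
Definition gchain (B : nat -> seq (site d)) (N K : nat) T T' :=
  (forall j, (j <= N)%N -> [/\ uniq (B j), B j != [::] & (size (B j) <= K)%N]) /\
  (forall j y y', (j < N)%N -> y \in B j -> y' \in B j.+1 -> gadget y y' T T').

Definition layer (U : site d * site d -> seq (site d)) (B : nat -> seq (site d)) j :=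
  flatten [seq U (y, y') | y <- B j, y' <- B j.+1].

Lemma layerP U B j u :
  reflect (exists y y', [/\ y \in B j, y' \in B j.+1 & u \in U (y, y')])
    (u \in layer U B j).
Proof.
apply: (iffP flattenP) => [[s /allpairsP[[y y'] /= [yB y'B ->]] uU]|].
  by exists y, y'.
by move=> [y [y' [yB y'B uU]]]; exists (U (y, y')) => //; apply/allpairsP; exists (y, y').
Qed.

Lemma gadget_choice T T' :
  exists U, forall y y', gadget y y' T T' -> gadget_on (U (y, y')) y y' T T'.
Proof.
have /choice[U HU] : forall p : site d * site d,
    exists U, gadget p.1 p.2 T T' -> gadget_on U p.1 p.2 T T'.
  move=> p; have [[U HU]|nG] := pselect (gadget p.1 p.2 T T'); first by exists U.
  by exists [::] => /nG.
by exists U => y y'; exact: (HU (y, y')).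
Qed.

Section GadgetChain.
Variables (B : nat -> seq (site d)) (N K : nat) (T T' : R).
Variables (U : site d * site d -> seq (site d)).
Hypothesis BN : gchain B N K T T'.
Hypothesis (T0 : 0 <= T) (T0' : 0 <= T').
Hypothesis UP : forall y y', gadget y y' T T' -> gadget_on (U (y, y')) y y' T T'.

Lemma gchain_gadget_on j y y' : (j < N)%N -> y \in B j -> y' \in B j.+1 ->
  gadget_on (U (y, y')) y y' T T'.
Proof. by move=> jN yB yB'; apply: UP; exact: BN.2 jN yB yB'. Qed.

Lemma gchain_mem j : (j <= N)%N -> exists y, y \in B j.
Proof.
by move=> /(proj1 BN)[_]; case: (B j) => // y s _ _; exists y; rewrite mem_head.
Qed.

Lemma gchain_le j j' y y' : (j < j' <= N)%N -> y \in B j -> y' \in B j' ->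
  sle y y' && (rank y < rank y')%N.
Proof.
elim: j' y' => // j' IH y' /andP[]; rewrite ltnS leq_eqVlt => /orP[/eqP <-|jj'] jN yB yB'.
  have [_ zU /(_ _ zU)[-> _ ->] _] // := gchain_gadget_on jN yB yB'.
have [y1 y1B] := gchain_mem (ltnW jN).
have [_ zU /(_ _ zU)[le2 _ lt2] _] := gchain_gadget_on jN y1B yB'.
have /andP[le1 lt1] : sle y y1 && (rank y < rank y1)%N.
  by apply: IH => //; rewrite jj' ltnW.
by rewrite (sle_trans le1) // (ltn_trans lt1).
Qed.

Variable (V : {fset site d}).
Hypothesis BV : {subset B 0%N <= V}.
Hypothesis UV : forall j, (j < N)%N -> {subset layer U B j <= V}.

Lemma gchain_blockV j : (j <= N)%N -> {subset B j <= V}.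
Proof.
case: j => [_|j jN] y yB; first exact: BV.
have [z zB] := gchain_mem (ltnW jN).
apply: (UV jN); apply/layerP; exists z, y; split=> //.
by have [] := gchain_gadget_on jN zB yB.
Qed.

Lemma gchain_reach_site (P : pred V) j (y u : V) y1 : (j < N)%N -> val y \in B j ->
  y1 \in B j.+1 -> val u \in U (val y, y1) ->
  (forall v : V, val v \in layer U B j -> P v) ->
  vreach P y [:: u] T' /\ (val u = y1 -> vreach P y [:: u] T).
Proof.
move=> jN yB y1B uU LP.
have [_ _ _ H] := gchain_gadget_on jN yB y1B.
have UsubV : {subset U (val y, y1) <= V}.
  by move=> v vU; apply: (UV jN); apply/layerP; exists (val y), y1.
have [h1 h2] := H V (valP y) UsubV y u erefl uU.
have sub : forall v : V, val v \in U (val y, y1) -> P v.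
  by move=> v vU; apply: LP; apply/layerP; exists (val y), y1.
split; first exact: reach_mono sub (lexx _) _ h1.
by move=> /h2; exact: reach_mono.
Qed.

Lemma gchain_reach_next (P : pred V) j (y u : V) : (j < N)%N -> val y \in B j ->
  val u \in B j.+1 -> (forall v : V, val v \in layer U B j -> P v) ->
  vreach P y [:: u] T.
Proof.
move=> jN yB uB LP.
have [_ uU _ _] := gchain_gadget_on jN yB uB.
by have [_ h] := gchain_reach_site jN yB uB uU LP; exact: h.
Qed.

Lemma lt_key j j' (y y' : V) : (j < j' <= N)%N -> val y \in B j ->
  val y' \in B j' -> (vkey y < vkey y')%N.
Proof. by move=> jj' yB yB'; have /andP[] := gchain_le jj' yB yB'. Qed.

Lemma ler1_invp (a : R) : 0 < a -> a <= 1 -> 1 <= 10 / a.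
Proof. by move=> a0 a1; rewrite ler_pdivlMr // mul1r; lra. Qed.

(** Bisection at block [j + 2 ^ k], each halving costing [10 / a] by [reach_trans]. The factor [K]
    arises only at the bottom of the recursion, where the sites of one block are relaxed
    separately. *)
Lemma gchain_reach_block (P : pred V) (a : R) k j n (y : V) :
  0 < a <= 1 ->
  (forall i, (0 < i < N)%N -> a <= 1 - (1 - q) ^+ size (B i)) ->
  (0 < n <= 2 ^ k)%N -> (j + n <= N)%N -> val y \in B j ->
  (forall l (v : V), (j <= l < j + n)%N -> val v \in layer U B l -> P v) ->
  vreach P y (lift_seq V (B (j + n))) ((10 / a) ^+ k * (K%:R * T)).
Proof.
move=> /andP[a0 a1] aB.
have a10 := ler1_invp a0 a1.
have pos m : 0 <= (10 / a) ^+ m * (K%:R * T).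
  by rewrite mulr_ge0 ?mulr_ge0 // exprn_ge0 // (le_trans ler01).
have one i (z : V) : (i < N)%N -> val z \in B i ->
    (forall v : V, val v \in layer U B i -> P v) ->
    vreach P z (lift_seq V (B i.+1)) (K%:R * T).
  move=> iN zB LP; have [uB _ sB] := BN.1 _ iN.
  apply: (@reach_mono _ _ _ hq _ _ P P z _ ((size (lift_seq V (B i.+1)))%:R * T)) => //.
  - by rewrite ler_wpM2r // ler_nat size_lift //; exact: gchain_blockV.
  - by rewrite mulr_ge0.
  apply: reach_sum => // v; rewrite mem_lift => vB.
    by apply: lt_key zB vB; rewrite ltnSn.
  exact: gchain_reach_next zB vB LP.
elim: k n j y => [|k IH] n j y /andP[n0 nk] jnN yB LP.
  have n1 : n = 1%N by apply/eqP; rewrite eqn_leq nk n0.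
  rewrite n1 addn1 expr0 mul1r; apply: one => // [|v]; first by nat_lia.
  by apply: LP; nat_lia.
have step m : (0 < m <= 2 ^ k)%N -> (m <= n)%N ->
    vreach P y (lift_seq V (B (j + m))) ((10 / a) ^+ k * (K%:R * T)).
  move=> mk mn; apply: IH => //; first by nat_lia.
  by move=> l v jl; apply: LP; nat_lia.
have [nk'|nk'] := leqP n (2 ^ k).
  apply: reach_mono (step n _ (leqnn n)) => //; last by rewrite n0.
  by rewrite exprS -mulrA ler_peMl.
have k0 : (0 < 2 ^ k)%N by rewrite expn_gt0.
have [m mE] : exists m, (2 ^ k + m.+1 = n)%N.
  by exists (n - 2 ^ k).-1; nat_lia.
have iN : (0 < j + 2 ^ k < N)%N by nat_lia.
have [uB _ sB] := BN.1 _ (ltnW (proj2 (andP iN))).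
have mk : (m.+1 <= 2 ^ k)%N by move: nk; rewrite expnS; nat_lia.
rewrite exprS -mulrA; apply: (@reach_trans _ _ _ hq _ _ P y
  (lift_seq V (B (j + 2 ^ k)))) => //.
- exact: enum_uniq.
- rewrite size_lift //; first exact: aB.
  by apply: gchain_blockV; nat_lia.
- by move=> v; rewrite mem_lift => vB; apply: lt_key yB vB; nat_lia.
- by move=> v; rewrite mem_lift => vB; apply: lt_key yB vB; nat_lia.
- by apply: step; nat_lia.
move=> z; rewrite mem_lift => zB; rewrite -mE addnA; apply: IH => //.
- by nat_lia.
- by move=> l v jl; apply: LP; nat_lia.
Qed.

(** Passing through one chosen site per block costs 1/q each time, whatever the blocks. Only a
    bounded number of such passages will be made. *)
Lemma gchain_reach_hop (P : pred V) n j (y u : V) : (j + n < N)%N -> val y \in B j ->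
  val u \in B (j + n).+1 ->
  (forall l (v : V), (j <= l <= j + n)%N -> val v \in layer U B l -> P v) ->
  vreach P y [:: u] ((10 / q) ^+ n * T).
Proof.
elim: n u => [|n IH] u jnN yB uB LP.
  rewrite expr0 mul1r; rewrite addn0 in jnN uB.
  by apply: gchain_reach_next uB _ => // v; apply: LP; nat_lia.
have [z zB] : exists z, z \in B (j + n).+1 by apply: gchain_mem; nat_lia.
have zV : z \in V by apply: gchain_blockV zB; nat_lia.
pose vz : V := [` zV]%fset.
have q10 := ler1_invp q0 (ltW q1).
have pos m : 0 <= (10 / q) ^+ m * T.
  by rewrite mulr_ge0 // exprn_ge0 // (le_trans ler01).
rewrite exprS -mulrA; apply: (@reach_trans1 _ _ _ hq _ _ P y vz) => //.
- by apply: (@lt_key j (j + n).+1) => //; nat_lia.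
- by move=> v; rewrite inE => /eqP ->; apply: lt_key yB uB; nat_lia.
- by apply: IH => //; [nat_lia | move=> l v jl; apply: LP; nat_lia].
apply: (@reach_mono _ _ _ hq _ _ P P vz _ T) => //.
  by rewrite ler_peMl // exprn_ege1.
rewrite addnS in jnN uB LP.
by apply: (gchain_reach_next (y := vz) jnN zB uB) => v; apply: LP; nat_lia.
Qed.

Lemma gchain_reach_site_hop (P : pred V) n j (y u : V) : ((j + n).+1 < N)%N ->
  val y \in B j -> val u \in layer U B (j + n).+1 ->
  (forall l (v : V), (j <= l <= (j + n).+1)%N -> val v \in layer U B l -> P v) ->
  vreach P y [:: u] ((10 / q) ^+ n.+1 * (T + T')).
Proof.
have q10 := ler1_invp q0 (ltW q1).
have TT0 : 0 <= T + T' by rewrite addr_ge0.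
have pos m T1 : 0 <= T1 -> 0 <= (10 / q) ^+ m * T1.
  by move=> ?; rewrite mulr_ge0 // exprn_ge0 // (le_trans ler01).
move=> jnN yB uL LP; have /layerP[y1 [y2 [y1B y2B uU]]] := uL.
have y1V : y1 \in V by apply: gchain_blockV y1B; nat_lia.
pose v1 : V := [` y1V]%fset.
have [_ _ /(_ _ uU)[_ _ lt1] _] := gchain_gadget_on jnN y1B y2B.
have yv1 : (vkey y < vkey v1)%N by apply: (@lt_key j (j + n).+1) => //; nat_lia.
rewrite exprS -mulrA; apply: (@reach_trans1 _ _ _ hq _ _ P y v1) => //.
- exact: pos.
- by move=> v; rewrite inE => /eqP ->; exact: ltn_trans yv1 lt1.
- apply: (@reach_mono _ _ _ hq _ _ P P _ _ ((10 / q) ^+ n * T)) => //.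
  + rewrite ler_wpM2l ?lerDl //; first by rewrite exprn_ge0 // (le_trans ler01).
  + exact: pos.
  by apply: (@gchain_reach_hop P n j) => // [|l v jl]; [nat_lia | apply: LP; nat_lia].
have LPn (v : V) : val v \in layer U B (j + n).+1 -> P v.
  by apply: LP; nat_lia.
have [h _] := gchain_reach_site jnN (y := v1) y1B y2B uU LPn.
apply: (@reach_mono _ _ _ hq _ _ P P _ _ T') => //.
apply: (@le_trans _ _ (T + T')); first by rewrite lerDr.
by rewrite ler_peMl // exprn_ege1.
Qed.

End GadgetChain.

(** The recursive step: a chain with point ends is a gadget of the next scale. An auxiliary site
    between two blocks is reached by first bringing a vacancy to a given site of the lower block,
    which costs the extra [10 / q] in the second time. *)
Lemma gchain_gadget (B : nat -> seq (site d)) N K k x z (a T T' : R) :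
  gchain B N K T T' -> 0 <= T -> 0 <= T' -> B 0%N = [:: x] -> B N = [:: z] ->
  0 < a <= 1 -> (0 < N <= 2 ^ k)%N ->
  (forall i, (0 < i < N)%N -> a <= 1 - (1 - q) ^+ size (B i)) ->
  gadget x z ((10 / a) ^+ k * (K%:R * T))
    (10 / q * ((10 / a) ^+ k * (K%:R * T) + T')).
Proof.
move=> BN T0 T0' B0 BNz a01 Nk aB.
have /andP[a0 a1] := a01.
have q10 := ler1_invp q0 (ltW q1).
have a10 := ler1_invp a0 a1.
have [U UP] := gadget_choice T T'.
pose tot := flatten [seq layer U B j | j <- iota 0 N].
have totP u : reflect (exists2 j, (j < N)%N & u \in layer U B j) (u \in tot).
  apply: (iffP flattenP) => [[s /mapP[j]]|[j jN uj]].
    by rewrite mem_iota add0n => jN -> uj; exists j.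
  by exists (layer U B j) => //; apply/mapP; exists j; rewrite ?mem_iota.
have xB : x \in B 0%N by rewrite B0 mem_head.
have zB : z \in B N by rewrite BNz mem_head.
set Tk := (10 / a) ^+ k * _.
have Tk0 : 0 <= Tk by rewrite mulr_ge0 ?mulr_ge0 // exprn_ge0 // (le_trans ler01).
have N0 : (0 < N)%N by case/andP: Nk.
have le_mid j u : (j < N)%N -> u \in layer U B j ->
    [/\ sle x u, sle u z & (rank x < rank u)%N].
  move=> jN /layerP[y [y' [yB y'B uU]]].
  have [_ _ /(_ _ uU)[le1 le2 lt1] _] := gchain_gadget_on BN UP jN yB y'B.
  have [sx rx] : sle x y /\ (rank x <= rank y)%N.
    case: j jN yB {y'B} => [_|j jN yB]; first by rewrite B0 inE => /eqP ->; rewrite sle_refl.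
    have j1N : (0 < j.+1 <= N)%N by nat_lia.
    by have /andP[? /ltnW ?] := gchain_le BN UP j1N xB yB.
  have sz : sle y' z.
    have [jN'|jN'] := ltnP j.+1 N.
      have jNN : (j.+1 < N <= N)%N by rewrite jN' leqnn.
      by have /andP[] := gchain_le BN UP jNN y'B zB.
    have jE : j.+1 = N by apply/eqP; rewrite eqn_leq jN jN'.
    by move: y'B; rewrite jE BNz inE => /eqP ->; rewrite sle_refl.
  by rewrite (sle_trans sx) ?(sle_trans le2) ?(leq_ltn_trans rx).
exists (undup tot); split.
- exact: undup_uniq.
- rewrite mem_undup; apply/totP.
  have [y yB] := gchain_mem BN (leq_pred N).
  have NN : (N.-1 < N)%N by rewrite prednK.
  have zB' : z \in B N.-1.+1 by rewrite prednK.
  exists N.-1 => //; apply/layerP; exists y, z; split=> //.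
  by have [] := gchain_gadget_on BN UP NN yB zB'.
- by move=> u; rewrite mem_undup => /totP[j jN]; exact: le_mid.
move=> V xV totV vx vu ex; rewrite mem_undup => vuT.
have BV : {subset B 0%N <= V} by rewrite B0 => y; rewrite inE => /eqP ->.
have UV j : (j < N)%N -> {subset layer U B j <= V}.
  by move=> jN u uj; apply: totV; rewrite mem_undup; apply/totP; exists j.
have vxB : val vx \in B 0%N by rewrite ex.
have LP l (v : V) : (l < N)%N -> val v \in layer U B l -> val v \in undup tot.
  by move=> lN vl; rewrite mem_undup; apply/totP; exists l.
have blk j : (0 < j <= N)%N -> vreach (fun v => val v \in undup tot) vx
    (lift_seq V (B j)) Tk.
  move=> /andP[j0 jN]; rewrite -[j]add0n.
  apply: (gchain_reach_block BN T0 T0' UP BV UV a01 aB) => //.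
    by rewrite j0 (leq_trans jN) //; case/andP: Nk.
  by move=> l v /andP[_]; rewrite add0n => lj; apply: LP; exact: leq_trans jN.
have tot_le (T1 : R) : 0 <= T1 -> T1 <= Tk + T' -> T1 <= 10 / q * (Tk + T').
  by move=> ? /le_trans; apply; rewrite ler_peMl // addr_ge0.
split; last first.
  have NN : (0 < N <= N)%N by rewrite N0 leqnn.
  move=> ez; apply: (reach_sub hq _ _ (blk N NN)).
    by move=> v; rewrite inE mem_lift => /eqP ->; rewrite ez.
  by move=> v; rewrite mem_lift => vB; exact: (lt_key BN UP NN vxB vB).
have /totP[j jN uj] := vuT.
have /layerP[y [y' [yB y'B uU]]] := uj.
have [_ _ /(_ _ uU)[_ _ lt1] _] := gchain_gadget_on BN UP jN yB y'B.
case: (posnP j) => [j0|j0].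
  move: yB; rewrite j0 B0 inE => /eqP yx.
  have y'B1 : y' \in B 1%N by rewrite -j0.
  have uU' : val vu \in U (val vx, y') by rewrite ex -yx.
  have LP0 (v : V) : val v \in layer U B 0%N -> val v \in undup tot by exact: LP.
  have [h _] := gchain_reach_site BN T0 T0' UP UV N0 vxB y'B1 uU' LP0.
  by apply: reach_mono h => //; apply: tot_le; rewrite // lerDr.
have yV : y \in V by apply: (gchain_blockV BN UP BV UV) yB; exact: ltnW.
pose vy : V := [` yV]%fset.
have xy : (vkey vx < vkey vy)%N.
  have j0N : (0 < j <= N)%N by rewrite j0 ltnW.
  by apply: (lt_key BN UP j0N vxB); exact: yB.
apply: (@reach_trans1 _ _ _ hq _ _ _ vx vy) => //.
- exact: addr_ge0.
- by move=> v; rewrite inE => /eqP ->; exact: ltn_trans xy lt1.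
- apply: (@reach_mono _ _ _ hq _ _ (fun v => val v \in undup tot) _ _ _ Tk) => //.
    by rewrite lerDl.
  have j0N : (0 < j <= N)%N by rewrite j0 ltnW.
  apply: (reach_sub hq _ _ (blk j j0N)).
    by move=> v; rewrite inE mem_lift => /eqP ->.
  by move=> v; rewrite mem_lift => vB; exact: (lt_key BN UP j0N vxB vB).
have [h _] := gchain_reach_site BN T0 T0' UP UV jN (y := vy) yB y'B uU (fun v => LP j v jN).
by apply: (@reach_mono _ _ _ hq _ _ (fun v => val v \in undup tot) _ _ _ T') => //; rewrite lerDr.
Qed.

End Gadgets.

(** * Spectral gap of chains of boxes *)

Section Gap.
Variables (R : realType) (q : R).
Hypothesis hq : 0 < q < 1.

Lemma variance_centered (S : finType) (f : cfg S -> R) :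
  variance q f = mean q (fun w => (f w - mean q f) ^+ 2).
Proof.
rewrite /variance; set m := mean q f.
transitivity (mean q (fun w => f w ^+ 2) - 2 * m * mean q f + m ^+ 2).
  by rewrite -/m; ring.
rewrite -(@mean_cst R S q (m ^+ 2)) -meanZ -meanB -meanD.
by apply: eq_mean => w; ring.
Qed.

Lemma variance_ge0 (S : finType) (f : cfg S -> R) : 0 <= variance q f.
Proof. by rewrite variance_centered; apply: mean_ge0 => // w; exact: sqr_ge0. Qed.

Lemma variance_gt0 (S : finType) (f : cfg S -> R) :
  nonconstant f -> 0 < variance q f.
Proof.
move=> [w [w' fww']]; rewrite lt_neqAle variance_ge0 andbT eq_sym.
apply: contra fww'; rewrite variance_centered /mean psumr_eq0 => [/allP H|v _]; last first.
  by rewrite mulr_ge0 ?sqr_ge0 // ltW // mu_gt0.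
have E v : f v = mean q f.
  have := H v (mem_index_enum v); rewrite /= mulf_eq0 gt_eqF ?mu_gt0 //=.
  by rewrite sqrf_eq0 subr_eq0 => /eqP.
by rewrite (E w) (E w').
Qed.

Lemma mean_variance_at (S : finType) x (k f : cfg S -> R) : indep x k ->
  mean q (fun w => k w * variance_at q x f w) =
  nrm q k (fun w => f w - mean_at q x f w).
Proof.
move=> ik; rewrite /nrm -(mean_mean_at q x (fun w => _ * _ ^+ 2)).
apply: eq_mean => w; rewrite /variance_at /mean_at !ik !set_at_id; ring.
Qed.

Lemma dirichlet_energy (S : finType) (c : S -> cfg S -> bool) f :
  (forall x, indep x (fun w => (c x w)%:R : R)) ->
  dirichlet q c f = \sum_x energy q c (fun _ => 1) f x.
Proof.
move=> ic; apply: eq_bigr => x _; rewrite mean_variance_at //.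
by apply: eq_mean => w; rewrite mul1r.
Qed.

Lemma east_constraint_indep d (V : {fset site d}) (x : V) :
  indep x (fun w => (east_constraint x w)%:R : R).
Proof.
move=> b w; congr (nat_of_bool _)%:R; rewrite /east_constraint; congr (_ || _).
apply: eq_existsb => y; apply: eq_existsb => i.
have [xy|//] := eqVneq (val x) (shift i (val y)).
rewrite set_at_neq //; apply/negP => /eqP yx.
by have := rank_shift i (val y); rewrite -xy yx => /n_Sn.
Qed.

Lemma dirichlet_ge0 (S : finType) (c : S -> cfg S -> bool) (f : cfg S -> R) :
  (forall x, indep x (fun w => (c x w)%:R : R)) -> 0 <= dirichlet q c f.
Proof.
by move=> ic; rewrite dirichlet_energy //; apply: sumr_ge0 => x _; exact: energy_ge0.
Qed.

Lemma gap_ge d (V : {fset site d}) (a : R) : origin d \in V -> 0 < a ->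
  (forall f, variance q f <= a * dirichlet q (@east_constraint d V) f) ->
  a^-1 <= gap q V.
Proof.
move=> oV a0 H; apply: lb_le_inf.
  pose f (w : cfg V) : R := (w [` oV]%fset)%:R.
  exists (dirichlet q (@east_constraint d V) f / variance q f), f => //.
  exists [ffun=> true], [ffun=> false].
  by rewrite /f !ffunE /= oner_neq0.
move=> _ [f /variance_gt0 vf <-].
by rewrite ler_pdivlMr // ler_pdivrMl.
Qed.

Lemma gap_variance d (V : {fset site d}) f :
  gap q V * variance q f <= dirichlet q (@east_constraint d V) f.
Proof.
have D0 g : 0 <= dirichlet q (@east_constraint d V) g.
  by apply: dirichlet_ge0 => x; exact: east_constraint_indep.
have [[w [w' fww']]|] := pselect (nonconstant f).
  have vf : 0 < variance q f by apply: variance_gt0; exists w, w'.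
  rewrite -ler_pdivlMr //; apply: ge_inf; last by exists f => //; exists w, w'.
  by exists 0 => _ [g _ <-]; rewrite divr_ge0 ?variance_ge0.
move=> nf; have fE w : f w = f [ffun=> true].
  by apply: contra_notP nf => /eqP ne; exists w, [ffun=> true].
rewrite (_ : variance q f = 0) ?mulr0 // variance_centered.
rewrite (_ : mean q f = f [ffun=> true]).
  rewrite -[RHS](@mean_cst R V q 0); apply: eq_mean => w.
  by rewrite fE subrr expr0n.
by rewrite -[RHS](@mean_cst R V q); apply: eq_mean.
Qed.

Lemma avg_support (S : finType) (s t : seq S) (f : cfg S -> R) (a : R) :
  {subset s <= t} -> avg q s f =1 (fun _ => a) -> avg q t f =1 (fun _ => a).
Proof.
move=> st fa w; rewrite -(avg_sub q f st) avgC -(avg_cst q t a w).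
by congr (avg q t _ w); apply: funext.
Qed.

Lemma size_flatten_allP (A : Type) (B : eqType) (F : B -> seq A) (s : seq B) m :
  (forall x, x \in s -> (size (F x) <= m)%N) ->
  (size (flatten [seq F x | x <- s]) <= size s * m)%N.
Proof.
elim: s => //= x s IH H; rewrite size_cat mulSn leq_add //.
  by apply: H; rewrite mem_head.
by apply: IH => y ys; apply: H; rewrite inE ys orbT.
Qed.

Lemma size_interval d (s : seq (site d)) x z D : uniq s ->
  (forall u, u \in s -> sle x u && sle u z) -> (rank z <= rank x + D)%N ->
  (size s <= D.+1 ^ d)%N.
Proof.
move=> us sI zx.
pose F (u : site d) : {ffun 'I_d -> 'I_D.+1} := [ffun i => inord (u i - x i)].
have lt_u u i : u \in s -> (u i - x i < D.+1)%N /\ (x i <= u i)%N.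
  move=> /sI/andP[/forallP xu /forallP uz]; split; last exact: xu.
  have xz : forall j, (x j <= z j)%N by move=> j; exact: leq_trans (uz j).
  rewrite ltnS; apply: (@leq_trans (z i - x i)); first exact: leq_sub2r.
  rewrite leq_subLR; move: zx; rewrite /rank (bigD1 i) //= [in leqRHS](bigD1 i) //=.
  have : (\sum_(j < d | j != i) x j <= \sum_(j < d | j != i) z j)%N by exact: leq_sum.
  by move: (\sum_(j < d | _) x j)%N (\sum_(j < d | _) z j)%N; clear; lia.
rewrite -(size_map F) -[X in (_ <= X ^ _)%N]card_ord -[X in (_ <= _ ^ X)%N]card_ord -card_ffun.
rewrite -(card_uniqP _) ?max_card // map_inj_in_uniq // => u v us' vs /ffunP E.
apply/ffunP => i; have [ui xu] := lt_u u i us'; have [vi xv] := lt_u v i vs.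
have := congr1 val (E i); rewrite !ffunE /= !inordK //.
by move=> E'; rewrite -(subnK xu) -(subnK xv) E'.
Qed.

(** Bounded overlap: it will say that a site enters the energy of at most three slabs of a long
    chain. *)
Lemma sum_window n (Q : pred nat) : (forall i j, Q i -> Q j -> (j < i + 3)%N) ->
  (\sum_(i < n) Q i <= 3)%N.
Proof.
move=> H.
have -> : (\sum_(i < n) Q i = size ([seq k <- iota 0 n | Q k]))%N.
  rewrite size_filter -sum1_count [RHS]big_mkcond -(big_mkord xpredT (fun i => nat_of_bool (Q i))).
  by rewrite /index_iota subn0; apply: eq_bigr => i _; case: (Q i).
case E: ([seq k <- iota 0 n | Q k]) => [//|i s].
have us : uniq (i :: s) by rewrite -E filter_uniq // iota_uniq.
have ss : sorted ltn (i :: s) by rewrite -E sorted_filter ?iota_ltn_sorted //; exact: ltn_trans.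
have sQ k : k \in i :: s -> Q k by rewrite -E mem_filter => /andP[].
have Qi : Q i by rewrite sQ // mem_head.
have -> : 3%N = size (iota i 3) by rewrite size_iota.
apply: uniq_leq_size us _ => k ks; rewrite mem_iota; apply/andP; split; last exact: H (sQ k ks).
move: ks; rewrite inE => /predU1P[->//|ks].
by have /allP/(_ k ks)/ltnW := order_path_min ltn_trans ss.
Qed.

End Gap.

(** The requirement that [calH] makes on a single box, with a free lower bound. *)
Definition gap_above (R : realType) d (q : R) (L : site d) (a : R) :=
  exists V : {fset site d},
    [/\ {subset V <= box L}, origin d \in V, L \in V & a <= gap q V].

Lemma gap_above_le (R : realType) d (q : R) (L : site d) (a b : R) :
  a <= b -> gap_above q L b -> gap_above q L a.
Proof. by move=> ab [V [? ? ? ?]]; exists V; split=> //; exact: le_trans ab _. Qed.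

(** * Spectral gap of a long chain of blocks separated by rank *)

Section LongChain.
Variables (R : realType) (d : nat) (q : R).
Hypothesis hq : 0 < q < 1.

Let q0 : 0 < q. Proof. by case/andP: hq. Qed.
Let q1 : q < 1. Proof. by case/andP: hq. Qed.

(** The sites used by the gadgets are cut into slabs of ranks, and [chain_gap] is applied to the
    slabs. The bad event of a slab is that a given block inside the previous slab has no vacancy;
    otherwise this vacancy relaxes each site of the slab through a bounded number of layers. The
    length [N] does not enter the bound. *)
Lemma gchain_gap (B : nat -> seq (site d)) (N K D : nat) (t : nat -> nat)
    (L : site d) (T T' : R) :
  gchain q B N K T T' -> 1 <= T -> 0 <= T' ->
  B 0%N = [:: origin d] -> B N = [:: L] ->
  (forall j y, (j <= N)%N -> y \in B j -> (t j <= rank y < t j.+1)%N) ->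
  (forall i j, (i <= j)%N -> (t i <= t j)%N) ->
  (forall j, (0 < j < N)%N -> (1 - q) ^+ size (B j) <= 8^-1) ->
  (forall j y y', (j < N)%N -> y \in B j -> y' \in B j.+1 ->
     (rank y' <= rank y + D)%N) ->
  gap_above q L ((12 * ((1 + 3 * (K * K * D.+1 ^ d))%N)%:R * ((10 / q) ^+ 3 * (T + T')))^-1).
Proof.
move=> BN T1 T0' B0 BNL tB tmono good BD.
have T0 : 0 <= T by exact: le_trans T1.
have q10 := ler1_invp q0 (ltW q1).
have [U UP] := gadget_choice d q T T'.
set o := origin d in B0 *.
pose tot := flatten [seq layer U B j | j <- iota 0 N].
have totP u : reflect (exists2 j, (j < N)%N & u \in layer U B j) (u \in tot).
  apply: (iffP flattenP) => [[s /mapP[j]]|[j jN uj]].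
    by rewrite mem_iota add0n => jN -> uj; exists j.
  by exists (layer U B j) => //; apply/mapP; exists j; rewrite ?mem_iota.
pose V : {fset site d} := [fset u in o :: tot]%fset.
have VP u : (u \in V) = (u == o) || (u \in tot) by rewrite !inE.
have oB : o \in B 0%N by rewrite B0 mem_head.
have LB : L \in B N by rewrite BNL mem_head.
have oV : o \in V by rewrite VP eqxx.
have layer_le j u : (j < N)%N -> u \in layer U B j ->
    [/\ sle u L, (rank o < rank u)%N & (t j <= rank u < t j.+2)%N].
  move=> jN /layerP[y [y' [yB y'B uU]]].
  have [_ _ /(_ _ uU)[le1 le2 lt1] _] := gchain_gadget_on BN UP jN yB y'B.
  have [t1 t2] := andP (tB j y (ltnW jN) yB).
  have [t3 t4] := andP (tB j.+1 y' jN y'B).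
  have oy : (rank o <= rank y)%N.
    by rewrite {1}/rank big1 // => i _; rewrite ffunE.
  have r1 := sle_rank le1; have r2 := sle_rank le2.
  split; first last.
  - by rewrite (leq_trans t1) // (leq_ltn_trans r2).
  - exact: leq_ltn_trans lt1.
  apply: (sle_trans le2); have [jN'|jN'] := ltnP j.+1 N.
    have jNN : (j.+1 < N <= N)%N by rewrite jN' leqnn.
    by have /andP[] := gchain_le BN UP jNN y'B LB.
  have jE : j.+1 = N by apply/eqP; rewrite eqn_leq jN jN'.
  by move: y'B; rewrite jE BNL inE => /eqP ->; rewrite sle_refl.
have UV j : (j < N)%N -> {subset layer U B j <= V}.
  by move=> jN u uj; rewrite VP; apply/orP; right; apply/totP; exists j.
have BV : {subset B 0%N <= V} by rewrite B0 => y; rewrite inE => /eqP ->.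
have blockV j := gchain_blockV BN UP BV UV (j := j).
have LV : L \in V by apply: (blockV N).
exists V; split=> //.
  move=> u; rewrite VP mem_box => /orP[/eqP ->|/totP[j jN uj]].
    by apply/forallP => i; rewrite ffunE.
  by have [/forallP uL _ _] := layer_le j u jN uj; apply/forallP.
set Ts := (10 / q) ^+ 3 * (T + T').
set cnt := (1 + _)%N.
have TT0 : 0 <= T + T' by exact: addr_ge0.
have TT1 : 1 <= T + T' by rewrite (le_trans T1) // lerDl.
have Ts1 : 1 <= Ts by rewrite mulr_ege1 // exprn_ege1.
have Ts0 : 0 <= Ts by exact: le_trans Ts1.
apply: gap_ge => // [|f].
  apply: mulr_gt0; last exact: lt_le_trans Ts1.
  by apply: mulr_gt0 => //; rewrite ltr0n.
(* A slab spans two blocks: layer [l] has ranks between [t l] and [t l.+2], so every layer meeting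
   slab [j.+1] lies strictly above block [j.*2.+1], which is at the bottom of slab [j]. At most
   three layers are crossed from there, whence the cube of [10 / q]. *)
pose n := (N.-1)./2.+1.
pose tau j := if j is j'.+1 then t j'.*2.+3 else 0%N.
have tauS j : tau j.+1 = t j.*2.+3 by [].
have tau_mono i j : (i <= j)%N -> (tau i <= tau j)%N.
  by case: i j => [|i] [|j] //= ij; apply: tmono; clear -ij; lia.
have tau_ge j : (tau j <= t j.*2.+1)%N by case: j => // j; rewrite tauS doubleS.
pose W j : seq V := enum [pred v : V | (tau j <= vkey v < tau j.+1)%N].
have WP j v : (v \in W j) = (tau j <= vkey v < tau j.+1)%N by rewrite mem_enum.
have belowP j v : (v \in blocks_below W j) = (vkey v < tau j)%N.
  elim: j => [|j IH]; first by rewrite in_nil ltn0.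
  rewrite mem_cat WP IH; have := tau_mono j j.+1 (leqnSn j).
  by case: (ltnP (vkey v) (tau j)) => [h1 h2|h1 h2]; rewrite ?orbT ?orbF //= (leq_trans h1).
pose bad j : cfg V -> R :=
  if j is j'.+1 then fun w => 1 - some_zero R (lift_seq V (B j'.*2.+1)) w
  else fun _ => 0.
have sz01 Y (w : cfg V) : 0 <= some_zero R Y w <= 1.
  by rewrite /some_zero; case: has; rewrite /= lexx ler01.
have bad01 j w : 0 <= bad j w <= 1.
  case: j => [|j] /=; first by rewrite lexx ler01.
  by have /andP[? ?] := sz01 (lift_seq V (B j.*2.+1)) w; lra.
have nN j : (j.+1 < n)%N -> (j.*2.+2 < N)%N.
  by rewrite /n; clear; lia.
have blk_rank j (v : V) : (j <= N)%N -> v \in lift_seq V (B j) ->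
    (t j <= vkey v < t j.+1)%N.
  by move=> jN; rewrite mem_lift; exact: tB.
have badi j y : (j.*2.+1 <= N)%N -> (vkey y < t j.*2.+1)%N || (t j.*2.+2 <= vkey y)%N ->
    indep y (bad j.+1).
  move=> jN ty b w; congr (1 - (nat_of_bool _)%:R); apply: eq_in_has => v /(blk_rank _ _ jN).
  move=> /andP[h1 h2]; rewrite set_at_neq //; apply: contraTneq ty => <-.
  by rewrite negb_or -leqNgt -ltnNge h1.
apply: le_trans (chain_gap (n := n) (W := W) hq f bad01 (fun=> erefl) _ _ _) _.
- move=> j jn; have j2 := nN j jn.
  have j1N : (j.*2.+1 <= N)%N by apply: ltnW; exact: ltnW.
  have [uB _ _] := BN.1 _ j1N.
  exists ((1 - q) ^+ size (lift_seq V (B j.*2.+1))).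
    by rewrite size_lift //; [apply: good; exact: ltnW | exact: blockV].
  apply: (avg_support (s := lift_seq V (B j.*2.+1))).
    move=> v /(blk_rank _ _ j1N)/andP[h1 h2]; rewrite WP (leq_trans (tau_ge j)) //=.
    by rewrite (leq_trans h2) // tmono.
  move=> w; rewrite /bad avgB avg_cst avg_some_zero; last exact: enum_uniq.
  by rewrite opprB addrC subrK.
- move=> j jn x; rewrite belowP => xj; apply: badi.
    by have := nN j jn; clear; lia.
  by rewrite (leq_trans xj).
- move=> v; rewrite belowP /tau /=.
  have vL : (rank (val v) <= rank L)%N.
    have := valP v; rewrite VP => /orP[/eqP ->|/totP[j jN uj]].
      by rewrite {1}/rank big1 // => i _; rewrite ffunE.
    by have [/sle_rank] := layer_le j _ jN uj.
  rewrite /vkey (leq_ltn_trans vL) //.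
  have /andP[_ lt] := tB N L (leqnn N) LB.
  by apply: (leq_trans lt); apply: tmono; clear; lia.
(* The ranks used to relax slab [j]. The windows of [j] and [j + 3] are disjoint, so at most three
   overlap; with the 4 of [chain_gap] this gives 12. *)
pose P j (v : V) := (t j.*2.-1 <= vkey v < t j.*2.+4)%N.
pose e1 v := energy q (@east_constraint d V) (fun=> 1) f v.
have e10 v : 0 <= e1 v by exact: energy_ge0.
have h0 j w : 0 <= 1 - bad j w by have /andP[_] := bad01 j w; lra.
have layerPj j l (v : V) : (l < N)%N -> (j.*2.-1 <= l <= j.*2.+2)%N ->
    val v \in layer U B l -> P j v.
  move=> lN /andP[l1 l2] vl; have [_ _ /andP[t1 t2]] := layer_le _ _ lN vl.
  rewrite /P /vkey (leq_trans _ t1) ?tmono //= (leq_trans t2) // tmono //.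
have inlayer j v : v \in W j -> val v != o ->
    exists l, [/\ (l < N)%N, val v \in layer U B l & (j.*2 <= l <= j.*2.+2)%N].
  move=> vW vo; have := valP v; rewrite VP (negPf vo) /= => /totP[l lN vl].
  exists l; split=> //; have [_ _ /andP[t1 t2]] := layer_le _ _ lN vl.
  move: vW; rewrite WP => /andP[w1 w2]; apply/andP; split.
    rewrite leqNgt; apply/negP => lj.
    case: j lj w1 {w2} => // j lj; rewrite tauS leqNgt => /negP; apply.
    by apply: (leq_trans t2); apply: tmono; move: lj; clear; lia.
  rewrite leqNgt; apply/negP => lj; move: w2; rewrite tauS ltnNge => /negP; apply.
  by apply: leq_trans t1; apply: tmono.
have site j u : (j < n)%N -> u \in W j ->
    nrm q (fun w => 1 - bad j w) (fun w => f w - mean_at q u f w)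
    <= Ts * \sum_(v | P j v) e1 v.
  case: j => [_ uW|j jn uW].
    have -> : (fun w => 1 - bad 0%N w) = fun=> 1 by apply: funext => w; rewrite subr0.
    pose vo : V := [` oV]%fset.
    have oP : P 0%N vo.
      have /andP[t1 t2] := tB 0%N o (leq0n N) oB.
      by rewrite /P /vkey t1 (leq_trans t2) ?tmono.
    have [uo|uo] := eqVneq (val u) o.
      have uE : u = vo by exact: val_inj.
      rewrite (bigD1 vo) //= -[leLHS]mul1r; apply: ler_pM => //.
        by apply: nrm_ge0 => // w.
      rewrite -[leLHS]addr0; apply: lerD; last exact: sumr_ge0.
      rewrite uE; apply: ler_nrmh => // w.
      by rewrite /east_constraint /= eqxx mulr1.
    have [l [lN ul /andP[_ l2]]] := inlayer 0%N u uW uo.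
    have ou : (vkey vo < vkey u)%N by have [] := layer_le _ _ lN ul.
    have tots : Ts = 10 / q * ((10 / q) ^+ 2 * (T + T')) by rewrite /Ts exprS mulrA.
    have q21 : 1 <= (10 / q) ^+ 2 by exact: exprn_ege1.
    rewrite tots; apply: (reach_free hq (key := @vkey d V) (U := P 0%N) (Z := [:: u]) (o := vo)) => //.
    - exact: mulr_ege1.
    - by move=> w; rewrite /east_constraint /= eqxx.
    - by move=> z; rewrite inE => /eqP ->.
    case: l lN ul l2 => [|l] lN ul l2.
      have /layerP[y [y' [yB y'B uU]]] := ul.
      move: yB uU; rewrite B0 inE => /eqP -> uU.
      have LP0 (v : V) : val v \in layer U B 0 -> P 0%N v by exact: layerPj.
      have [h _] := gchain_reach_site hq BN T0 T0' UP UV lN (y := vo) oB y'B uU LP0.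
      apply: (@reach_mono _ _ _ hq _ _ (P 0%N) _ _ _ T') => //.
      by rewrite -[leLHS]mul1r; apply: ler_pM => //; rewrite lerDr.
    have LPl k (v : V) : (0 <= k <= l.+1)%N -> val v \in layer U B k -> P 0%N v.
      by move=> /andP[_ kl]; apply: layerPj; move: kl lN l2; clear; lia.
    have h := gchain_reach_site_hop hq BN T0 T0' UP BV UV (n := l) (j := 0) lN (y := vo) oB ul LPl.
    apply: (@reach_mono _ _ _ hq _ _ (P 0%N) _ _ _ ((10 / q) ^+ l.+1 * (T + T'))) => //.
      rewrite ler_wpM2r //; apply: ler_weXn2l => //.
    by rewrite mulr_ge0 // exprn_ge0 // (le_trans ler01).
  have -> : (fun w => 1 - bad j.+1 w) =
      fun w => 1 * some_zero R (lift_seq V (B j.*2.+1)) w.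
    by apply: funext => w /=; ring.
  have j2 := nN j jn.
  have j1N : (j.*2.+1 <= N)%N by apply: ltnW; exact: ltnW.
  apply: (nrm_some_zero_unsorted hq (key := @vkey d V) (U := P j.+1) (Z := [:: u])) => // y.
  rewrite mem_lift => yB.
  have /andP[_ ty] := tB _ _ j1N yB.
  have uo : val u != o.
    apply: contraTneq uW => uo; rewrite WP negb_and -!ltnNge tauS /vkey uo.
    have /andP[_ t2] := tB 0%N o (leq0n N) oB.
    by rewrite (leq_trans t2) // tmono.
  have [l [lN ul /andP[l1 l2]]] := inlayer _ u uW uo.
  have [m lE] : exists m, l = (j.*2.+1 + m).+1.
    by exists (l - j.*2.+2)%N; move: l1; clear; lia.
  rewrite {l}lE in lN ul l1 l2.
  have m2 : (m.+1 <= 3)%N by move: l2; clear; lia.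
  have LPl k (v : V) : (j.*2.+1 <= k <= (j.*2.+1 + m).+1)%N ->
      val v \in layer U B k -> P j.+1 v.
    by move=> /andP[k1 k2]; apply: layerPj; move: k1 k2 lN l2; clear; lia.
  have h := gchain_reach_site_hop hq BN T0 T0' UP BV UV (n := m) (j := j.*2.+1) lN (y := y) yB ul LPl.
  apply: (@reach_mono _ _ _ hq _ _ (P j.+1) _ _ _ ((10 / q) ^+ m.+1 * (T + T'))) => //.
    by rewrite ler_wpM2r //; apply: ler_weXn2l.
  by rewrite mulr_ge0 // exprn_ge0 // (le_trans ler01).
(* The origin, plus three layers made of at most K * K gadgets, each lying in an interval of at most
   (D + 1)^d sites. *)
have sizeW j : (size (W j) <= cnt)%N.
  pose lay := [seq layer U B l | l <- [seq l <- iota j.*2 3 | (l < N)%N]].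
  rewrite -(size_map val).
  apply: (@leq_trans (size (o :: flatten lay))).
    apply: uniq_leq_size; first by rewrite map_inj_uniq ?enum_uniq //; exact: val_inj.
    move=> _ /mapP[v vW ->]; rewrite inE; case: eqVneq => //= vo.
    have [l [lN vl /andP[l1 l2]]] := inlayer _ v vW vo.
    apply/flattenP; exists (layer U B l) => //; apply/mapP; exists l => //.
    by rewrite mem_filter lN mem_iota l1 addnS ltnS addn2.
  rewrite /= /cnt add1n ltnS; apply: (leq_trans (size_flatten_allP (m := K * K * D.+1 ^ d) _)).
    move=> l; rewrite mem_filter => /andP[lN _].
    have [_ _ s1] := BN.1 _ (ltnW lN); have [_ _ s2] := BN.1 _ lN.
    rewrite /layer; set F := [seq U (y, y') | y <- B l, y' <- B l.+1].
    apply: (@leq_trans (size F * D.+1 ^ d)); last first.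
      by rewrite leq_mul2r size_allpairs leq_mul // orbT.
    have : forall s, s \in F -> (size s <= D.+1 ^ d)%N.
      move=> s /allpairsP[[y y'] /= [yB y'B ->]].
      have [uU _ Ule _] := gchain_gadget_on BN UP lN yB y'B.
      apply: (size_interval (x := y) (z := y')) => //; last exact: (BD l).
      by move=> u /Ule[-> ->].
    elim: F => //= s F IH H; rewrite size_cat mulSn leq_add ?H ?mem_head //.
    by apply: IH => s' s'F; apply: H; rewrite inE s'F orbT.
  by rewrite leq_mul2r (leq_trans (size_subseq (filter_subseq _ _))) ?size_iota ?orbT.
have step j : (j < n)%N ->
    nrm q (fun w => 1 - bad j w) (fun w => f w - avg q (W j) f w)
    <= cnt%:R * Ts * \sum_(v | P j v) e1 v.
  move=> jn; apply: le_trans (nrm_var_sum hq _ _ _) _ => //.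
    move=> v; rewrite WP => /andP[w1 _].
    case: j jn w1 => [//|j jn w1].
    have j2 := nN j jn.
    have ib : indep v (bad j.+1).
      apply: badi; first by move: j2; clear; lia.
      by apply/orP; right; apply: leq_trans w1; rewrite tauS tmono.
    by move=> b w; rewrite ib.
  apply: (@le_trans _ _ (\sum_(v <- W j) (Ts * \sum_(v | P j v) e1 v))).
    by rewrite big_seq [leRHS]big_seq; apply: ler_sum => v; exact: site.
  have S0 : 0 <= \sum_(v | P j v) e1 v by exact: sumr_ge0.
  rewrite big_const_seq count_predT iter_addr addr0 -[leLHS]mulr_natl -[leRHS]mulrA.
  by apply: ler_wpM2r; [exact: mulr_ge0 | rewrite ler_nat].
have S3 : \sum_(j < n) \sum_(v | P j v) e1 v <= 3 * \sum_v e1 v.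
  rewrite (eq_bigr (fun j : 'I_n => \sum_v (P j v)%:R * e1 v)); last first.
    by move=> j _; rewrite big_mkcond; apply: eq_bigr => v _; case: (P j v); rewrite ?mul1r ?mul0r.
  rewrite exchange_big mulr_sumr; apply: ler_sum => v _ /=.
  rewrite -mulr_suml ler_wpM2r // -natr_sum -[3]/(3%:R) ler_nat.
  apply: (@sum_window n (fun j => P j v)) => i j /andP[_ h1] /andP[h2 _].
  rewrite ltnNge; apply/negP => ij.
  have : (t i.*2.+4 <= t j.*2.-1)%N by apply: tmono; move: ij; clear; lia.
  by rewrite leqNgt (leq_ltn_trans h2).
apply: (@le_trans _ _ (4 * \sum_(j < n) (cnt%:R * Ts * \sum_(v | P j v) e1 v))).
  by rewrite ler_wpM2l //; apply: ler_sum => j _; exact: step.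
rewrite dirichlet_energy; last exact: east_constraint_indep.
rewrite -mulr_sumr.
have -> : 12 * cnt%:R * Ts * \sum_x energy q (@east_constraint d V) (fun=> 1) f x
   = 4 * (cnt%:R * Ts * (3 * \sum_v e1 v)) by rewrite /e1; ring.
by rewrite ler_wpM2l // ler_wpM2l // mulr_ge0.
Qed.

End LongChain.

(** * Chains of boxes along a segment *)

Section Boxes.
Variable D : nat.
Hypothesis D0 : (0 < D)%N.
Implicit Types (x y w a : site D).

Definition sadd x y : site D := [ffun i => (x i + y i)%N].

Definition volume a : nat := (\prod_(i < D) a i)%N.

(* The [j]-th of a chain of boxes with side lengths [a] that follows the segment
   from [x] to [x + w] in [M] steps; the two end blocks are reduced to a point. *)
Definition boxes x a w M j : seq (site D) :=
  if j == 0%N then [:: x] else if j == M then [:: sadd x w] else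
  [seq [ffun i => (x i + j * w i %/ M + o i)%N]
     | o : {dffun forall i : 'I_D, 'I_(a i)}].

Lemma uniq_boxes x a w M j : uniq (boxes x a w M j).
Proof.
rewrite /boxes; case: eqP => // _; case: eqP => // _.
rewrite map_inj_uniq ?enum_uniq // => o o' /ffunP E; apply/ffunP => i.
by have := E i; rewrite !ffunE => /addnI/val_inj.
Qed.

Lemma size_boxes x a w M j : (0 < j < M)%N -> size (boxes x a w M j) = volume a.
Proof.
move=> /andP[j0 jM]; rewrite /boxes gtn_eqF // ltn_eqF // size_map -cardE.
rewrite card_dep_ffun /volume foldrE big_image /=.
by apply: eq_bigr => i _; rewrite card_ord.
Qed.

Lemma size_boxes_le x a w M j : (forall i, (0 < a i)%N) ->
  (0 < size (boxes x a w M j) <= volume a)%N.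
Proof.
move=> a0; have v0 : (0 < volume a)%N by rewrite prodn_gt0.
have [j0|j0] := eqVneq j 0%N; first by rewrite /boxes j0 /= v0.
have [jM|jM] := eqVneq j M; first by rewrite /boxes jM eqxx; case: ifP; rewrite /= v0.
rewrite /boxes (negPf j0) (negPf jM) size_map -cardE card_dep_ffun foldrE big_image /=.
by rewrite (eq_bigr (fun i => a i)) ?v0 ?leqnn // => i _; rewrite card_ord.
Qed.

Lemma boxes_bounds x a w M j y : (0 < M)%N -> (forall i, (0 < a i)%N) ->
  y \in boxes x a w M j -> forall i,
  (x i + j * w i %/ M <= y i)%N && (y i < x i + j * w i %/ M + a i)%N.
Proof.
move=> M0 a0; rewrite /boxes; case: eqP => [->|_].
  by rewrite inE => /eqP -> i; rewrite mul0n div0n addn0 leqnn -addn1 leq_add2l a0.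
case: eqP => [->|_].
  by rewrite inE => /eqP -> i; rewrite ffunE mulKn // leqnn -addn1 leq_add2l a0.
by move=> /mapP[u _ ->] i; rewrite ffunE leq_addr ltn_add2l ltn_ord.
Qed.

Lemma divn_step j (w M : nat) : (0 < M)%N ->
  (j * w %/ M + w %/ M <= j.+1 * w %/ M <= j * w %/ M + w %/ M + 1)%N.
Proof.
move=> M0; have -> : (j.+1 * w = j * w + w)%N by rewrite mulSn addnC.
by rewrite divnD // leq_addr /= leq_add2l; case: (M <= _)%N.
Qed.

Lemma boxes_step x a w M k j y y' : (0 < M)%N -> (forall i, (0 < a i)%N) ->
  (forall i, (4 * a i * M <= w i <= 4 * k * a i * M)%N) ->
  y \in boxes x a w M j -> y' \in boxes x a w M j.+1 -> forall i,
  (y i + a i <= y' i <= y i + (4 * k + 1) * a i)%N.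
Proof.
move=> M0 a0 wi yj y'j i.
have := boxes_bounds M0 a0 yj i; have := boxes_bounds M0 a0 y'j i.
have := divn_step j (w i) M0; have := a0 i.
have : (4 * a i <= w i %/ M <= 4 * k * a i)%N.
  have /andP[w1 w2] := wi i.
  by rewrite leq_divRL // w1 /= -[X in (_ <= X)%N](mulnK _ M0) leq_div2r.
move: (j * w i %/ M)%N (j.+1 * w i %/ M)%N (w i %/ M)%N (x i : nat) (y i : nat) (y' i : nat) (a i : nat).
by clear; move=> *; nia.
Qed.

(** The rank of the lower corner of the [j]-th box, which serves as the threshold [t j] of
    [gchain_gap]. *)
Definition box_rank x w M j : nat := (rank x + \sum_(i < D) (j * w i %/ M))%N.

Lemma box_rank_mono x w M i j : (i <= j)%N -> (box_rank x w M i <= box_rank x w M j)%N.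
Proof.
by move=> ij; rewrite leq_add2l leq_sum // => k _; rewrite leq_div2r // leq_mul2r ij orbT.
Qed.

Lemma boxes_rank x a w M j y : (0 < M)%N -> (forall i, (0 < a i)%N) ->
  (forall i, (4 * a i * M <= w i)%N) -> y \in boxes x a w M j ->
  (box_rank x w M j <= rank y < box_rank x w M j.+1)%N.
Proof.
move=> M0 a0 wi yj; rewrite /box_rank /rank -!big_split /=; apply/andP; split.
  by apply: leq_sum => i _; have /andP[] := boxes_bounds M0 a0 yj i.
have lt i : (y i < x i + j.+1 * w i %/ M)%N.
  have := boxes_bounds M0 a0 yj i; have := divn_step j (w i) M0; have := a0 i.
  have : (4 * a i <= w i %/ M)%N by rewrite leq_divRL.
  move: (j * w i %/ M)%N (j.+1 * w i %/ M)%N (w i %/ M)%N (x i : nat) (y i : nat) (a i : nat).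
  by clear; lia.
apply: leq_trans (_ : (\sum_(i < D) (y i).+1 <= _)%N); last exact: leq_sum.
under [leqRHS]eq_bigr do rewrite -addn1.
by rewrite big_split /= sum1_card card_ord -addn1 leq_add2l.
Qed.

End Boxes.

Section BoxChain.
Variables (R : realType) (d D : nat) (q : R).
Hypothesis hq : 0 < q < 1.
Hypothesis D0 : (0 < D)%N.
(** Either the identity, with D = d, or a monotone path, with D = 1: one construction serves both
    geometries. *)
Variable Phi : site D -> site d.
Hypothesis Phi_rank : forall x, rank (Phi x) = rank x.
Hypothesis Phi_inj : injective Phi.

Lemma boxes_gchain (x a w : site D) M k (T T' : R) : (0 < M)%N ->
  (forall i, (0 < a i)%N) ->
  (forall i, (4 * a i * M <= w i <= 4 * k * a i * M)%N) ->
  (forall y y' : site D, (forall i, (y i + a i <= y' i <= y i + (4 * k + 1) * a i)%N) ->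
     gadget q (Phi y) (Phi y') T T') ->
  gchain q (fun j => map Phi (boxes x a w M j)) M (volume a) T T'.
Proof.
move=> M0 a0 wi G; split=> [j jM|j y y' jM /mapP[u uj ->] /mapP[u' u'j ->]].
  rewrite map_inj_uniq // uniq_boxes size_map; split=> //.
    have /andP[] := size_boxes_le x w M j a0.
    by rewrite -(size_map Phi); case: map.
  by have /andP[] := size_boxes_le x w M j a0.
by apply: G => i; exact: (boxes_step M0 a0 wi uj u'j).
Qed.

Lemma boxes_gap (a w : site D) M k (T T' : R) (L : site d) : (0 < M)%N ->
  (forall i, (0 < a i)%N) ->
  (forall i, (4 * a i * M <= w i <= 4 * k * a i * M)%N) ->
  (forall y y' : site D, (forall i, (y i + a i <= y' i <= y i + (4 * k + 1) * a i)%N) ->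
     gadget q (Phi y) (Phi y') T T') ->
  1 <= T -> 0 <= T' -> Phi (origin D) = origin d -> Phi w = L ->
  (1 - q) ^+ volume a <= 8^-1 ->
  gap_above q L ((12 * ((1 + 3 * (volume a * volume a * ((4 * k + 1) * rank a).+1 ^ d))%N)%:R
        * ((10 / q) ^+ 3 * (T + T')))^-1).
Proof.
move=> M0 a0 wi G T1 T0' Phi0 Phiw good.
have wi' i : (4 * a i * M <= w i)%N by have /andP[] := wi i.
have BN := boxes_gchain (origin D) M0 a0 wi G.
apply: (gchain_gap hq (t := box_rank (origin D) w M) BN) => //.
- by rewrite /= Phi0.
- have ME : sadd (origin D) w = w by apply/ffunP => i; rewrite !ffunE add0n.
  by rewrite /boxes gtn_eqF // eqxx /= ME Phiw.
- move=> j y _ /mapP[u uj ->]; rewrite Phi_rank; exact: boxes_rank uj.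
- by move=> i j; exact: box_rank_mono.
- by move=> j jM; rewrite size_map size_boxes.
move=> j y y' jM /mapP[u uj ->] /mapP[u' u'j ->]; rewrite !Phi_rank /rank big_distrr.
rewrite -big_split leq_sum //= => i _.
by have /andP[] := boxes_step M0 a0 wi uj u'j i.
Qed.

End BoxChain.

(** * Chains of at most one step, and monotone paths *)

Section Paths.
Variables (R : realType) (d : nat) (q : R).
Hypothesis hq : 0 < q < 1.

Let q0 : 0 < q. Proof. by case/andP: hq. Qed.
Let q1 : q < 1. Proof. by case/andP: hq. Qed.

Lemma gadget_gap (L : site d) (T T' : R) : gadget q (origin d) L T T' ->
  1 <= T -> 0 <= T' ->
  gap_above q L ((12 * ((1 + 3 * (1 * 1 * (rank L).+1 ^ d))%N)%:R
        * ((10 / q) ^+ 3 * (T + T')))^-1).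
Proof.
move=> G T1 T0'; have L0 := gadget_rank G.
rewrite rank_origin in L0.
pose B j := if j == 0%N then [:: origin d] else [:: L].
pose t j := if j is j'.+1 then (rank L + j')%N else 0%N.
have BN : gchain q B 1 1 T T'.
  split=> [[|[|j]] //|[|j] // y y' _].
  by rewrite !inE => /eqP -> /eqP ->.
apply: (gchain_gap hq (t := t) BN) => //.
- move=> [|[|j]] y //= _; rewrite inE => /eqP ->; first by rewrite rank_origin addn0 L0.
  by rewrite addn0 addn1 leqnn ltnSn.
- by move=> [|i] [|j] //= ij; rewrite leq_add2l.
- by move=> [|[|j]].
- by move=> [|j] // y y' _; rewrite !inE => /eqP -> /eqP ->; rewrite rank_origin.
Qed.

(** Gadgets strictly increase the rank, so none ends at the origin; the box reduced to a point needs
    a chain of zero steps. *)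
Lemma origin_gap : gap_above q (origin d) ((12 * ((1 + 3 * (1 * 1 * 1 ^ d))%N)%:R * ((10 / q) ^+ 3 * 1))^-1).
Proof.
have BN : gchain q (fun _ => [:: origin d]) 0 1 1 0 by split=> // j; rewrite ltn0.
have := gchain_gap hq (D := 0) (t := id) (L := origin d) BN.
rewrite addr0; apply=> //.
- by move=> [|j] y // _; rewrite inE => /eqP ->; rewrite rank_origin.
- by move=> j /andP[].
Qed.

Definition unit_path (p : nat -> site d) := forall j, exists i, p j.+1 = shift i (p j).

Lemma unit_path_rank p n : unit_path p -> rank (p n) = (rank (p 0%N) + n)%N.
Proof.
move=> up; elim: n => [|n IH]; first by rewrite addn0.
by have [i ->] := up n; rewrite rank_shift IH addnS.
Qed.

Lemma unit_path_ex (x z : site d) : (0 < d)%N -> sle x z ->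
  exists2 p, unit_path p & p 0%N = x /\ p (rank z - rank x)%N = z.
Proof.
move=> d0 xz; have [n nE] : exists n, n = (rank z - rank x)%N by exists (rank z - rank x)%N.
rewrite -nE; elim: n x xz nE => [|n IH] x xz nE.
  have zx : z = x.
    apply/ffunP => i; apply/eqP; rewrite eqn_leq (forallP xz) andbT leqNgt.
    have e (y : site d) : rank y = (y i + \sum_(j < d | j != i) y j)%N.
      by rewrite /rank (bigD1 i).
    rewrite ltnNge negbK -(leq_add2r (\sum_(j < d | j != i) z j)) -e.
    have le : (\sum_(j < d | j != i) x j <= \sum_(j < d | j != i) z j)%N.
      by apply: leq_sum => j _; exact: (forallP xz).
    by rewrite (leq_trans _ (leq_add (leqnn (x i)) le)) // -e -subn_eq0 -nE.
  pose i0 := Ordinal d0.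
  exists (fun j => iter j (shift i0) x); last by rewrite zx.
  by move=> j; exists i0.
have [i lt] : exists i, (x i < z i)%N.
  apply/existsP; rewrite -[X in is_true X]negbK negb_exists; apply/negP => /forallP H.
  have : sle z x by apply/forallP => i; rewrite leqNgt H.
  by move=> /sle_rank; move: nE; clear; lia.
have xz' : sle (shift i x) z.
  apply/forallP => j; rewrite ffunE; case: eqP => [->|_]; first by rewrite addn1.
  by rewrite addn0; exact: (forallP xz).
have nE' : n = (rank z - rank (shift i x))%N by rewrite rank_shift; move: nE; clear; lia.
have [p up [p0 pn]] := IH _ xz' nE'.
exists (fun j => if j is j'.+1 then p j' else x) => // -[|j]; last exact: up.
by exists i; rewrite p0.
Qed.

(** Here the blocks are single sites, vacant with probability q. The cost is 2^(O(theta)) only over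
    bounded lengths, where this provides the base of the multi-scale recursion. *)
Lemma gadget_path (p : nat -> site d) k n j : unit_path p -> (0 < n <= 2 ^ k)%N ->
  gadget q (p j) (p (j + n)%N) ((10 / q) ^+ k.+2) ((10 / q) ^+ k.+2).
Proof.
move=> up nk.
have q10 := ler1_invp q0 (ltW q1).
have q100 : 0 <= 10 / q by exact: le_trans q10.
have q2 : 2 <= 10 / q by rewrite ler_pdivlMr //; have := q1; lra.
pose B i := [:: p (j + i)%N].
have BN : gchain q B n 1 1 1.
  split=> // i y y' _; rewrite !inE => /eqP -> /eqP ->; rewrite addnS.
  by have [l ->] := up (j + i)%N; exact: gadget_shift.
have q01 : 0 < q <= 1 by rewrite q0 ltW.
have B0 : B 0%N = [:: p j] by rewrite /B addn0.
have aB i : (0 < i < n)%N -> q <= 1 - (1 - q) ^+ size (B i).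
  by rewrite expr1 opprB addrC subrK.
have := gchain_gadget hq BN ler01 ler01 B0 (erefl (B n)) q01 nk aB.
have e1 : 1 <= (10 / q) ^+ k by exact: exprn_ege1.
have e0 : 0 <= (10 / q) ^+ k by exact: exprn_ge0.
rewrite !mulr1; apply: gadget_mono => //.
- by rewrite mulr_ge0 // addr_ge0.
- by rewrite ler_weXn2l // ltnW.
rewrite !exprS ler_wpM2l //; apply: (@le_trans _ _ (2 * (10 / q) ^+ k)); first by lra.
by rewrite ler_wpM2r.
Qed.

End Paths.

(** * Multi-scale construction *)

Section Levels.
Variables (R : realType) (d D : nat) (q : R).
Hypothesis hq : 0 < q < 1.
Hypothesis D0 : (0 < D)%N.
Variable Phi : site D -> site d.
Hypothesis Phi_rank : forall x, rank (Phi x) = rank x.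
Hypothesis Phi_inj : injective Phi.
Variables (J m k0 : nat) (T0 : R).
Hypotheses (m2 : (2 <= m)%N) (k00 : (0 < k0)%N) (T01 : 1 <= T0).

Let q0 : 0 < q. Proof. by case/andP: hq. Qed.
Let q1 : q < 1. Proof. by case/andP: hq. Qed.

Lemma bernoulli_inv n : (1 - q) ^+ n * (1 + n%:R * q) <= 1.
Proof.
elim: n => [|n IH]; first by rewrite expr0 mul0r addr0 mul1r.
apply: le_trans IH; rewrite exprSr -mulrA; apply: ler_wpM2l.
  by rewrite exprn_ge0 // subr_ge0 ltW.
rewrite -natr1; have n0 : 0 <= n%:R :> R by [].
have : 0 <= n%:R * q * q by rewrite !mulr_ge0 // ltW.
have : 0 <= q * q by rewrite mulr_ge0 // ltW.
by lra.
Qed.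

Definition side k : nat := 2 ^ (m * k).

(** Largest displacement allowed at level [k], in units of [side k]. A chain with ratio [r] at one
    level makes steps of ratio 4 r + 1 <= 6 r at the level below, hence the factor 6 per level. *)
Definition level_ratio k : nat := k0 * 6 ^ (J - k).

(* Up to a factor, the probability that a box of volume [n] contains a vacancy. *)
Definition vacancy_prob (n : nat) : R := Num.min 1 (q * n%:R) / 2.

Lemma vacancy_prob_gt0 n : (0 < n)%N -> 0 < vacancy_prob n.
Proof. by move=> n0; rewrite divr_gt0 // lt_min ltr01 mulr_gt0 // ltr0n. Qed.

Lemma vacancy_prob_le1 n : vacancy_prob n <= 1.
Proof.
by rewrite ler_pdivrMr // (@le_trans _ _ 1) ?ge_min ?lexx //; lra.
Qed.

Lemma vacancy_prob_le n : vacancy_prob n <= 1 - (1 - q) ^+ n.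
Proof.
have n0 : 0 <= n%:R :> R by [].
have nq0 : 0 <= n%:R * q by rewrite mulr_ge0 // ltW.
have h1 : (1 - q) ^+ n <= (1 + n%:R * q)^-1.
  by rewrite -[leRHS]mul1r ler_pdivlMr ?bernoulli_inv //; lra.
suff h2 : (1 + n%:R * q)^-1 <= 1 - vacancy_prob n by lra.
rewrite /vacancy_prob [q * _]mulrC; move: (n%:R * q) nq0 => u u0.
rewrite -[leLHS]mul1r ler_pdivrMr; last by lra.
have [h|h] := leP 1 u; first by lra.
have : 0 <= u * (1 - u) by rewrite mulr_ge0 // subr_ge0 ltW.
by lra.
Qed.

(** The first time of [gchain_gadget] for at most [2 ^ m] steps between boxes of side [side j]; the
    volume of the box stands for [K]. *)
Fixpoint level_time k : R :=
  if k is j.+1 then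
    (10 / vacancy_prob (side j ^ D)) ^+ m * ((side j ^ D)%:R * level_time j)
  else T0.

Lemma side_gt0 k : (0 < side k)%N. Proof. by rewrite expn_gt0. Qed.

Lemma sideD_gt0 k : (0 < side k ^ D)%N. Proof. by rewrite expn_gt0 side_gt0. Qed.

Lemma volume_side k : volume [ffun _ : 'I_D => side k] = (side k ^ D)%N.
Proof.
rewrite /volume (eq_bigr (fun=> side k)); last by move=> i _; rewrite ffunE.
by rewrite prod_nat_const card_ord.
Qed.

Lemma level_time_ge1 k : 1 <= level_time k.
Proof.
elim: k => //= k IH; apply: mulr_ege1.
  by apply: exprn_ege1; rewrite ler1_invp ?vacancy_prob_gt0 ?sideD_gt0 ?vacancy_prob_le1.
by apply: mulr_ege1 => //; rewrite ler1n sideD_gt0.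
Qed.

Lemma level_time_ge0 k : 0 <= level_time k.
Proof. exact: le_trans (level_time_ge1 k). Qed.

Lemma level_time_le k : level_time k <= level_time k.+1.
Proof.
have h1 : 1 <= (10 / vacancy_prob (side k ^ D)) ^+ m.
  by apply: exprn_ege1; rewrite ler1_invp ?vacancy_prob_gt0 ?sideD_gt0 ?vacancy_prob_le1.
have h2 : level_time k <= (side k ^ D)%:R * level_time k.
  by rewrite ler_peMl ?level_time_ge0 // ler1n sideD_gt0.
apply: (le_trans h2); rewrite /= ler_peMl // mulr_ge0 //; exact: level_time_ge0.
Qed.

Let q20 : 1 <= 20 / q.
Proof. by rewrite ler_pdivlMr // mul1r; have := q1; lra. Qed.

(** The second time of the gadgets of level [k]. Each level multiplies it by [10 / q], and by 2 for
    the sum in [gchain_gadget]; with at most J levels this remains a factor 2^(O(theta)). *)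
Definition site_time k : R := (20 / q) ^+ k * level_time k.

Lemma site_time_ge0 k : 0 <= site_time k.
Proof. by rewrite mulr_ge0 ?level_time_ge0 // exprn_ge0 // (le_trans ler01). Qed.

Lemma site_time_le k : site_time k <= site_time k.+1.
Proof.
apply: ler_pM; rewrite ?level_time_ge0 ?level_time_le //.
  by rewrite exprn_ge0 // (le_trans ler01).
by rewrite ler_weXn2l.
Qed.

Lemma site_timeS k : 10 / q * (level_time k.+1 + site_time k) <= site_time k.+1.
Proof.
have e1 : 1 <= (20 / q) ^+ k by exact: exprn_ege1.
have h : level_time k.+1 + site_time k <= 2 * ((20 / q) ^+ k * level_time k.+1).
  rewrite mulr_natl mulr2n lerD // ?ler_peMl ?level_time_ge0 //.
  by rewrite ler_wpM2l ?level_time_le // (le_trans ler01).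
have q100 : 0 <= 10 / q by rewrite divr_ge0 // ltW.
apply: le_trans (ler_wpM2l q100 h) _.
by rewrite /site_time exprS le_eqVlt; apply/orP; left; apply/eqP; ring.
Qed.

Hypothesis base : forall x y : site D,
  (forall i, (x i + 1 <= y i <= x i + level_ratio 0 * 1)%N) ->
  gadget q (Phi x) (Phi y) T0 T0.

Lemma box_chain_gadget k (x y : site D) M r : (0 < M <= 2 ^ m)%N ->
  (forall i, (x i + 4 * side k * M <= y i <= x i + 4 * r * side k * M)%N) ->
  (forall y y' : site D,
    (forall i, (y i + side k <= y' i <= y i + (4 * r + 1) * side k)%N) ->
     gadget q (Phi y) (Phi y') (level_time k) (site_time k)) ->
  gadget q (Phi x) (Phi y) (level_time k.+1) (site_time k.+1).
Proof.
move=> Mm xy G; have /andP[M0 _] := Mm.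
pose a : site D := [ffun _ => side k].
pose w : site D := [ffun i => (y i - x i)%N].
have xw : sadd x w = y.
  apply/ffunP => i; rewrite !ffunE subnKC //; have /andP[h _] := xy i.
  exact: leq_trans (leq_addr _ _) h.
have a0 i : (0 < a i)%N by rewrite ffunE side_gt0.
have wi i : (4 * a i * M <= w i <= 4 * r * a i * M)%N.
  by rewrite !ffunE leq_subLR leq_subRL ?xy //; have /andP[h _] := xy i; exact: leq_trans (leq_addr _ _) h.
have G' (u u' : site D) : (forall i, (u i + a i <= u' i <= u i + (4 * r + 1) * a i)%N) ->
    gadget q (Phi u) (Phi u') (level_time k) (site_time k).
  by move=> H; apply: G => i; have := H i; rewrite ffunE.
have BN := boxes_gchain Phi_inj x M0 a0 wi G'.
have B0 : map Phi (boxes x a w M 0) = [:: Phi x] by [].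
have BM : map Phi (boxes x a w M M) = [:: Phi y].
  by rewrite /boxes gtn_eqF // eqxx /= xw.
have g01 : 0 < vacancy_prob (side k ^ D) <= 1.
  by rewrite vacancy_prob_gt0 ?sideD_gt0 ?vacancy_prob_le1.
have aB i : (0 < i < M)%N ->
    vacancy_prob (side k ^ D) <= 1 - (1 - q) ^+ size (map Phi (boxes x a w M i)).
  by move=> iM; rewrite size_map size_boxes // volume_side vacancy_prob_le.
have := gchain_gadget hq BN (level_time_ge0 k) (site_time_ge0 k) B0 BM g01 Mm aB.
rewrite volume_side; apply: gadget_mono => //.
- exact: (level_time_ge0 k.+1).
- by rewrite mulr_ge0 ?addr_ge0 ?site_time_ge0 ?(level_time_ge0 k.+1) // divr_ge0 // ltW.
- exact: site_timeS.
Qed.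

Lemma level_gadget k (x y : site D) : (k <= J)%N ->
  (forall i, (x i + side k <= y i <= x i + level_ratio k * side k)%N) ->
  gadget q (Phi x) (Phi y) (level_time k) (site_time k).
Proof.
elim: k x y => [|k IH] x y kJ xy.
  rewrite /site_time expr0 mul1r; apply: base => i.
  by have := xy i; rewrite /side muln0 expn0.
(* The steps of a box chain are four sides long, so 2^(m - 2) of them lead from [side k] to
   [side k.+1]; this is where m >= 2 is used. *)
apply: (@box_chain_gadget k x y (2 ^ (m - 2)) (level_ratio k.+1)).
- by rewrite expn_gt0 leq_exp2l //= leq_subr.
- move=> i; have : (4 * side k * 2 ^ (m - 2) = side k.+1)%N.
    have em : (2 ^ m = 4 * 2 ^ (m - 2))%N by rewrite -[in LHS](subnKC m2) expnD.
    by rewrite /side mulnSr expnD em -mulnA mulnCA.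
  move=> e; have := xy i; rewrite -e.
  by rewrite (_ : 4 * level_ratio k.+1 * side k * _ = level_ratio k.+1 * (4 * side k * 2 ^ (m - 2)))%N //; ring.
move=> u u' H; apply: IH; first exact: ltnW.
move=> i; have /andP[-> h] := H i; apply: (leq_trans h); rewrite leq_add2l leq_mul2r.
apply/orP; right; rewrite /level_ratio subnS -{2}[(J - k)%N]prednK ?subn_gt0 // expnS.
have : (0 < k0 * 6 ^ (J - k).-1)%N by rewrite muln_gt0 k00 expn_gt0.
by rewrite mulnCA; clear; lia.
Qed.

Variable r : nat.
Hypothesis rk0 : (8 * r + 1 <= k0)%N.

Lemma level_ratio_ge k : (8 * r + 1 <= level_ratio k)%N.
Proof. by rewrite (leq_trans rk0) // leq_pmulr // expn_gt0. Qed.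

Lemma level_step_gadget k (x y : site D) : (k <= J)%N ->
  (forall i, (x i + side k <= y i <= x i + (4 * (2 * r) + 1) * side k)%N) ->
  gadget q (Phi x) (Phi y) (level_time k) (site_time k).
Proof.
move=> kJ H; apply: level_gadget => // i; have /andP[-> h] := H i.
apply: (leq_trans h); rewrite leq_add2l leq_mul2r mulnA.
by rewrite level_ratio_ge orbT.
Qed.

Lemma wide_step a k (w : nat) : (4 * side k <= a)%N -> (a <= w <= r * a)%N ->
  (4 * side k * (a %/ (4 * side k)) <= w <= 4 * (2 * r) * side k * (a %/ (4 * side k)))%N.
Proof.
move=> ka /andP[aw wa]; set M := (a %/ _)%N; have s0 := side_gt0 k.
have s40 : (0 < 4 * side k)%N by rewrite muln_gt0.
have M0 : (0 < M)%N by rewrite divn_gt0.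
have h1 : (M * (4 * side k) <= a)%N by exact: leq_trunc_div.
have h2 : (a < M.+1 * (4 * side k))%N by exact: ltn_ceil.
rewrite mulnC (leq_trans h1) //= (leq_trans wa) //.
apply: (@leq_trans (r * (2 * M * (4 * side k)))); last by apply: eq_leq; ring.
rewrite leq_mul2l (leq_trans (ltnW h2)) ?orbT // leq_mul2r.
by apply/orP; right; move: M0; clear; lia.
Qed.

(** The chain is made at the largest scale of which four sides fit in [a], found by descending from
    [k]. Times increase with the level, so stating the bound at the top level is legitimate. *)
Lemma wide_gadget a k (x y : site D) : (k <= J)%N -> (0 < a)%N -> (a < 4 * side k.+1)%N ->
  (forall i, (x i + a <= y i <= x i + r * a)%N) ->
  gadget q (Phi x) (Phi y) (level_time k.+1) (site_time k.+1).
Proof.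
move=> kJ a0; have chain j : (j <= J)%N -> (4 * side j <= a)%N -> (a < 4 * side j.+1)%N ->
    (forall i, (x i + a <= y i <= x i + r * a)%N) ->
    gadget q (Phi x) (Phi y) (level_time j.+1) (site_time j.+1).
  move=> jJ ja aj xy; have s0 := side_gt0 j.
  apply: (@box_chain_gadget j x y (a %/ (4 * side j)) (2 * r)).
  - rewrite divn_gt0 ?muln_gt0 // ja -ltnS ltn_divLR ?muln_gt0 //.
    apply: (leq_trans aj); rewrite (mulSn (2 ^ m)) mulnCA [side j.+1]/side mulnS expnD.
    by rewrite leq_addl.
  - move=> i; have /andP[h1 h2] := xy i.
    have xy' : (x i <= y i)%N by rewrite (leq_trans _ h1) ?leq_addr.
    have wi : (a <= y i - x i <= r * a)%N by rewrite (leq_subRL _ xy') h1 leq_subLR.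
    have /andP[w1 w2] := wide_step ja wi.
    by rewrite -(leq_subRL _ xy') w1 -leq_subLR w2.
  by move=> u u' H; exact: level_step_gadget.
elim: k kJ => [|k IH] kJ ak xy.
  have [ka|ka] := ltnP a (4 * side 0); last exact: chain.
  apply: (@gadget_mono _ _ _ hq _ _ T0 T0).
  - exact: le_trans T01.
  - exact: le_trans T01.
  - exact: (level_time_le 0).
  - by apply: le_trans (site_time_le 0); rewrite /site_time expr0 mul1r.
  apply: base => i; have /andP[h1 h2] := xy i.
  rewrite (leq_trans _ h1) ?leq_add2l //= (leq_trans h2) // leq_add2l muln1.
  apply: (leq_trans _ (level_ratio_ge 0)); move: ka; rewrite /side muln0 expn0.
  by clear -a0; nia.
have [ka|ka] := ltnP a (4 * side k.+1); last exact: chain.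
have := IH (ltnW kJ) ka xy; apply: gadget_mono => //.
- exact: level_time_ge0.
- exact: site_time_ge0.
- exact: level_time_le.
- exact: site_time_le.
Qed.

Definition relaxation_bound (k : nat) : R :=
  12 * ((1 + 3 * (side k ^ D * side k ^ D * ((8 * r + 1) * (D * side k)).+1 ^ d))%N)%:R
     * ((10 / q) ^+ 3 * (level_time k + site_time k)).

Lemma level_gap (w : site D) (L : site d) (a : nat) : (0 < J)%N -> (0 < a)%N ->
  (forall i, (a <= w i <= r * a)%N) ->
  Phi (origin D) = origin d -> Phi w = L -> (1 - q) ^+ (side J ^ D) <= 8^-1 ->
  gap_above q L ((relaxation_bound J)^-1).
Proof.
move=> J0 a0 wa Phi0 PhiL good.
have q100 : 0 < 10 / q by rewrite divr_gt0.
have TT : 0 < level_time J + site_time J.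
  by rewrite ltr_pwDl ?site_time_ge0 // (lt_le_trans ltr01) ?level_time_ge1.
have pos (n : nat) : (0 < n)%N ->
    0 < 12 * n%:R * ((10 / q) ^+ 3 * (level_time J + site_time J)).
  move=> n0; apply: mulr_gt0; last by apply: mulr_gt0 => //; exact: exprn_gt0.
  by apply: mulr_gt0 => //; rewrite ltr0n.
have big (K n : nat) : (K <= side J ^ D)%N -> (n <= (8 * r + 1) * (D * side J))%N ->
    (relaxation_bound J)^-1 <=
    (12 * ((1 + 3 * (K * K * n.+1 ^ d))%N)%:R * ((10 / q) ^+ 3 * (level_time J + site_time J)))^-1.
  move=> KK nn; rewrite lef_pV2 ?posrE.
  - rewrite /relaxation_bound ler_wpM2r //.
      by rewrite mulr_ge0 ?(ltW TT) // exprn_ge0 // ltW.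
    rewrite ler_wpM2l // ler_nat leq_add2l leq_mul2l /=.
    rewrite leq_mul ?leq_mul //.
    by case: (d) => // d'; rewrite leq_exp2r.
  - exact: pos.
  - exact: pos.
(* Below four sides of the top scale the chain of boxes would have no step, and a single gadget is
   used instead. *)
have [aJ|aJ] := ltnP a (4 * side J).
  have G : gadget q (origin d) L (level_time J) (site_time J).
    have := @wide_gadget a J.-1 (origin D) w (leq_pred J) a0.
    by rewrite prednK // Phi0 PhiL; apply=> // i; rewrite ffunE.
  apply: gap_above_le (gadget_gap hq G (level_time_ge1 J) (site_time_ge0 J)).
  apply: big.
    exact: sideD_gt0.
  rewrite -PhiL Phi_rank /rank; apply: (@leq_trans (\sum_(i < D) 4 * r * side J)).
    apply: leq_sum => i _; have /andP[_ h] := wa i; apply: (leq_trans h).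
    by move: aJ; clear; nia.
  rewrite sum_nat_const card_ord mulnCA leq_mul2r.
  by apply/orP; right; clear; lia.
pose A : site D := [ffun _ => side J].
have A0 i : (0 < A i)%N by rewrite ffunE side_gt0.
have M0 : (0 < a %/ (4 * side J))%N by rewrite divn_gt0 ?muln_gt0 ?side_gt0.
have wi i : (4 * A i * (a %/ (4 * side J)) <= w i <= 4 * (2 * r) * A i * (a %/ (4 * side J)))%N.
  by rewrite ffunE; exact: wide_step.
have G (u u' : site D) : (forall i, (u i + A i <= u' i <= u i + (4 * (2 * r) + 1) * A i)%N) ->
    gadget q (Phi u) (Phi u') (level_time J) (site_time J).
  by move=> H; apply: level_step_gadget => // i; have := H i; rewrite ffunE.
have good' : (1 - q) ^+ volume A <= 8^-1 by rewrite volume_side.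
apply: gap_above_le (boxes_gap hq D0 Phi_rank Phi_inj M0 A0 wi G
  (level_time_ge1 J) (site_time_ge0 J) Phi0 PhiL good').
apply: big.
  by rewrite volume_side.
rewrite mulnA leq_mul2l; apply/orP; right.
by rewrite /rank (eq_bigr (fun=> side J)) ?sum_nat_const ?card_ord // => i _; rewrite ffunE.
Qed.

End Levels.

(** * Asymptotics in theta *)

Section Theta.
Variable R : realType.
Implicit Types (q x y u : R).

Lemma theta_gt0 q : 0 < q < 1 -> 0 < theta q.
Proof.
move=> /andP[q0 q1]; rewrite normr_gt0 mulf_neq0 //.
  by rewrite lt_eqF // ln_lt0 // q0 q1.
by rewrite invr_neq0 // gt_eqF // ln_gt0 // ltr1n.
Qed.

Lemma pow2_theta q : 0 < q < 1 -> 2 `^ (- theta q) = q.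
Proof.
move=> /andP[q0 q1]; have l2 : 0 < ln (2 : R) by rewrite ln_gt0 // ltr1n.
have lq : ln q < 0 by rewrite ln_lt0 // q0 q1.
rewrite /theta normrM normfV (ltr0_norm lq) (gtr0_norm l2) /powR pnatr_eq0 /=.
by rewrite !mulNr opprK divfK ?lnK ?posrE // gt_eqF.
Qed.

Lemma pow2_gt0 x : 0 < 2 `^ x :> R. Proof. by rewrite powR_gt0. Qed.

Lemma pow2_ge0 x : 0 <= 2 `^ x :> R. Proof. exact: powR_ge0. Qed.

Lemma pow2D x y : 2 `^ (x + y) = 2 `^ x * 2 `^ y :> R.
Proof. by rewrite powRD // pnatr_eq0 implybT. Qed.

Lemma pow2N x : 2 `^ (- x) = (2 `^ x)^-1 :> R. Proof. exact: powRN. Qed.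

Lemma pow2_nat n : 2 `^ n%:R = (2 ^ n)%:R :> R.
Proof. by rewrite powR_mulrn // natrX. Qed.

Lemma ler_pow2 x y : x <= y -> 2 `^ x <= 2 `^ y :> R.
Proof. by move=> xy; rewrite ler_powR // ler1n. Qed.

Lemma ltr_pow2 x y : x < y -> 2 `^ x < 2 `^ y :> R.
Proof. by move=> xy; rewrite /powR pnatr_eq0 /= ltr_expR ltr_pM2r // ln_gt0 // ltr1n. Qed.

Lemma le_pow2 x y : 2 `^ x <= 2 `^ y :> R -> x <= y.
Proof. by move=> h; rewrite leNgt; apply/negP => /ltr_pow2; rewrite ltNge h. Qed.

Lemma natr_le_pow2 n : n%:R <= 2 `^ n%:R :> R.
Proof. by rewrite pow2_nat ler_nat ltnW // ltn_expl. Qed.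

Lemma mul_le_pow2 (a b x y : R) : 0 <= a -> 0 <= b -> a <= 2 `^ x -> b <= 2 `^ y ->
  a * b <= 2 `^ (x + y).
Proof. by move=> *; rewrite pow2D ler_pM. Qed.

Lemma exp_le_pow2 (a x : R) n : 0 <= a -> a <= 2 `^ x -> a ^+ n <= 2 `^ (n%:R * x).
Proof.
move=> a0 ax; elim: n => [|n IH]; first by rewrite mul0r powRr0.
rewrite exprS -[n.+1%:R]natr1 mulrDl mul1r addrC.
by apply: mul_le_pow2 => //; rewrite exprn_ge0.
Qed.

Lemma small_theta (A : R) : exists2 q0, 0 < q0 & forall q, 0 < q < 1 -> q <= q0 -> A <= theta q.
Proof.
exists (2 `^ (- A)); first exact: pow2_gt0.
by move=> q q01; rewrite -{1}(pow2_theta q01) => /le_pow2; rewrite lerN2.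
Qed.

Lemma inv_le_pow2 q c (a : nat) : 0 < q < 1 -> c <= 2 `^ a%:R -> 0 <= c ->
  c / q <= 2 `^ (a%:R + theta q).
Proof.
move=> q01 ca c0; rewrite -{1}(pow2_theta q01) -pow2N opprK.
by apply: mul_le_pow2 => //; exact: pow2_ge0.
Qed.

Lemma ten_div q : 0 < q < 1 -> 10 / q <= 2 `^ (4 + theta q).
Proof. by move=> q01; apply: (@inv_le_pow2 q 10 4) => //; rewrite pow2_nat ler_nat. Qed.

Lemma twenty_div q : 0 < q < 1 -> 20 / q <= 2 `^ (5 + theta q).
Proof. by move=> q01; apply: (@inv_le_pow2 q 20 5) => //; rewrite pow2_nat ler_nat. Qed.

End Theta.

(** * Exponents of the multi-scale times *)

Section TimeBounds.
Variables (R : realType) (d D : nat) (q : R).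
Hypothesis hq : 0 < q < 1.
Hypothesis D0 : (0 < D)%N.
Variables (J m e : nat).
Hypothesis J0 : (0 < J)%N.
Let th := theta q.
Hypothesis th1 : 1 <= th.
Hypothesis m_ge : th <= D%:R * J%:R * m%:R.
Hypothesis m_le : m%:R <= th / (D%:R * J%:R) + 5.

Notation T0 := ((10 / q) ^+ e).
Notation ltime := (level_time D q m T0).
Notation stime := (site_time D q m T0).

Let q0 : 0 < q. Proof. by case/andP: hq. Qed.
Let q1 : q < 1. Proof. by case/andP: hq. Qed.
Let th0 : 0 <= th. Proof. exact: le_trans th1. Qed.
Let DR : 0 < D%:R :> R. Proof. by rewrite ltr0n. Qed.
Let JR : 0 < J%:R :> R. Proof. by rewrite ltr0n. Qed.

Lemma T0_ge1 : 1 <= T0.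
Proof. by apply: exprn_ege1; apply: ler1_invp => //; exact: ltW. Qed.

Lemma side_pow2 k : (side m k ^ D)%:R = 2 `^ (D%:R * m%:R * k%:R) :> R.
Proof. by rewrite /side -expnM -pow2_nat !natrM; congr (_ `^ _); ring. Qed.

Lemma vacancy_bound k : (k <= J)%N ->
  10 / vacancy_prob q (side m k ^ D) <= 2 `^ (5 + th * (1 - k%:R / J%:R)).
Proof.
move=> kJ; set u := th * _.
have u0 : 0 <= u.
  by rewrite mulr_ge0 // subr_ge0 ler_pdivrMr // mul1r ler_nat.
have uth : th - D%:R * m%:R * k%:R <= u.
  rewrite /u mulrBr mulr1 lerD2l lerN2 mulrA ler_pdivrMr //.
  rewrite (_ : D%:R * m%:R * k%:R * J%:R = D%:R * J%:R * m%:R * k%:R); last by ring.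
  by rewrite ler_wpM2r.
have v : 2 `^ (- u) / 2 <= vacancy_prob q (side m k ^ D).
  rewrite /vacancy_prob ler_wpM2r // le_min; apply/andP; split.
    by rewrite -[leRHS](powRr0 2) ler_pow2 // oppr_le0.
  by rewrite side_pow2 -{1}(pow2_theta hq) -pow2D ler_pow2 // -/th; lra.
have v0 : 0 < 2 `^ (- u) / 2 :> R by rewrite divr_gt0 // pow2_gt0.
apply: (@le_trans _ _ (10 / (2 `^ (- u) / 2))).
  by rewrite ler_wpM2l // lef_pV2 ?posrE // (lt_le_trans v0).
rewrite invf_div mulrA -pow2N opprK pow2D ler_wpM2r ?pow2_ge0 //.
by rewrite pow2_nat -natrM ler_nat.
Qed.

(** The base contributes (4 + theta) e. Level j then adds m (5 + theta (1 - j / J)) for its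
    bisections and D m j for the size of its blocks; the arithmetic progression in j produces the
    last term. *)
Definition time_exponent k : R :=
  (4 + th) * e%:R + m%:R * k%:R * (5 + D%:R * k%:R)
  + m%:R * th * (k%:R - k%:R * (k%:R - 1) / (2 * J%:R)).

Lemma level_time_bound k : (k <= J)%N -> ltime k <= 2 `^ time_exponent k.
Proof.
elim: k => [_|k IH kJ].
  have -> : time_exponent 0 = e%:R * (4 + th) by rewrite /time_exponent mulr0n; ring.
  by apply: exp_le_pow2; [rewrite divr_ge0 // ltW | exact: ten_div].
have v0 : 0 <= 10 / vacancy_prob q (side m k ^ D).
  by rewrite divr_ge0 // ltW // vacancy_prob_gt0 // sideD_gt0.
have a1 := exp_le_pow2 m v0 (vacancy_bound (ltnW kJ)).
have a2 : (side m k ^ D)%:R * ltime k <= 2 `^ (D%:R * m%:R * k%:R + time_exponent k).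
  apply: mul_le_pow2 => //; first by apply: level_time_ge0 => //; exact: T0_ge1.
    by rewrite side_pow2.
  by apply: IH; exact: ltnW.
apply: le_trans (mul_le_pow2 _ _ a1 a2) _.
- exact: exprn_ge0.
- by rewrite mulr_ge0 //; apply: level_time_ge0 => //; exact: T0_ge1.
apply: ler_pow2; rewrite /time_exponent -[k.+1%:R]natr1.
have m0 : 0 <= m%:R :> R by []. have k0 : 0 <= k%:R :> R by [].
have h : 0 <= D%:R * m%:R * (k%:R + 1) :> R.
  by apply: mulr_ge0; [exact: mulr_ge0 | exact: addr_ge0].
rewrite -subr_ge0; set X := (X in 0 <= X).
rewrite (_ : X = D%:R * m%:R * (k%:R + 1)) // /X.
by field; rewrite gt_eqF.
Qed.

(** The coefficient of theta^2, from m close to theta / (D J). With s = k / J it tends to (s - s^2 /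
    2) / D for large J: this is 1 / (2 D) at s = 1 and strictly less for s < 1, the source of the
    gain for elongated boxes. *)
Definition time_coef k : R := (k%:R - k%:R * (k%:R - 1) / (2 * J%:R)) / (D%:R * J%:R).

Definition time_const k : R :=
  1 + (5 + 1) * k%:R + (4 + 1) * e%:R + 6 * k%:R * (5 + D%:R * k%:R) + 5 * k%:R.

Lemma times_bound k : (k <= J)%N ->
  ltime k + stime k <= 2 `^ (time_coef k * th ^+ 2 + time_const k * th).
Proof.
move=> kJ; have T1 := T0_ge1.
have l0 := level_time_ge0 D hq m T1 k.
have q200 : 0 <= 20 / q by rewrite divr_ge0 // ltW.
have q20 : 1 <= 20 / q by rewrite ler_pdivlMr // mul1r; have := q1; lra.
have e1 : 1 <= (20 / q) ^+ k by exact: exprn_ege1.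
have b1 : ltime k + stime k <= 2 * ((20 / q) ^+ k * ltime k).
  have : ltime k <= (20 / q) ^+ k * ltime k by rewrite ler_peMl.
  by rewrite /site_time; lra.
have b2 : 2 <= 2 `^ 1 :> R by rewrite powRr1.
have b3 := exp_le_pow2 k q200 (twenty_div hq).
have b4 := mul_le_pow2 (exprn_ge0 k q200) l0 b3 (level_time_bound kJ).
have b5 := mul_le_pow2 (ler0n R 2) (mulr_ge0 (exprn_ge0 k q200) l0) b2 b4.
apply: (le_trans b1); apply: (le_trans b5); apply: ler_pow2.
rewrite /time_exponent /time_const -/th.
set c := k%:R - k%:R * (k%:R - 1) / (2 * J%:R).
have k0 : 0 <= k%:R :> R by [].
have D1 : 1 <= D%:R :> R by rewrite ler1n.
have J1 : 1 <= J%:R :> R by rewrite ler1n.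
have DJ0 : 0 < D%:R * J%:R :> R by rewrite mulr_gt0.
have c0 : 0 <= c.
  rewrite subr_ge0 ler_pdivrMr ?mulr_gt0 // ler_wpM2l //.
  have : k%:R <= J%:R :> R by rewrite ler_nat.
  by have := JR; lra.
have ck : c <= k%:R.
  case: (k) @c c0 => [|k'] c c0; first by rewrite /c !mul0r subr0.
  rewrite gerBl; apply: divr_ge0; last by rewrite mulr_ge0 // ltW.
  by rewrite mulr_ge0 // subr_ge0 ler1n.
have m6 : m%:R <= 6 * th.
  apply: (le_trans m_le); have : th / (D%:R * J%:R) <= th.
    by rewrite ler_pdivrMr // ler_peMr // mulr_ege1.
  by have := th1; lra.
have x1 : m%:R * th * c <= (th / (D%:R * J%:R) + 5) * th * c.
  by rewrite ler_wpM2r // ler_wpM2r.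
have x2 : th * c <= th * k%:R by rewrite ler_wpM2l.
have x3 : m%:R * k%:R * (5 + D%:R * k%:R) <= 6 * th * k%:R * (5 + D%:R * k%:R).
  by rewrite ler_wpM2r ?addr_ge0 ?mulr_ge0 // ?(ltW DR) // ler_wpM2r.
have x4 : time_coef k * th ^+ 2 = th / (D%:R * J%:R) * th * c.
  by rewrite /time_coef -/c; ring.
rewrite x4.
have y1 : e%:R <= th * e%:R by rewrite ler_peMl.
have y2 : k%:R <= th * k%:R by rewrite ler_peMl.
move: x1 x2 x3 y1 y2 th1; move: (th / (D%:R * J%:R)) => z.
by move=> *; lra.
Qed.

End TimeBounds.

(** * Gap bounds as powers of 2 *)

Section Admissible.
Variables (R : realType) (d : nat).
Hypothesis d0 : (0 < d)%N.
Implicit Types (q kappa eps lambda beta : R).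

Lemma prefactor_bound q (K N : nat) (a b T : R) : 0 < q < 1 -> 1 <= theta q ->
  (0 < K)%N -> (0 < N)%N -> K%:R <= 2 `^ (a * theta q) -> N%:R <= 2 `^ (b * theta q) ->
  0 <= T ->
  12 * ((1 + 3 * (K * K * N ^ d))%N)%:R * ((10 / q) ^+ 3 * T) <=
  2 `^ ((21 + 2 * a + d%:R * b) * theta q) * T.
Proof.
move=> hq th1 K0 N0 Ka Nb T0; rewrite mulrA ler_wpM2r //.
have Y0 : (0 < K * K * N ^ d)%N by rewrite !muln_gt0 K0 expn_gt0 N0.
have q0 : 0 <= 10 / q by rewrite divr_ge0 // ltW //; case/andP: hq.
have y1 : (K * K * N ^ d)%:R <= 2 `^ (a * theta q + a * theta q + d%:R * (b * theta q)).
  rewrite !natrM natrX; apply: mul_le_pow2 => //; first exact: mul_le_pow2.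
  exact: exp_le_pow2.
have y2 : 12 * ((1 + 3 * (K * K * N ^ d))%N)%:R <= 64 * (K * K * N ^ d)%:R :> R.
  by rewrite -!natrM ler_nat; move: Y0; clear; lia.
have y3 : 64 <= 2 `^ 6 :> R by rewrite pow2_nat ler_nat.
have y4 := mul_le_pow2 (ler0n _ 64) (ler0n _ _) y3 y1.
have y5 := mul_le_pow2 (mulr_ge0 (ler0n _ 64) (ler0n _ _)) (exprn_ge0 3 q0) y4
  (exp_le_pow2 3 q0 (ten_div hq)).
apply: le_trans (ler_wpM2r (exprn_ge0 3 q0) y2) _; apply: (le_trans y5).
by apply: ler_pow2; lra.
Qed.

Lemma gadget_small q (e : nat) (x y : site d) : 0 < q < 1 -> sle x y ->
  (0 < rank y - rank x <= 2 ^ e)%N ->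
  gadget q x y ((10 / q) ^+ e.+2) ((10 / q) ^+ e.+2).
Proof.
move=> hq xy xye; have [p up [p0 pn]] := unit_path_ex d0 xy.
by have := gadget_path hq 0 up xye; rewrite p0 add0n pn.
Qed.

Lemma sle_origin (L : site d) : sle (origin d) L.
Proof. by apply/forallP => i; rewrite ffunE. Qed.

(** Bounded boxes relax in time 2^(O(theta)). This covers the degenerate cases, in particular L = 0,
    which the multi-scale construction excludes. *)
Lemma small_gap (n : nat) : exists C : R, forall q, 0 < q < 1 -> 1 <= theta q ->
  forall L : site d, (rank L <= n)%N -> gap_above q L (2 `^ (- (C * theta q))).
Proof.
exists (21 + 2 * 0 + d%:R * n.+1%:R + (1 + 5 * n.+2%:R)) => q hq th1 L Ln.
have q10 : 1 <= 10 / q by apply: ler1_invp; case/andP: hq => // _ /ltW.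
have q0 : 0 <= 10 / q by exact: le_trans q10.
have th0 : 0 <= theta q by exact: le_trans th1.
have T0 : 0 <= (10 / q) ^+ n.+2 by exact: exprn_ge0.
have T1 : 1 <= (10 / q) ^+ n.+2 by exact: exprn_ege1.
have bT : (10 / q) ^+ n.+2 + (10 / q) ^+ n.+2 <= 2 `^ ((1 + 5 * n.+2%:R) * theta q).
  rewrite -mulr2n -[X in X <= _]mulr_natl; apply: le_trans (mul_le_pow2 (x := 1) _ _ _ (exp_le_pow2 n.+2 q0 (ten_div hq))) _ => //.
    by rewrite powRr1.
  apply: ler_pow2; have : n.+2%:R <= n.+2%:R * theta q by rewrite ler_peMr.
  by lra.
have bnd (N : nat) : (0 < N)%N -> (N <= n.+1)%N ->
    2 `^ (- ((21 + 2 * 0 + d%:R * n.+1%:R + (1 + 5 * n.+2%:R)) * theta q)) <=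
    (12 * ((1 + 3 * (1 * 1 * N ^ d))%N)%:R * ((10 / q) ^+ 3 * ((10 / q) ^+ n.+2 + (10 / q) ^+ n.+2)))^-1.
  move=> N0 Nn; rewrite pow2N lef_pV2 ?posrE ?pow2_gt0 //; last first.
    have q00 : 0 < 10 / q by exact: lt_le_trans q10.
    apply: mulr_gt0; last by rewrite mulr_gt0 ?exprn_gt0 // addr_gt0 ?exprn_gt0.
    by apply: mulr_gt0 => //; rewrite ltr0n.
  apply: le_trans (prefactor_bound (K := 1) (a := 0) (b := n.+1%:R) hq th1 _ N0 _ _ _) _ => //.
  - by rewrite mul0r powRr0.
  - apply: (le_trans _ (ler_pow2 (_ : n.+1%:R <= _))); last by rewrite ler_peMr.
    by apply: le_trans (natr_le_pow2 R n.+1); rewrite ler_nat.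
  - by rewrite addr_ge0.
  by rewrite [X in _ <= 2 `^ X]mulrDl pow2D ler_wpM2l // pow2_ge0.
have [Lo|Lo] := posnP (rank L).
  have -> : L = origin d.
    apply/ffunP => i; rewrite ffunE; apply/eqP; rewrite -leqn0 -Lo /rank.
    by rewrite (bigD1 i) //= leq_addr.
  apply: gap_above_le (origin_gap d hq); apply: le_trans (bnd 1%N _ _) _ => //.
  rewrite lef_pV2 ?posrE.
  - rewrite ler_wpM2l // ?mulr_ge0 // ler_wpM2l ?exprn_ge0 //; lra.
  - apply: mulr_gt0; last by rewrite mulr_gt0 ?exprn_gt0 ?addr_gt0 ?(lt_le_trans _ T1) ?(lt_le_trans _ q10).
    by apply: mulr_gt0 => //; rewrite ltr0n.
  - apply: mulr_gt0; last by rewrite mulr_gt0 ?exprn_gt0 // (lt_le_trans _ q10).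
    by apply: mulr_gt0 => //; rewrite ltr0n.
have G : gadget q (origin d) L ((10 / q) ^+ n.+2) ((10 / q) ^+ n.+2).
  apply: gadget_small => //; first exact: sle_origin.
  rewrite rank_origin subn0 Lo (leq_trans Ln) //; exact/ltnW/ltn_expl.
apply: gap_above_le (gadget_gap hq G T1 T0).
exact: bnd.
Qed.

(** The 3 makes the top box of volume at least 8 / q, hence empty of vacancies with probability at
    most 1/8. After rounding up, [m] exceeds theta / (D J) by at most 5. *)
Lemma level_parameter (D J : nat) (x : R) : (0 < D)%N -> (0 < J)%N -> 0 <= x ->
  exists m, [/\ (2 <= m)%N, x + 3 <= D%:R * J%:R * m%:R & m%:R <= x / (D%:R * J%:R) + 5].
Proof.
move=> D0 J0 x0; set u := (x + 3) / (D%:R * J%:R).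
have DJ1 : 1 <= D%:R * J%:R :> R by rewrite mulr_ege1 // ler1n.
have DJ0 : 0 < D%:R * J%:R :> R by exact: lt_le_trans DJ1.
have u0 : 0 <= u by rewrite divr_ge0 ?addr_ge0 // ltW.
have /andP[t1 t2] := truncn_itv u0.
exists (Num.truncn u).+2; split=> //.
  rewrite mulrC -ler_pdivrMr // -/u (le_trans (ltW t2)) //.
  by rewrite ler_nat.
have h : 3 / (D%:R * J%:R) <= 3 :> R by rewrite ler_pdivrMr // ler_peMr.
have : (Num.truncn u).+2%:R = (Num.truncn u)%:R + 2 :> R by rewrite -natrD addn2.
have uE : u = x / (D%:R * J%:R) + 3 / (D%:R * J%:R) by rewrite /u mulrDl.
lra.
Qed.

Lemma small_power q n : 0 < q < 1 -> 8 <= n%:R * q -> (1 - q) ^+ n <= 8^-1.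
Proof.
move=> hq n8; have b := bernoulli_inv hq n.
have p0 : 0 <= (1 - q) ^+ n by rewrite exprn_ge0 // subr_ge0 ltW //; case/andP: hq.
have : (1 - q) ^+ n * 8 <= 1.
  by apply: le_trans b; rewrite ler_wpM2l //; lra.
by lra.
Qed.

Lemma good_box q (D J m : nat) : 0 < q < 1 ->
  theta q + 3 <= D%:R * J%:R * m%:R -> (1 - q) ^+ (side m J ^ D) <= 8^-1.
Proof.
move=> hq hm; apply: small_power => //.
rewrite side_pow2 -{1}(pow2_theta hq) -pow2D.
apply: (@le_trans _ _ (2 `^ 3)); first by rewrite pow2_nat ler_nat.
by apply: ler_pow2; move: hm; rewrite -(mulrA D%:R) [J%:R * _]mulrC mulrA; lra.
Qed.

(* The exponent of the relaxation time in dimension [D], up to O(1/J). *)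
Lemma level_gap_bound (D J r : nat) : (0 < D)%N -> (0 < J)%N ->
  exists C : R, forall q, 0 < q < 1 -> 1 <= theta q ->
  forall (Phi : site D -> site d) (L : site d) (w : site D) (a : nat),
  (forall x, rank (Phi x) = rank x) -> injective Phi ->
  (forall x y : site D, (forall i, x i < y i)%N -> sle (Phi x) (Phi y)) ->
  Phi (origin D) = origin d -> Phi w = L -> (0 < a)%N ->
  (forall i, (a <= w i <= r * a)%N) ->
  gap_above q L (2 `^ (- ((1 + J%:R^-1) / (2 * D%:R) * theta q ^+ 2 + C * theta q))).
Proof.
(* [wide_step] yields chains of ratio 2 r, whose steps have ratio 4 (2 r) + 1. The number [e0]
   bounds the l1 length of the base moves and does not depend on q. *)
move=> D0 J0; pose k0 := (8 * r + 1)%N; pose e0 := (D * level_ratio J k0 0)%N.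
have DR : 0 < D%:R :> R by rewrite ltr0n.
have JR : 0 < J%:R :> R by rewrite ltr0n.
pose a1 : R := 6 * D%:R * J%:R; pose b1 : R := ((8 * r + 2) * D)%:R + 6 * J%:R.
exists (time_const R D e0.+2 J + (21 + 2 * a1 + d%:R * b1)).
move=> q hq th1 Phi L w a Phi_rank Phi_inj Phi_le Phi0 PhiL a0 wa.
have th0 : 0 <= theta q by exact: le_trans th1.
have [m [m2 m_ge m_le]] := level_parameter D0 J0 th0.
have m_ge' : theta q <= D%:R * J%:R * m%:R by lra.
have T01 := T0_ge1 hq e0.+2.
have base (x y : site D) : (forall i, (x i + 1 <= y i <= x i + level_ratio J k0 0 * 1)%N) ->
    gadget q (Phi x) (Phi y) ((10 / q) ^+ e0.+2) ((10 / q) ^+ e0.+2).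
  move=> xy; have xy' i : (x i < y i)%N by have /andP[] := xy i; rewrite addn1.
  have r1 : (rank x < rank y)%N.
    rewrite /rank (bigD1 (Ordinal D0)) //= [in ltnRHS](bigD1 (Ordinal D0)) //=.
    by rewrite -addSn leq_add // leq_sum // => i _; exact: ltnW.
  have r2 : (rank y <= rank x + e0)%N.
    apply: (@leq_trans (\sum_(i < D) (x i + level_ratio J k0 0))).
      by apply: leq_sum => i _; have /andP[_] := xy i; rewrite muln1.
    by rewrite big_split /= sum_nat_const card_ord.
  apply: gadget_small => //; first exact: Phi_le.
  rewrite !Phi_rank subn_gt0 r1 leq_subLR (leq_trans r2) // leq_add2l.
  exact/ltnW/ltn_expl.
have k00 : (0 < k0)%N by rewrite /k0 addn1.
have := level_gap hq D0 Phi_rank Phi_inj m2 k00 T01 base (leqnn k0) J0 a0 wa Phi0 PhiL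
  (good_box hq m_ge).
apply: gap_above_le; rewrite pow2N lef_pV2 ?posrE ?pow2_gt0 //; last first.
  have q00 : 0 < 10 / q by rewrite divr_gt0 //; case/andP: hq.
  apply: mulr_gt0; first by apply: mulr_gt0 => //; rewrite ltr0n.
  apply: mulr_gt0; first exact: exprn_gt0.
  by rewrite ltr_pwDl ?site_time_ge0 // (lt_le_trans ltr01) ?level_time_ge1.
have TT0 : 0 <= level_time D q m ((10 / q) ^+ e0.+2) J + site_time D q m ((10 / q) ^+ e0.+2) J.
  by rewrite addr_ge0 ?level_time_ge0 ?site_time_ge0.
have m6 : m%:R <= 6 * theta q.
  apply: (le_trans m_le); have : theta q / (D%:R * J%:R) <= theta q.
    by rewrite ler_pdivrMr ?mulr_gt0 // ler_peMr // mulr_ege1 // ler1n.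
  by lra.
apply: le_trans (prefactor_bound (a := a1) (b := b1) hq th1 _ _ _ _ TT0) _ => //.
- exact: sideD_gt0.
- rewrite side_pow2; apply: ler_pow2; rewrite /a1.
  rewrite (_ : D%:R * m%:R * J%:R = D%:R * J%:R * m%:R); last by ring.
  by apply: (@le_trans _ _ (D%:R * J%:R * (6 * theta q))); [rewrite ler_wpM2l | lra].
- apply: (@le_trans _ _ (((8 * r + 2) * D)%:R * (side m J)%:R)).
    rewrite -natrM ler_nat; have := side_gt0 m J.
    by move: (side m J) => s s0; move: D0; clear -s0; nia.
  rewrite /b1 mulrDl; apply: mul_le_pow2 => //.
    by apply: le_trans (natr_le_pow2 _ _) _; apply: ler_pow2; rewrite ler_peMr.
  rewrite /side -pow2_nat; apply: ler_pow2; rewrite natrM.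
  by apply: (@le_trans _ _ (6 * theta q * J%:R)); [rewrite ler_wpM2r | lra].
have tb := times_bound hq D0 e0.+2 J0 th1 m_ge' m_le (leqnn J).
apply: le_trans (ler_wpM2l (pow2_ge0 _) tb) _; rewrite -pow2D; apply: ler_pow2.
have -> : time_coef R D J J = (1 + J%:R^-1) / (2 * D%:R).
  by rewrite /time_coef; field; rewrite !gt_eqF.
by lra.
Qed.

End Admissible.

(** * The condition H(beta) for the coefficients 1 and 1/d *)

Section CalH.
Variables (R : realType) (d : nat).
Hypothesis d0 : (0 < d)%N.
Implicit Types (q kappa eps lambda beta : R).

Lemma quadratic_dominates (c c' C : R) : c < c' ->
  exists2 M : R, 1 <= M & forall x, M <= x -> c * x ^+ 2 + C * x <= c' * x ^+ 2.
Proof.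
move=> cc; have e0 : 0 < c' - c by rewrite subr_gt0.
exists (1 + `|C| / (c' - c)); first by rewrite lerDl divr_ge0 // ltW.
move=> x Mx; have n0 : 0 <= `|C| / (c' - c) by rewrite divr_ge0 // ltW.
have x0 : 0 <= x by lra.
have : `|C| / (c' - c) <= x by lra.
rewrite ler_pdivrMr // => h; have h2 := le_trans (ler_norm C) h.
by have := ler_wpM2r x0 h2; lra.
Qed.

Lemma inv_nat_lt eps : 0 < eps -> exists2 J : nat, (0 < J)%N & J%:R^-1 < eps.
Proof.
move=> e0; exists (Num.truncn eps^-1).+1 => //.
have ie0 : 0 <= eps^-1 by rewrite invr_ge0 ltW.
have /andP[_ h] := truncn_itv ie0.
by rewrite invf_plt ?posrE // ltr0n.
Qed.

(** The strict inequality on [c] leaves room to absorb the term linear in theta once q is small. *)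
Lemma calH_gap_above beta lambda :
  (forall kappa eps, 1 <= kappa -> 0 < eps -> exists (M C c : R),
     [/\ c < (1 + eps) * lambda / 2 &
     forall q, 0 < q < 1 -> M <= theta q -> forall L : site d,
     outstretched beta kappa q L ->
     gap_above q L (2 `^ (- (c * theta q ^+ 2 + C * theta q)))]) ->
  calH d beta lambda.
Proof.
move=> H kappa eps k1 e0; have [M [C [c [cl HM]]]] := H kappa eps k1 e0.
have [M' _ HM'] := quadratic_dominates C cl.
have [q1 q10 Hq1] := small_theta (Num.max M M').
exists q1 => // q hq qq1 L Lo; have := Hq1 q hq qq1.
rewrite ge_max => /andP[MQ M'Q].
apply: gap_above_le (HM q hq MQ L Lo); apply: ler_pow2; rewrite lerN2.
by apply: le_trans (HM' _ M'Q) _; lra.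
Qed.

Definition on_path (p : nat -> site d) (x : site 1) : site d := p (x ord0).

Lemma rank1 (x : site 1) : rank x = x ord0.
Proof. by rewrite /rank big_ord1. Qed.

Lemma unit_path_sle (p : nat -> site d) i j : unit_path p -> (i <= j)%N -> sle (p i) (p j).
Proof.
move=> up; elim: j => [|j IH]; first by rewrite leqn0 => /eqP ->; exact: sle_refl.
rewrite leq_eqVlt => /orP[/eqP ->|ij]; first exact: sle_refl.
apply: sle_trans (IH ij) _; have [l ->] := up j.
by apply/forallP => k; rewrite ffunE leq_addr.
Qed.

Lemma on_path_rank (p : nat -> site d) : unit_path p -> rank (p 0%N) = 0%N ->
  forall x, rank (on_path p x) = rank x.
Proof. by move=> up p0 x; rewrite /on_path (unit_path_rank (x ord0) up) p0 rank1. Qed.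

Lemma on_path_inj (p : nat -> site d) : unit_path p -> injective (on_path p).
Proof.
move=> up x y xy; have := congr1 (@rank d) xy.
rewrite /on_path (unit_path_rank (x ord0) up) (unit_path_rank (y ord0) up) => /addnI e.
by apply/ffunP => i; rewrite (ord1 i).
Qed.

Lemma calH_one beta : calH d beta 1.
Proof.
apply: (@calH_gap_above _ _) => kappa eps _ e0; have [J J0 Je] := inv_nat_lt e0.
have [C1 H1] := small_gap R d0 0.
have [C2 H2] := level_gap_bound R d0 (D := 1) 1 isT J0.
exists 1, (Num.max 0 (Num.max C1 C2)), ((1 + J%:R^-1) / 2); split.
  by rewrite mulr1 ltr_pM2r ?invr_gt0 // ltrD2l.
move=> q hq th1 L _; have th0 : 0 <= theta q by exact: le_trans th1.
have J1 : 0 <= (1 + J%:R^-1) / 2 * theta q ^+ 2 :> R.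
  by rewrite mulr_ge0 ?sqr_ge0 // divr_ge0 // addr_ge0.
have [L0|L0] := posnP (rank L).
  apply: gap_above_le (H1 q hq th1 L _); last by rewrite L0.
  apply: ler_pow2; rewrite lerN2.
  have : C1 * theta q <= Num.max 0 (Num.max C1 C2) * theta q.
    by rewrite ler_wpM2r // !le_max lexx !orbT.
  by lra.
have [p up [p0 pL]] := unit_path_ex d0 (sle_origin L).
have p00 : rank (p 0%N) = 0%N by rewrite p0 rank_origin.
have := H2 q hq th1 (on_path p) L [ffun _ => rank L] (rank L)
  (on_path_rank up p00) (on_path_inj up).
move=> H; apply: gap_above_le (H _ _ _ L0 _).
- apply: ler_pow2; rewrite lerN2 mulr1.
  have : C2 * theta q <= Num.max 0 (Num.max C1 C2) * theta q.
    by rewrite ler_wpM2r // !le_max lexx !orbT.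
  by lra.
- by move=> x y xy; apply: unit_path_sle => //; exact/ltnW/xy.
- by rewrite /on_path ffunE.
- by rewrite /on_path ffunE -[in RHS]pL rank_origin subn0.
- by move=> i; rewrite ffunE mul1n leqnn.
Qed.

Lemma calH_zero : calH d 0 (d%:R^-1 : R).
Proof.
apply: (@calH_gap_above _ _) => kappa eps k1 e0; have [J J0 Je] := inv_nat_lt e0.
have dR : 0 < d%:R :> R by rewrite ltr0n.
pose r := (Num.truncn kappa).+1.
have kr : kappa <= r%:R.
  by have /andP[_ /ltW] := truncn_itv (le_trans ler01 k1).
have [C1 H1] := small_gap R d0 (d * r).
have [C2 H2] := level_gap_bound R d0 r d0 J0.
exists 1, (Num.max 0 (Num.max C1 C2)), ((1 + J%:R^-1) / (2 * d%:R)); split.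
  rewrite invfM mulrA -[ltRHS]mulrA [d%:R^-1 * _]mulrC mulrA.
  by rewrite ltr_pM2r ?invr_gt0 // ltr_pM2r ?invr_gt0 // ltrD2l.
move=> q hq th1 L Lo; have th0 : 0 <= theta q by exact: le_trans th1.
have J1 : 0 <= (1 + J%:R^-1) / (2 * d%:R) * theta q ^+ 2 :> R.
  by rewrite mulr_ge0 ?sqr_ge0 // divr_ge0 // ?addr_ge0 // mulr_ge0 // ltW.
have Lr i j : (maxn (L i) 1 <= r * maxn (L j) 1)%N.
  have := Lo i j; rewrite mul0r powRr0 mulr1 ler_pdivrMr ?ltr0n ?leq_max ?orbT //.
  move=> h; rewrite -(ler_nat R) natrM; apply: (le_trans h).
  by rewrite ler_wpM2r.
(* At beta = 0, one vanishing side forces all the others to be at most [r], and [small_gap]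
   applies. *)
have [/existsP[j /eqP Lj]|Lpos] := boolP [exists j, L j == 0%N].
  have Lsmall : (rank L <= d * r)%N.
    rewrite /rank; apply: (@leq_trans (\sum_(i < d) r)); last by rewrite sum_nat_const card_ord.
    apply: leq_sum => i _; have := Lr i j; rewrite Lj muln1.
    by rewrite geq_max => /andP[].
  apply: gap_above_le (H1 q hq th1 L Lsmall).
  apply: ler_pow2; rewrite lerN2.
  have : C1 * theta q <= Num.max 0 (Num.max C1 C2) * theta q.
    by rewrite ler_wpM2r // !le_max lexx !orbT.
  by lra.
have L1 i : (0 < L i)%N.
  by rewrite lt0n; apply: contra Lpos => Li; apply/existsP; exists i.
pose i0 := [arg min_(i < Ordinal d0) L i]%N.
have L0 i : (L i0 <= L i)%N by rewrite /i0; case: arg_minnP => // k _ /(_ i); apply.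
have := H2 q hq th1 id L L (L i0) (fun _ => erefl) (fun _ _ => id) _ erefl erefl (L1 i0).
move=> H; apply: gap_above_le (H _ _).
- apply: ler_pow2; rewrite lerN2.
  have : C2 * theta q <= Num.max 0 (Num.max C1 C2) * theta q.
    by rewrite ler_wpM2r // !le_max lexx !orbT.
  by lra.
- by move=> x y xy; apply/forallP => i; exact: ltnW.
by move=> i; rewrite L0 /=; have := Lr i i0; rewrite !(maxn_idPl _).
Qed.

End CalH.

(** * Boxes of aspect ratio 2^(beta theta) with 0 < beta < 1 *)

Section Slanted.
Variables (R : realType) (d : nat).
Hypothesis d0 : (0 < d)%N.
Implicit Types (q kappa beta : R).

(** The construction along a monotone path with r = 1, whence 9 = 8 r + 1. *)
Lemma line_gadget q (J m k : nat) (x y : site d) : 0 < q < 1 -> (2 <= m)%N ->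
  (k < J)%N -> sle x y -> (0 < rank y - rank x < 4 * side m k.+1)%N ->
  let T0 := (10 / q) ^+ (level_ratio J 9 0).+2 in
  gadget q x y (level_time 1 q m T0 k.+1) (site_time 1 q m T0 k.+1).
Proof.
move=> hq m2 kJ xy /andP[n0 nk] T0.
have [p up [p0 pn]] := unit_path_ex d0 xy.
have base (u v : site 1) :
    (forall i, (u i + 1 <= v i <= u i + level_ratio J 9 0 * 1)%N) ->
    gadget q (on_path p u) (on_path p v) T0 T0.
  move=> uv; have /andP[h1 h2] := uv ord0.
  rewrite /on_path -(subnKC (leq_trans (leq_addr 1 _) h1)).
  apply: gadget_path => //; rewrite subn_gt0 -addn1 h1 leq_subLR /=.
  rewrite muln1 in h2; apply: (leq_trans h2); rewrite leq_add2l.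
  exact/ltnW/ltn_expl.
have := @wide_gadget R d 1 q hq (on_path p) (on_path_inj up) J m 9 T0 m2 isT
  (T0_ge1 hq _) base 1 (leqnn 9) (rank y - rank x) k
  [ffun _ => 0%N] [ffun _ => (rank y - rank x)%N] (ltnW kJ) n0 nk.
rewrite /on_path !ffunE p0 pn; apply=> i.
by rewrite !ffunE add0n mul1n leqnn.
Qed.

(* In a box of aspect ratio 2^(beta theta), blocks of the same shape whose
   longest side is 2^(b theta) with b > (1 + beta) / 2 have volume larger than
   1/q: two consecutive ones can be joined by one-dimensional paths. *)
Lemma slanted_gap_bound beta kappa (J k : nat) : (2 <= d)%N -> 0 < beta < 1 ->
  1 <= kappa -> (k < J)%N -> (1 + beta) / 2 < k.+1%:R / J%:R ->
  exists M C : R, forall q, 0 < q < 1 -> M <= theta q -> forall L : site d,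
  outstretched beta kappa q L ->
  gap_above q L (2 `^ (- (time_coef R 1 J k.+1 * theta q ^+ 2 + C * theta q))).
Proof.
move=> d2 /andP[b0 b1] k1 kJ tau_b.
set K := k.+1; set b := (1 + beta) / 2 in tau_b.
have J0 : (0 < J)%N by exact: leq_ltn_trans kJ.
have JR : 0 < J%:R :> R by rewrite ltr0n.
pose r := (Num.truncn kappa).+1.
have kr : kappa <= r%:R.
  by have /andP[_ /ltW] := truncn_itv (le_trans ler01 k1).
(* Chosen so that s >= c 2^(b theta) implies both 16 rho <= s and a block volume of at least 8 / q,
   where rho <= r 2^(beta theta) bounds the aspect ratio. *)
pose c := (16 * r)%N.
have c0 : (0 < c)%N by [].
pose e0 := (level_ratio J 9 0)%N.
have tb0 : 0 < K%:R / J%:R - b by rewrite subr_gt0.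
pose a1 : R := d%:R * (6 * K%:R); pose b1' : R := 4 + 6 * K%:R.
pose C0 : R := time_const R 1 e0.+2 K + (21 + 2 * a1 + d%:R * b1').
have [C1 H1] := small_gap R d0 0.
exists (1 + (10 * d * c)%:R / (K%:R / J%:R - b)), (Num.max 0 (Num.max C1 C0)).
move=> q hq thM L Lo.
have dc0 : 0 <= (10 * d * c)%:R / (K%:R / J%:R - b) by rewrite divr_ge0 // ltW.
have th1 : 1 <= theta q by lra.
have th0 : 0 <= theta q by lra.
have thM' : (10 * d * c)%:R <= theta q * (K%:R / J%:R - b).
  by rewrite -ler_pdivrMr //; lra.
have [m [m2 m_ge m_le]] := level_parameter (D := 1) isT J0 th0.
have m_ge' : theta q <= 1%:R * J%:R * m%:R by lra.
have m6 : m%:R <= 6 * theta q.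
  apply: (le_trans m_le); have : theta q / (1%:R * J%:R) <= theta q.
    by rewrite mul1r ler_pdivrMr // ler_peMr // ler1n.
  by lra.
set T0 := (10 / q) ^+ e0.+2.
have T01 : 1 <= T0 by exact: T0_ge1.
pose T := level_time 1 q m T0 K; pose T' := site_time 1 q m T0 K.
have T1 : 1 <= T by exact: level_time_ge1.
have T0' : 0 <= T' by exact: site_time_ge0.
have tb := times_bound hq (D := 1) isT e0.+2 J0 th1 m_ge' m_le (kJ : (K <= J)%N).
have coef0 : 0 <= time_coef R 1 J K.
  rewrite /time_coef mul1r divr_ge0 // subr_ge0 ler_pdivrMr ?mulr_gt0 // ler_wpM2l //.
  by have : K%:R <= J%:R :> R; [rewrite ler_nat | lra].
have le_max_C (C : R) : C <= Num.max 0 (Num.max C1 C0) ->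
    2 `^ (- (time_coef R 1 J K * theta q ^+ 2 + Num.max 0 (Num.max C1 C0) * theta q)) <=
    2 `^ (- (time_coef R 1 J K * theta q ^+ 2 + C * theta q)).
  by move=> CC; apply: ler_pow2; rewrite lerN2 lerD2l ler_wpM2r.
pose S := side m K.
have S0 : (0 < S)%N by exact: side_gt0.
have SE : S%:R = 2 `^ (m%:R * K%:R) :> R by rewrite /S /side -pow2_nat natrM.
have SU : S%:R <= 2 `^ (6 * K%:R * theta q) :> R.
  by rewrite SE; apply: ler_pow2; rewrite mulrAC ler_wpM2r.
have SL : 2 `^ (K%:R / J%:R * theta q) <= S%:R :> R.
  rewrite SE; apply: ler_pow2.
  rewrite (_ : K%:R / J%:R * theta q = theta q / J%:R * K%:R); last by ring.
  by rewrite ler_wpM2r // ler_pdivrMr //; lra.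
have Cbound (V N : nat) : (0 < V)%N -> (0 < N)%N -> (V <= S ^ d)%N -> (N <= 10 * S)%N ->
    2 `^ (- (time_coef R 1 J K * theta q ^+ 2 + C0 * theta q)) <=
    (12 * ((1 + 3 * (V * V * N ^ d))%N)%:R * ((10 / q) ^+ 3 * (T + T')))^-1.
  move=> V0 N0 VS NS; have TT : 0 < T + T' by rewrite ltr_pwDl // (lt_le_trans ltr01).
  rewrite pow2N lef_pV2 ?posrE ?pow2_gt0 //; last first.
    have q00 : 0 < 10 / q by rewrite divr_gt0 //; case/andP: hq.
    apply: mulr_gt0; first by apply: mulr_gt0 => //; rewrite ltr0n.
    by apply: mulr_gt0 => //; exact: exprn_gt0.
  apply: le_trans (@prefactor_bound R d q V N a1 b1' _ hq th1 V0 N0 _ _ (ltW TT)) _ => //.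
  - apply: (@le_trans _ _ (S%:R ^+ d)); first by rewrite -natrX ler_nat.
    by rewrite /a1 -(mulrA d%:R); apply: exp_le_pow2.
  - apply: (@le_trans _ _ (10 * S%:R)); first by rewrite -natrM ler_nat.
    rewrite /b1' [X in _ <= 2 `^ X]mulrDl; apply: mul_le_pow2 => //.
    apply: (@le_trans _ _ (2 `^ 4)); first by rewrite pow2_nat ler_nat.
    by apply: ler_pow2; lra.
  apply: le_trans (ler_wpM2l (pow2_ge0 _) tb) _; rewrite -pow2D; apply: ler_pow2.
  by rewrite /C0; lra.
have [L0|L0] := posnP (rank L).
  apply: gap_above_le (H1 q hq th1 L _); last by rewrite L0.
  apply: ler_pow2; rewrite lerN2.
  have : C1 * theta q <= Num.max 0 (Num.max C1 C0) * theta q.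
    by rewrite ler_wpM2r // !le_max lexx !orbT.
  have : 0 <= time_coef R 1 J K * theta q ^+ 2 by rewrite mulr_ge0 ?sqr_ge0.
  by lra.
apply: gap_above_le (le_max_C C0 _) _; first by rewrite !le_max lexx !orbT.
have [LS|LS] := ltnP (rank L) (4 * S).
  have G : gadget q (origin d) L T T'.
    apply: (@line_gadget q J m k) => //; first exact: sle_origin.
    by rewrite rank_origin subn0 L0.
  apply: gap_above_le (gadget_gap hq G T1 T0'); apply: Cbound => //.
    by rewrite expn_gt0 S0.
  by move: LS S0; clear; lia.
(* The longest side of a block will lie between s and 2 s. Two points of consecutive blocks are then
   at l1 distance at most 9 * 2 d s <= 18 S / 5 < 4 S, within the range of [line_gadget]. *)
pose s := (S %/ (5 * d))%N.
have sS : (s * (5 * d) <= S)%N by exact: leq_trunc_div.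
pose X : R := 2 `^ (b * theta q).
have X1 : 1 <= X by rewrite -[leLHS](powRr0 2); apply: ler_pow2; rewrite mulr_ge0 // /b; lra.
have s_ge : c%:R * X <= s%:R.
  have h1 : (S < s.+1 * (5 * d))%N by rewrite ltn_ceil // muln_gt0.
  have h2 : (10 * d * c)%:R * X <= S%:R.
    apply: le_trans SL; rewrite /X.
    rewrite (_ : K%:R / J%:R * theta q = theta q * (K%:R / J%:R - b) + b * theta q); last by ring.
    rewrite pow2D ler_wpM2r ?pow2_ge0 //; apply: le_trans (natr_le_pow2 _ _) _.
    exact: ler_pow2.
  have h3 : (10 * d * c)%:R * X < (s%:R + 1) * (5 * d%:R).
    apply: (le_lt_trans h2); move: h1; rewrite -(ltr_nat R) !natrM.
    by rewrite -[s.+1%:R]natr1.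
  have dR : 0 < d%:R :> R by rewrite ltr0n.
  have h4 : (2 * c%:R * X - s%:R - 1) * (5 * d%:R) < 0.
    by move: h3; rewrite !natrM; lra.
  have h5 : 2 * c%:R * X - s%:R - 1 < 0.
    by rewrite -(pmulr_llt0 _ (_ : 0 < 5 * d%:R)) // mulr_gt0.
  have h6 : 1 <= c%:R * X by rewrite mulr_ege1 // ler1n.
  by lra.
have s1 : 1 <= s%:R :> R.
  by apply: le_trans s_ge; rewrite mulr_ege1 // ler1n.
have s0 : (0 < s)%N by rewrite -(ler1n R).
pose i1 := [arg max_(i > Ordinal d0) L i]%N.
have Lmax i : (L i <= L i1)%N by rewrite /i1; case: arg_maxnP => // j _ /(_ i); apply.
have [rho [rhoE rho0 rho_r]] : exists rho : R, [/\ rho = kappa * 2 `^ (beta * theta q),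
    0 < rho & rho <= r%:R * 2 `^ (beta * theta q)].
  exists (kappa * 2 `^ (beta * theta q)); split=> //.
    by rewrite mulr_gt0 ?pow2_gt0 // (lt_le_trans ltr01).
  by rewrite ler_wpM2r ?pow2_ge0.
have rho_s : 16 * rho <= s%:R.
  apply: le_trans s_ge; rewrite /c natrM -mulrA ler_wpM2l //.
  apply: (le_trans rho_r); rewrite ler_wpM2l // /X; apply: ler_pow2.
  by rewrite ler_wpM2r // /b; lra.
have Ls : (20 * s <= L i1)%N.
  have : (rank L <= d * L i1)%N.
    rewrite /rank; apply: (@leq_trans (\sum_(i < d) L i1)); last by rewrite sum_nat_const card_ord.
    exact: leq_sum.
  move=> h; rewrite -(leq_pmul2l d0); apply: leq_trans h; apply: leq_trans LS.
  by move: sS; clear; lia.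
have Lrho i : (L i1)%:R <= rho * (maxn (L i) 1)%:R.
  have := Lo i1 i; rewrite -rhoE ler_pdivrMr ?ltr0n ?leq_max ?orbT //.
  by apply: le_trans; rewrite ler_nat leq_maxl.
have L16 i : (16 * L i1 <= s * L i)%N.
  have h : (16 * L i1 <= s * maxn (L i) 1)%N.
    rewrite -(ler_nat R) !natrM; have := Lrho i.
    have : 16 * rho * (maxn (L i) 1)%:R <= s%:R * (maxn (L i) 1)%:R by rewrite ler_wpM2r.
    by lra.
  move: h; rewrite /maxn; case: ltnP => // h h'; exfalso.
  by move: h' Ls s0; clear; lia.
(* The number of steps is fixed by the longest side of the box, and the blocks get its proportions.
   By [L16] even the shortest side of a block is nonzero. *)
pose M := (L i1 %/ (4 * s))%N.
have M0 : (0 < M)%N by rewrite divn_gt0 ?muln_gt0 //; move: Ls s0; clear; lia.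
have M1 : (M * (4 * s) <= L i1)%N by exact: leq_trunc_div.
have M2 : (L i1 < M.+1 * (4 * s))%N by rewrite ltn_ceil // muln_gt0.
pose a : site d := [ffun i => (L i %/ (4 * M))%N].
have M40 : (0 < 4 * M)%N by rewrite muln_gt0.
have LM i : (4 * M <= L i)%N.
  have := L16 i; move: M1 s0; clear => M1 s0 h.
  by rewrite -(leq_pmul2l s0); move: M1 h; lia.
have a0 i : (0 < a i)%N by rewrite ffunE divn_gt0.
have a_le i : (a i * (4 * M) <= L i)%N by rewrite ffunE leq_trunc_div.
have a_gt i : (L i < (a i).+1 * (4 * M))%N by rewrite ffunE ltn_ceil.
have wi i : (4 * a i * M <= L i <= 4 * 2 * a i * M)%N.
  have := a_le i; have := a_gt i; have := a0 i.
  by move: (a i : nat) (L i : nat); clear=> ai Li; nia.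
have a_s i : (a i <= 2 * s)%N.
  rewrite -ltnS -(ltn_pmul2r M40); apply: leq_ltn_trans (a_le i) _.
  apply: leq_ltn_trans (Lmax i) _; apply: (leq_trans M2).
  by move: M0 s0; clear; nia.
have rank_a : (rank a <= d * (2 * s))%N.
  rewrite /rank; apply: (@leq_trans (\sum_(i < d) (2 * s))); last by rewrite sum_nat_const card_ord.
  exact: leq_sum.
have G (u v : site d) : (forall i, (u i + a i <= v i <= u i + (4 * 2 + 1) * a i)%N) ->
    gadget q u v T T'.
  move=> uv; have uv' : sle u v.
    by apply/forallP => i; have /andP[h _] := uv i; exact: leq_trans (leq_addr _ _) h.
  apply: (@line_gadget q J m k) => //; apply/andP; split.
    rewrite subn_gt0 /rank (bigD1 (Ordinal d0)) //= [in ltnRHS](bigD1 (Ordinal d0)) //=.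
    rewrite -addSn leq_add //; last by apply: leq_sum => i _; exact: (forallP uv').
    have /andP[h _] := uv (Ordinal d0); apply: leq_trans h.
    by rewrite -addn1 leq_add2l.
  have h : (rank v <= rank u + 9 * rank a)%N.
    rewrite /rank big_distrr -big_split leq_sum // => i _.
    by have /andP[_] := uv i.
  apply: (@leq_ltn_trans (9 * rank a)); first by rewrite leq_subLR.
  by move: rank_a sS S0 d0; rewrite -/S; clear; nia.
have Phi_rank (x : site d) : rank (id x) = rank x by [].
have goodv : (1 - q) ^+ volume a <= 8^-1.
  apply: small_power => //.
  (* Two directions suffice: the longest side of a block is at least s and any other one at least s
     / (2 rho), so that the volume is at least s^2 / (2 rho), of order 2^((2 b - beta) theta) =
     2^theta. *)
  have [j ji] : exists j : 'I_d, j != i1.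
    have [e|e] := eqVneq i1 (Ordinal d0); last by exists (Ordinal d0); rewrite eq_sym.
    by exists (Ordinal d2); rewrite e -val_eqE.
  have vol : (a i1 * a j <= volume a)%N.
    rewrite /volume (bigD1 i1) //= leq_mul2l (bigD1 j) //=.
    by apply/orP; right; rewrite leq_pmulr // prodn_gt0.
  have ai1 : (s <= a i1)%N by rewrite ffunE leq_divRL // mulnCA (mulnC s) mulnCA.
  have aj : s%:R <= 2 * rho * (a j)%:R.
    have g1 := Lrho j; have Lj1 : maxn (L j) 1 = L j.
      by apply/maxn_idPl; apply: leq_trans (LM j).
    rewrite Lj1 in g1.
    have MR : 0 < (4 * M)%:R :> R by rewrite ltr0n.
    rewrite -(ler_pM2r MR).
    apply: (@le_trans _ _ (L i1)%:R).
      by rewrite -natrM ler_nat; move: M1; clear; lia.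
    apply: (le_trans g1); rewrite [2 * rho]mulrC -!mulrA.
    apply: ler_wpM2l; first exact: ltW.
    rewrite -!natrM ler_nat; have := a_gt j; have := a0 j.
    by move: (a j : nat) (L j : nat); clear=> ai Li; nia.
  have aa : s%:R * s%:R <= 2 * rho * (volume a)%:R.
    apply: (@le_trans _ _ ((a i1)%:R * (2 * rho * (a j)%:R))).
      by apply: ler_pM => //; rewrite ler_nat.
    rewrite mulrCA; apply: ler_wpM2l; first by apply: mulr_ge0 => //; exact: ltW.
    by rewrite -natrM ler_nat.
  have ss : 16 * rho * (16 * 2 `^ theta q) <= s%:R * s%:R.
    have cX : (c%:R * X) * (c%:R * X) <= s%:R * s%:R.
      by apply: ler_pM => //; rewrite mulr_ge0 // (le_trans ler01).
    apply: le_trans cX.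
    have XX : X * X = 2 `^ theta q * 2 `^ (beta * theta q).
      by rewrite /X -!pow2D; congr (_ `^ _); rewrite /b; field.
    rewrite (_ : c%:R * X * (c%:R * X) = 16 * (r%:R * 2 `^ (beta * theta q)) * (16 * 2 `^ theta q) * r%:R); last first.
      rewrite (_ : c%:R * X * (c%:R * X) = c%:R * c%:R * (X * X)); last by ring.
      by rewrite XX /c natrM; ring.
    apply: (@le_trans _ _ (16 * (r%:R * 2 `^ (beta * theta q)) * (16 * 2 `^ theta q))).
      apply: ler_wpM2r; first by apply: mulr_ge0 => //; exact: pow2_ge0.
      exact: ler_wpM2l.
    apply: ler_peMr; last by rewrite ler1n.
    by rewrite !mulr_ge0 // pow2_ge0.
  have : 8 * 2 `^ theta q <= (volume a)%:R.
    have rho2 : 0 < 2 * rho by exact: mulr_gt0.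
    rewrite -(ler_pM2l rho2); apply: le_trans aa; apply: le_trans ss.
    have : 0 <= rho * 2 `^ theta q by apply: mulr_ge0; [exact: ltW | exact: pow2_ge0].
    by move: (2 `^ theta q) (rho) => z z'; clear; lra.
  move=> v8; have q00 : 0 < q by case/andP: hq.
  rewrite -ler_pdivrMr // -{1}(pow2_theta hq) -pow2N opprK //.
apply: gap_above_le (boxes_gap hq d0 Phi_rank (fun _ _ => id) M0 a0 wi G T1 T0' _ _ goodv) => //.
apply: Cbound => //.
- by rewrite prodn_gt0.
- rewrite /volume; apply: (@leq_trans (\prod_(i < d) S)); last by rewrite prod_nat_const card_ord.
  apply: leq_prod => i _; apply: leq_trans (a_s i) _; apply: leq_trans sS.
  by move: d0; clear; nia.
by move: rank_a sS S0 d0; clear; nia.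
Qed.

Lemma calH_below_one beta : (2 <= d)%N -> 0 < beta < 1 ->
  exists2 lambda : R, 0 < lambda < 1 & calH d beta lambda.
Proof.
move=> d2 b01; have /andP[b0 b1] := b01.
have g0 : 0 < (1 - beta) / 2 by rewrite divr_gt0 // subr_gt0.
have [n n0 nb] := inv_nat_lt g0.
(* Stopping at the fraction s = 1 - 1/r of the levels gives s - s^2 / 2 = 1/2 - 1/(2 r^2). With J =
   2 r^2 the discretization error is at most half of this gain. *)
pose r := n.+1; pose J := (2 * r * r)%N; pose k := (2 * r * n).-1.
have kE : k.+1 = (2 * r * n)%N by rewrite /k prednK // !muln_gt0 n0.
have rR : 0 < r%:R :> R by rewrite ltr0n.
have nE : n%:R = r%:R - 1 :> R by rewrite /r -[n.+1%:R]natr1 addrK.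
have kJ : (k < J)%N by rewrite /J -ltnS kE ltnS leq_mul2l leqnSn orbT.
pose lambda : R := 1 - (4 * r%:R ^+ 2)^-1.
have r2 : 1 <= r%:R ^+ 2 :> R by rewrite exprn_ege1 // ler1n.
have l4 : (4 * r%:R ^+ 2)^-1 <= 4^-1 :> R by rewrite lef_pV2 ?posrE ?mulr_gt0 ?exprn_gt0 // ler_peMr.
have l0 : 0 < (4 * r%:R ^+ 2)^-1 :> R by rewrite invr_gt0 mulr_gt0 ?exprn_gt0.
exists lambda; first by rewrite /lambda; lra.
apply: calH_gap_above => kappa eps kap1 e0.
have tau : (1 + beta) / 2 < k.+1%:R / J%:R.
  rewrite kE /J !natrM nE.
  have -> : 2 * r%:R * (r%:R - 1) / (2 * r%:R * r%:R) = 1 - r%:R^-1 :> R.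
    by field; rewrite gt_eqF.
  have : r%:R^-1 <= n%:R^-1 :> R by rewrite lef_pV2 ?posrE ?ltr0n // ler_nat leqnSn.
  by lra.
have [M [C H]] := slanted_gap_bound d2 b01 kap1 kJ tau.
exists M, C, (time_coef R 1 J k.+1); split=> //.
have -> : time_coef R 1 J k.+1 = 2^-1 - (2 * r%:R ^+ 2)^-1 + (1 - r%:R^-1) / (4 * r%:R ^+ 2).
  rewrite /time_coef kE /J !natrM nE; field; rewrite gt_eqF //.
have i0 : 0 < r%:R^-1 :> R by rewrite invr_gt0.
have h1 : (1 - r%:R^-1) / (4 * r%:R ^+ 2) <= (4 * r%:R ^+ 2)^-1 :> R.
  have i1 : 1 - r%:R^-1 <= 1 :> R by lra.
  by apply: ler_piMl => //; exact: ltW.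
have h2 : (2 * r%:R ^+ 2)^-1 = 2 * (4 * r%:R ^+ 2)^-1 :> R by field; rewrite gt_eqF.
have : 0 < eps * lambda by rewrite mulr_gt0 // /lambda; lra.
by rewrite /lambda in h1 h2 l0 *; lra.
Qed.

End Slanted.

(** * The combinatorial bottleneck *)

Section Bottleneck.
Variables (R : realType) (S : finType) (q : R).
Hypothesis hq : 0 < q < 1.
Variables (c : S -> cfg S -> bool) (le : rel S) (rk : S -> nat) (m n : nat).
Hypothesis le_tr : transitive le.
Hypothesis le_rk : forall x y, le y x -> y != x -> (rk y < rk x)%N.
Hypothesis c_indep : forall x b w, c x (set_at x b w) = c x w.
Hypothesis c_legal : forall x w, c x w ->
  rk x = 0%N \/ exists y, [/\ le y x, rk x = (rk y).+1 & ~~ w y].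

Let q0 : 0 < q. Proof. by case/andP: hq. Qed.
Let q1 : q < 1. Proof. by case/andP: hq. Qed.
Let p0 : 0 < 1 - q. Proof. by rewrite subr_gt0. Qed.

(** The strict inequality for the root treats the unconstrained site as if a permanent vacancy stood
    just below it, at rank -1. *)
Definition linked (t : seq S) x k : bool :=
  (rk x < k)%N || has (fun y => [&& y != x, le y x & (rk x <= rk y + k)%N]) t.

(* The vacancies can be removed one after the other, the last one but [j]
   being at distance at most [2 ^ (n - j - 1)] above a remaining one. *)
Fixpoint dismantlable (s : seq S) : bool :=
  if s is x :: t then
    [&& x \notin t, linked t x (2 ^ (n - (size t).+1)), (size t < n)%N & dismantlable t]
  else true.

Lemma dismantlable_uniq s : dismantlable s -> uniq s.
Proof. by elim: s => //= x t IH /and4P[-> _ _ /IH]. Qed.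

Lemma dismantlable_size s : dismantlable s -> (size s <= n)%N.
Proof. by case: s => //= x t /and4P[]. Qed.

Lemma linkedP t x k :
  reflect ((rk x < k)%N \/ exists y, [/\ y \in t, y != x, le y x & (rk x <= rk y + k)%N])
    (linked t x k).
Proof.
apply: (iffP orP) => -[h|h]; [by left| |by left|].
  by right; have /hasP[y yt /and3P[? ? ?]] := h; exists y.
by right; apply/hasP; have [y [yt ? ? ?]] := h; exists y => //; apply/and3P.
Qed.

Lemma dismantlable_add x s (w : cfg S) : dismantlable s -> (size s < n)%N -> x \notin s ->
  (forall y, (y \in s) = ~~ w y) -> c x w -> dismantlable (x :: s).
Proof.
move=> ds sn xs sw cx /=; rewrite xs sn ds !andbT /=; apply/linkedP.
case: (c_legal cx) => [->|[y [yx ry wy]]]; first by left; rewrite expn_gt0.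
right; exists y; rewrite sw wy; split=> //.
  by apply: contraNneq xs => <-; rewrite sw.
by rewrite ry -addn1 leq_add2l expn_gt0.
Qed.

(** A vacancy linked through [z] is relinked through the link of [z]. The two distances add up to at
    most twice the allowed one, which is precisely the distance allowed to a list shorter by one.
    Links go downwards, so they cannot be circular. *)
Lemma dismantlable_rem z s : dismantlable s -> z \in s ->
  linked s z (2 ^ (n - size s)) -> dismantlable (rem z s).
Proof.
elim: s => //= x t IH /and4P[xt lx tn dt]; rewrite inE => zs lz.
case: eqVneq zs => [//|zx /= zt].
have t0 : (0 < size t)%N by case: (t) zt.
have DE : (2 ^ (n - size t) = 2 ^ (n - (size t).+1) + 2 ^ (n - (size t).+1))%N.
  rewrite addnn -mul2n -expnS; congr (_ ^ _)%N.
  by move: tn; clear; lia.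
set k := (2 ^ (n - (size t).+1))%N in lx lz DE.
have lz' : linked t z (2 ^ (n - size t)).
  rewrite DE; apply/linkedP; case/linkedP: lz => [h|[y [yt yz lyz ryz]]].
    by left; exact: leq_trans h (leq_addr _ _).
  move: yt; rewrite inE => /predU1P[yx|yt]; last first.
    by right; exists y; split=> //; apply: leq_trans ryz _; rewrite leq_add2l leq_addr.
  rewrite yx in lyz ryz yz.
  case/linkedP: lx => [h|[y' [y't y'x ly'x ry'x]]].
    by left; apply: leq_ltn_trans ryz _; rewrite ltn_add2r.
  right; exists y'; split=> //.
  - apply/negP => /eqP e; rewrite e in ly'x y'x.
    by have := ltn_trans (le_rk ly'x y'x) (le_rk lyz yz); rewrite ltnn.
  - exact: le_tr lyz.
  - by rewrite addnA; apply: leq_trans ryz _; rewrite leq_add2r.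
have drem := IH dt zt lz'.
have ut := dismantlable_uniq dt.
have xrem : x \notin rem z t by apply: contra xt; exact: mem_rem.
rewrite xrem drem size_rem // prednK // (ltnW tn) /= andbT DE; apply/linkedP.
case/linkedP: (lx) => [h|[y [yt yx lyx ryx]]].
  by left; exact: leq_trans h (leq_addr _ _).
have [yz|yz] := eqVneq y z; last first.
  right; exists y; split=> //; first by rewrite mem_rem_uniq // inE yz.
  by apply: leq_trans ryx _; rewrite leq_add2l leq_addr.
rewrite yz in lyx ryx yx.
case/linkedP: lz => [h|[y' [y't y'z ly'z ry'z]]].
  by left; apply: leq_ltn_trans ryx _; rewrite ltn_add2r.
move: y't; rewrite inE => /predU1P[e|y't].
  rewrite e in ly'z y'z.
  by have := ltn_trans (le_rk lyx yx) (le_rk ly'z y'z); rewrite ltnn.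
right; exists y'; split.
- by rewrite mem_rem_uniq // inE y'z.
- by apply: contraNneq xt => <-.
- exact: le_tr lyx.
- by rewrite addnA; apply: leq_trans ryx _; rewrite leq_add2r.
Qed.

(** Geometric sum of the allowed distances 2^(n-1), 2^(n-2), ...; it shows that rank 2^n is out of
    reach with n vacancies. *)
Lemma dismantlable_rk s x : dismantlable s -> x \in s ->
  ((rk x).+1 + 2 ^ (n - size s) <= 2 ^ n)%N.
Proof.
elim: s x => //= y t IH x /and4P[yt ly tn dt].
have DE : (2 ^ (n - size t) = 2 ^ (n - (size t).+1) + 2 ^ (n - (size t).+1))%N.
  rewrite addnn -mul2n -expnS; congr (_ ^ _)%N.
  by move: tn; clear; lia.
have D1 : (2 ^ (n - size t) <= 2 ^ n)%N by rewrite leq_exp2l // leq_subr.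
rewrite inE => /predU1P[->|xt]; last first.
  by apply: leq_trans (IH x dt xt); rewrite leq_add2l DE leq_addr.
case/linkedP: ly => [h|[z [zt zy lzy rzy]]].
  by apply: leq_trans D1; rewrite DE leq_add2r.
apply: leq_trans (IH z dt zt); rewrite DE addnA leq_add2r addSn ltnS.
exact: rzy.
Qed.

Definition reachable (w : cfg S) : Prop :=
  exists2 s, dismantlable s & forall x, (x \in s) = ~~ w x.

Definition critical (w : cfg S) : Prop :=
  exists2 s, dismantlable s & size s = n /\ forall x, (x \in s) = ~~ w x.

Lemma reachable_set_true x (w : cfg S) : c x w -> reachable (set_at x false w) ->
  reachable (set_at x true w).
Proof.
move=> cx [s ds sw]; exists (rem x s); last first.
  move=> y; rewrite mem_rem_uniq ?dismantlable_uniq // inE sw /= !ffunE.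
  by case: eqVneq.
have xs : x \in s by rewrite sw set_at_eq.
apply: dismantlable_rem => //; apply/linkedP.
have cx' : c x (set_at x false w) by rewrite c_indep.
case: (c_legal cx') => [->|[y [yx ry wy]]]; first by left; rewrite expn_gt0.
right; exists y; split=> //.
- by rewrite sw.
- by apply/eqP => e; move: ry; rewrite e => /n_Sn.
- by rewrite ry -addn1 leq_add2l expn_gt0.
Qed.

(** The new vacancy is put at the head of the list, where distance one is always allowed; only a
    list that is already full forbids it. *)
Lemma reachable_set_false x (w : cfg S) : c x w -> reachable (set_at x true w) ->
  ~ critical (set_at x true w) -> reachable (set_at x false w).
Proof.
move=> cx [s ds sw] nc.
have sn : (size s < n)%N.
  rewrite ltn_neqAle dismantlable_size // andbT; apply/eqP => e.
  by apply: nc; exists s.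
have xs : x \notin s by rewrite sw set_at_eq.
exists (x :: s).
  by apply: (dismantlable_add (w := set_at x true w)) => //; rewrite c_indep.
by move=> y; rewrite inE sw !ffunE; case: eqVneq.
Qed.

Fixpoint dismantlings k : seq (seq S) :=
  if k is j.+1 then
    flatten [seq [seq x :: t | x <- enum [pred x | linked t x (2 ^ (n - j.+1))]]
            | t <- dismantlings j]
  else [:: [::]].

Lemma mem_dismantlings s : dismantlable s -> s \in dismantlings (size s).
Proof.
elim: s => //= x t IH /and4P[_ lx _ dt]; apply/flattenP.
eexists; first by apply/mapP; exists t; [exact: IH | reflexivity].
by apply/mapP; exists x; rewrite // mem_enum.
Qed.

Lemma size_dismantlings_mem k s : s \in dismantlings k -> size s = k.
Proof.
elim: k s => [|k IH] s /=; first by rewrite inE => /eqP ->.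
by move=> /flattenP[_ /mapP[t tk ->] /mapP[x _ ->]] /=; rewrite (IH t).
Qed.

Hypothesis count_above : forall y k,
  (#|[pred x | le y x && (rk x <= rk y + k)%N]| <= k.+1 ^ m)%N.
Hypothesis count_root : forall k, (#|[pred x | (rk x < k)%N]| <= k.+1 ^ m)%N.

Lemma size_dismantlings k :
  (size (dismantlings k) <= \prod_(j < k) (j.+1 * (2 ^ (n - j.+1)).+1 ^ m))%N.
Proof.
elim: k => [|k IH]; first by rewrite big_ord0.
rewrite big_ord_recr /=; set D := (2 ^ (n - k.+1))%N.
apply: leq_trans (leq_mul IH (leqnn _)).
apply: size_flatten_allP => t /size_dismantlings_mem st.
rewrite size_map -cardE.
(* A new site is linked either to the root or to one of the [k] sites already present. *)
have -> : (k.+1 * D.+1 ^ m = D.+1 ^ m + size t * D.+1 ^ m)%N by rewrite st mulSn.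
have link_le u : (#|[pred x | linked u x D]| <= D.+1 ^ m + size u * D.+1 ^ m)%N.
  elim: u => [|y u IHu].
    rewrite addn0 (leq_trans _ (count_root D)) // subset_leq_card //.
    by apply/fintype.subsetP => x; rewrite !inE /linked /= orbF.
  rewrite mulSn; apply: leq_trans (leq_add (count_above y D) IHu).
  rewrite -cardUI; apply: leq_trans (leq_addr _ _); apply: subset_leq_card.
  apply/fintype.subsetP => x; rewrite !inE /linked /= => /orP[->|/orP[/and3P[_ -> ->]|->]] //.
    by rewrite orbT.
  by rewrite !orbT.
exact: link_le.
Qed.

Definition dismantling_count : nat := \prod_(j < n) (j.+1 * (2 ^ (n - j.+1)).+1 ^ m).

Lemma mean_critical :
  mean q (fun w : cfg S => (`[< critical w >])%:R) <= dismantling_count%:R * q ^+ n.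
Proof.
pose conf (s : seq S) : cfg S := [ffun x => x \notin s].
pose G := [seq s <- dismantlings n | uniq s].
have sum_ge (r : seq (seq S)) (F : seq S -> R) s0 : (forall s, 0 <= F s) -> s0 \in r ->
    F s0 <= \sum_(s <- r) F s.
  move=> F0; elim: r => // s r IH; rewrite inE big_cons => /predU1P[->|/IH h].
    by rewrite lerDl sumr_ge0.
  by apply: le_trans h _; rewrite lerDr.
apply: (@le_trans _ _ (\sum_(s <- G) mean q (fun w => (w == conf s)%:R))).
  rewrite -mean_sum; apply: ler_mean => // w.
  case: asboolP => [[s ds [sn sw]]|_]; last by apply: sumr_ge0.
  have sG : s \in G.
    by rewrite mem_filter dismantlable_uniq // -sn mem_dismantlings.
  have wE : w = conf s by apply/ffunP => x; rewrite ffunE sw negbK.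
  apply: le_trans (sum_ge G (fun s => (w == conf s)%:R) s _ sG) => //.
  by rewrite -wE eqxx.
have mu_conf s : s \in G -> mean q (fun w => (w == conf s)%:R) <= q ^+ n.
  rewrite mem_filter => /andP[us /size_dismantlings_mem <-].
  rewrite /mean (bigD1 (conf s)) //= eqxx mulr1 big1 => [|w /negPf ->]; last by rewrite mulr0.
  rewrite addr0 /mu (bigID (fun x => x \in s)) /=.
  rewrite (eq_bigr (fun=> q)); last by move=> x xs; rewrite ffunE xs.
  rewrite prodr_const -(card_uniqP us) ler_piMr ?exprn_ge0 ?(ltW q0) //.
  apply: prodr_ile1 => x xs; rewrite ffunE xs (ltW p0) /=.
  by rewrite gerBl ltW.
apply: (@le_trans _ _ (\sum_(s <- G) q ^+ n)).
  by rewrite big_seq [leRHS]big_seq; apply: ler_sum => s /mu_conf.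
rewrite big_const_seq count_predT iter_addr addr0 -[leLHS]mulr_natl ler_wpM2r ?exprn_ge0 ?(ltW q0) //.
by rewrite ler_nat (leq_trans _ (size_dismantlings n)) // size_subseq // filter_subseq.
Qed.

Lemma mean_set_true x (g : cfg S -> R) : (forall w, 0 <= g w) ->
  (1 - q) * mean q (fun w => g (set_at x true w)) <= mean q g.
Proof.
move=> g0; rewrite -[leRHS](mean_mean_at q x) -meanZ; apply: ler_mean => // w.
by rewrite /mean_at lerDl mulr_ge0 // ltW.
Qed.

(* The indicator of the configurations that can be reached with at most [n]
   simultaneous vacancies; the chain leaves this set only through the
   configurations with exactly [n] vacancies. *)
Definition reach_test (w : cfg S) : R := (`[< reachable w >])%:R.

(** Only a flip creating a vacancy in a critical configuration crosses the boundary. The factor 1 -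
    q of its local variance pays for forcing a one at [x], and the factor q remains. *)
Lemma dirichlet_reach_test :
  dirichlet q c reach_test <= #|S|%:R * (q * (dismantling_count%:R * q ^+ n)).
Proof.
pose g (w : cfg S) : R := (`[< critical w >])%:R.
have g0 w : 0 <= g w by [].
have bound x : mean q (fun w => (c x w)%:R * variance_at q x reach_test w) <= q * mean q g.
  apply: (@le_trans _ _ (mean q (fun w => q * (1 - q) * g (set_at x true w)))).
    apply: ler_mean => // w; case cx : (c x w); last first.
      by rewrite mul0r !mulr_ge0 // ltW.
    rewrite mul1r /variance_at /mean_at /reach_test.
    have nonneg : 0 <= q * (1 - q) * g (set_at x true w) by rewrite !mulr_ge0 // ltW.
    case: asboolP => r1; case: asboolP => r0.
    - by apply: le_trans nonneg; rewrite /=; lra.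
    - suff : critical (set_at x true w) by rewrite /g => /asboolP ->; rewrite /=; lra.
      by apply: contrapT => /(reachable_set_false cx r1).
    - by case: r1; exact: reachable_set_true.
    - by apply: le_trans nonneg; rewrite /=; lra.
  rewrite meanZ -mulrA ler_wpM2l ?(ltW q0) //; exact: mean_set_true.
apply: (@le_trans _ _ (\sum_(x : S) q * mean q g)); first exact: ler_sum.
rewrite sumr_const -[leLHS]mulr_natl; apply: ler_wpM2l => //.
by apply: ler_wpM2l; [exact: ltW | exact: mean_critical].
Qed.

Variable z0 : S.
Hypothesis z0_far : (2 ^ n <= rk z0)%N.

(** The configuration without vacancies is reachable, while none with a vacancy at [z0] is. The
    factor q will cancel that of the Dirichlet form. *)
Lemma variance_reach_test : (1 - q) ^+ #|S| * q <= variance q reach_test.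
Proof.
have -> : variance q reach_test = mean q reach_test * (1 - mean q reach_test).
  rewrite /variance (_ : mean q (fun w => reach_test w ^+ 2) = mean q reach_test).
    by ring.
  by apply: eq_mean => w; rewrite /reach_test; case: `[< _ >]; rewrite ?expr1n ?expr0n.
have p1 : (1 - q) ^+ #|S| <= mean q reach_test.
  rewrite /mean (bigD1 [ffun=> true]) //= (_ : mu q [ffun=> true] = (1 - q) ^+ #|S|); last first.
    by rewrite /mu (eq_bigr (fun=> 1 - q)) ?prodr_const // => x _; rewrite ffunE.
  rewrite (_ : reach_test _ = 1) ?mulr1.
    by rewrite lerDl sumr_ge0 // => w _; rewrite mulr_ge0 // ltW // mu_gt0.
  rewrite /reach_test (_ : `[< _ >]) //; apply/asboolP.
  by exists [::] => // x; rewrite ffunE.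
have p2 : q <= 1 - mean q reach_test.
  rewrite lerBrDr -lerBrDl.
  have -> : 1 - q = mean q (fun w : cfg S => (w z0)%:R).
    rewrite -(mean_mean_at q z0) -(@mean_cst R S q (1 - q)); apply: eq_mean => w.
    by rewrite /mean_at !set_at_eq /= mulr0 addr0 mulr1.
  apply: ler_mean => // w; rewrite /reach_test; case: asboolP => // -[s ds sw].
  case wz : (w z0) => //; exfalso.
  have zs : z0 \in s by rewrite sw wz.
  have := dismantlable_rk ds zs; rewrite leqNgt => /negP; apply.
  by apply: leq_trans (leq_addr _ _); rewrite ltnS.
by apply: ler_pM => //; [apply: exprn_ge0; exact: ltW | exact: ltW].
Qed.

Lemma bottleneck : nonconstant reach_test /\
  dirichlet q c reach_test <=
  #|S|%:R * dismantling_count%:R * q ^+ n / (1 - q) ^+ #|S| * variance q reach_test.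
Proof.
have pS : 0 < (1 - q) ^+ #|S| by exact: exprn_gt0.
have v := variance_reach_test.
split.
  have [//|nc] := pselect (nonconstant reach_test).
  have v0 : 0 < variance q reach_test by apply: lt_le_trans v; rewrite mulr_gt0.
  exfalso; move: v0; rewrite (_ : variance q reach_test = 0) ?ltxx //.
  have E w : reach_test w = reach_test [ffun=> true].
    by apply: contra_notP nc => /eqP ne; exists w, [ffun=> true].
  rewrite variance_centered -[RHS](@mean_cst R S q); apply: eq_mean => w.
  rewrite (_ : mean q reach_test = reach_test [ffun=> true]) ?E ?subrr ?expr0n //.
  by rewrite -[RHS](@mean_cst R S q); apply: eq_mean.
apply: le_trans dirichlet_reach_test _.
rewrite (_ : #|S|%:R * (q * _) =
  #|S|%:R * dismantling_count%:R * q ^+ n / (1 - q) ^+ #|S| * ((1 - q) ^+ #|S| * q)); last first.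
  by field; rewrite gt_eqF.
by apply: ler_wpM2l => //; rewrite divr_ge0 ?mulr_ge0 ?exprn_ge0 // ltW.
Qed.

End Bottleneck.

Lemma variance_at_ge0 (R : realType) (q : R) (S : finType) (x : S) (f : cfg S -> R) w :
  0 < q < 1 -> 0 <= variance_at q x f w.
Proof.
move=> /andP[q0 q1]; rewrite /variance_at /mean_at; set u := f _; set v := f _.
have : 0 <= q * (1 - q) * (u - v) ^+ 2.
  apply: mulr_ge0; last exact: sqr_ge0.
  by apply: mulr_ge0; [exact: ltW | rewrite subr_ge0 ltW].
by lra.
Qed.

(** * Embedding one set of sites into another *)

Section Transfer.
Variables (R : realType) (S1 S2 : finType) (q : R) (iota : S1 -> S2).
Hypothesis hq : 0 < q < 1.
Hypothesis iota_inj : injective iota.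

Definition pull (w : cfg S2) : cfg S1 := [ffun x => w (iota x)].

Definition glue (w : cfg S2) (v : cfg S1) : cfg S2 :=
  [ffun y => if [pick x | iota x == y] is Some x then v x else w y].

Lemma glue_iota w v x : glue w v (iota x) = v x.
Proof.
rewrite ffunE; case: pickP => [x' /eqP /iota_inj -> //|/(_ x)].
by rewrite eqxx.
Qed.

Lemma pull_glue w v : pull (glue w v) = v.
Proof. by apply/ffunP => x; rewrite ffunE glue_iota. Qed.

Lemma glue_pull w : glue w (pull w) = w.
Proof.
apply/ffunP => y; rewrite ffunE; case: pickP => [x /eqP <-|//].
by rewrite ffunE.
Qed.

Lemma glue_set_at w v x b : glue w (set_at x b v) = set_at (iota x) b (glue w v).
Proof.
apply/ffunP => y; rewrite !ffunE; case: pickP => [x' /eqP <-|nx].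
  by rewrite ffunE (inj_eq iota_inj).
by case: eqP => // e; have := nx x; rewrite e eqxx.
Qed.

Lemma pull_set_at w x b : pull (set_at (iota x) b w) = set_at x b (pull w).
Proof. by apply/ffunP => y; rewrite !ffunE (inj_eq iota_inj). Qed.

Lemma avg_glue (s : seq S1) (f : cfg S2 -> R) w v :
  avg q s (fun v => f (glue w v)) v = avg q (map iota s) f (glue w v).
Proof.
elim: s v => //= x s IH v.
by rewrite /mean_at !IH !glue_set_at.
Qed.

Lemma mean_glue (f : cfg S2 -> R) :
  mean q (fun w => mean q (fun v => f (glue w v))) = mean q f.
Proof.
rewrite -(mean_avg q (map iota (enum S1)) f); apply: eq_mean => w.
rewrite -{2}[w]glue_pull -avg_glue avg_all // => x.
by rewrite mem_enum.
Qed.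

Lemma mean_pull (f : cfg S1 -> R) : mean q (fun w => f (pull w)) = mean q f.
Proof.
rewrite -mean_glue -[RHS](@mean_cst R S2 q); apply: eq_mean => w.
by apply: eq_mean => v; rewrite pull_glue.
Qed.

Lemma variance_pull (f : cfg S1 -> R) : variance q (fun w => f (pull w)) = variance q f.
Proof.
by rewrite /variance mean_pull (mean_pull (fun v => f v ^+ 2)).
Qed.

(** Sites outside the image have zero local variance. The alternative [indep x f] serves the sites
    of [window A] outside [A], where no comparison of constraints is available. *)
Lemma dirichlet_pull (c1 : S1 -> cfg S1 -> bool) (c2 : S2 -> cfg S2 -> bool)
    (f : cfg S1 -> R) :
  (forall x w, c2 (iota x) w -> c1 x (pull w) \/ indep x f) ->
  dirichlet q c2 (fun w => f (pull w)) <= dirichlet q c1 f.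
Proof.
move=> H.
have va x w : variance_at q (iota x) (fun w => f (pull w)) w = variance_at q x f (pull w).
  by rewrite /variance_at /mean_at !pull_set_at.
have vanish (S : finType) (g : cfg S -> R) y : indep y g -> forall w, variance_at q y g w = 0.
  by move=> ig w; rewrite /variance_at /mean_at !ig; ring.
rewrite /dirichlet (bigID (fun y => y \in iota @: predT)) /= [X in _ + X]big1 ?addr0.
  rewrite big_imset /=; last by move=> x x' _ _; exact: iota_inj.
  apply: ler_sum => x _.
  rewrite -[leRHS]mean_pull; apply: ler_mean => // w; rewrite va.
  case cw : (c2 (iota x) w); last by rewrite mul0r mulr_ge0 ?variance_at_ge0.
  case: (H x w cw) => [->//|/vanish ->]; by rewrite !mulr0.
move=> y ny; rewrite -[RHS](@mean_cst R S2 q); apply: eq_mean => w.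
rewrite vanish ?mulr0 // => b w'; congr f; apply/ffunP => x; rewrite !ffunE.
by case: eqP => // e; rewrite -e imset_f in ny.
Qed.

End Transfer.

(** * The bottleneck in a box *)

Section BoxBottleneck.
Variables (R : realType) (d : nat) (q : R).
Hypothesis hq : 0 < q < 1.
Variables (D n : nat).
Hypotheses (D0 : (0 < D)%N) (Dd : (D <= d)%N).

(** A D-dimensional cube embedded in dimension d. For D = d all sides are equal, so it is
    outstretched for every beta >= 0; for D = 1 its ratio 2^n, with n <= theta, is allowed as soon
    as beta >= 1. *)
Definition corner : site d := [ffun i : 'I_d => if (i < D)%N then (2 ^ n)%N else 0%N].

Variable V : {fset site d}.
Hypothesis VL : {subset V <= box corner}.
Hypothesis oV : origin d \in V.
Hypothesis cV : corner \in V.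

Lemma count_above_box (y : V) k :
  (#|[pred x : V | sle (val y) (val x) && (rank (val x) <= rank (val y) + k)%N]| <= k.+1 ^ D)%N.
Proof.
pose F (x : V) : {ffun 'I_D -> 'I_k.+1} :=
  [ffun i => inord (val x (widen_ord Dd i) - val y (widen_ord Dd i))].
have V0 (x : V) (i : 'I_d) : (D <= i)%N -> val x i = 0%N.
  have := VL (valP x); rewrite mem_box => /forallP/(_ i); rewrite ffunE.
  by move=> h Di; move: h; rewrite ltnNge Di /= leqn0 => /eqP.
rewrite -[X in (_ <= X ^ _)%N]card_ord -[X in (_ <= _ ^ X)%N]card_ord -card_ffun.
apply: (@leq_card_in V _ F) => x x'; rewrite !inE => /andP[yx rx] /andP[yx' rx'] /ffunP E.
apply/val_inj/ffunP => i; have [Di|iD] := leqP D i; first by rewrite !V0.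
have small (u : V) : sle (val y) (val u) -> (rank (val u) <= rank (val y) + k)%N ->
    (val u i - val y i < k.+1)%N.
  move=> yu ru; rewrite ltnS leq_subLR -(leq_add2l (\sum_(j < d | j != i) val y j)).
  move: ru; rewrite /rank (bigD1 i) //= [in leqRHS](bigD1 i) //= => ru.
  rewrite addnC addnCA addnA; apply: leq_trans ru.
  by rewrite leq_add2l; apply: leq_sum => j _; exact: (forallP yu).
have := congr1 val (E (Ordinal iD)); rewrite !ffunE.
have -> : widen_ord Dd (Ordinal iD) = i by exact: val_inj.
rewrite /= !inordK ?small // => e.
by rewrite -(subnK (forallP yx i)) -(subnK (forallP yx' i)) e.
Qed.

Lemma card_box : (#|{: V}| <= (D * 2 ^ n).+1 ^ D)%N.
Proof.
have := count_above_box [` oV]%fset (D * 2 ^ n); apply: leq_trans.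
apply: subset_leq_card; apply/fintype.subsetP => x _; rewrite !inE /=.
rewrite rank_origin add0n; apply/andP; split; first by apply/forallP => i; rewrite ffunE.
have xL : sle (val x) corner by have := VL (valP x); rewrite mem_box.
apply: leq_trans (sle_rank xL) _; rewrite /rank.
under eq_bigr do rewrite ffunE.
rewrite -big_mkcond -(big_ord_widen_cond d xpredT (fun=> 2 ^ n)%N Dd) /=.
by rewrite sum_nat_const card_ord.
Qed.

Lemma rank_corner : (2 ^ n <= rank corner)%N.
Proof.
have i0 : (0 < d)%N by exact: leq_trans Dd.
by rewrite /rank (bigD1 (Ordinal i0)) //= ffunE /= D0 leq_addr.
Qed.

Lemma box_bottleneck : exists2 f : cfg V -> R, nonconstant f &
  dirichlet q (@east_constraint d V) f <=
  #|{: V}|%:R * (dismantling_count D n)%:R * q ^+ n / (1 - q) ^+ #|{: V}| * variance q f.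
Proof.
pose le (y x : V) := sle (val y) (val x); pose rk (x : V) := rank (val x).
have le_tr : transitive le by move=> y x z; exact: sle_trans.
have le_rk x y : le y x -> y != x -> (rk y < rk x)%N.
  move=> yx; apply: contraNltn => rxy; apply/eqP/val_inj/ffunP => i.
  apply/eqP; rewrite eqn_leq (forallP yx) /=.
  rewrite leqNgt; apply/negP => lt; move: rxy; rewrite /rk leqNgt => /negP; apply.
  rewrite /rank (bigD1 i) //= [in ltnRHS](bigD1 i) //= -addSn leq_add //.
  by apply: leq_sum => j _; exact: (forallP yx).
have cI (x : V) b (w : cfg V) : east_constraint x (set_at x b w) = east_constraint x w.
  have := @east_constraint_indep R d V x b w => /eqP; rewrite eqr_nat.
  by case: east_constraint; case: east_constraint.
have cL (x : V) (w : cfg V) : east_constraint x w ->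
    rk x = 0%N \/ exists y, [/\ le y x, rk x = (rk y).+1 & ~~ w y].
  move=> /orP[/eqP e|/existsP[y /existsP[i /andP[/eqP e wy]]]].
    by left; rewrite /rk e /rank big1 // => i _; rewrite ffunE.
  right; exists y; split=> //; last by rewrite /rk e rank_shift.
  by rewrite /le e; apply/forallP => j; rewrite ffunE leq_addr.
have cA y k : (#|[pred x : V | le y x && (rk x <= rk y + k)%N]| <= k.+1 ^ D)%N.
  exact: count_above_box.
have cR k : (#|[pred x : V | (rk x < k)%N]| <= k.+1 ^ D)%N.
  have := count_above_box [` oV]%fset k; apply: leq_trans.
  apply: subset_leq_card; apply/fintype.subsetP => x; rewrite !inE /= => /ltnW xk.
  apply/andP; split; first by apply/forallP => i; rewrite ffunE.
  exact: leq_trans xk (leq_addl _ _).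
have [nc H] := bottleneck hq le_tr le_rk cI cL cA cR (z0 := [` cV]%fset) rank_corner.
by exists (reach_test R le rk n).
Qed.

End BoxBottleneck.

(** * Lower bounds on the coefficient *)

Section LowerBounds.
Variable R : realType.
Implicit Types (q eta beta lambda : R).

(** It absorbs the factorial in [dismantling_count], since n! <= n^n <= 2^(eta n^2 + C n). *)
Lemma nat_le_pow2_eps eta : 0 < eta ->
  exists2 C : R, 0 <= C & forall n : nat, n%:R <= 2 `^ (eta * n%:R + C).
Proof.
move=> e0; have [N N0 Ne] := inv_nat_lt e0.
exists N%:R => // n.
have NR : 0 < N%:R :> R by rewrite ltr0n.
have h1 : (n <= (n %/ N).+1 * N)%N by exact/ltnW/ltn_ceil.
apply: (@le_trans _ _ (((n %/ N).+1)%:R * N%:R)); first by rewrite -natrM ler_nat.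
apply: mul_le_pow2 => //; last exact: natr_le_pow2.
apply: (@le_trans _ _ (2 `^ ((n %/ N)%N)%:R)); first by rewrite pow2_nat ler_nat ltn_expl.
apply: ler_pow2; apply: (@le_trans _ _ (N%:R^-1 * n%:R)).
  by rewrite ler_pdivlMl // -natrM ler_nat mulnC leq_trunc_div.
by rewrite ler_wpM2r // ltW.
Qed.

Lemma dismantling_count_bound (D n : nat) (x : R) : n%:R <= 2 `^ x ->
  (dismantling_count D n)%:R <=
  2 `^ (n%:R * x + D%:R * (n%:R * n%:R - n%:R * (n%:R - 1) / 2)).
Proof.
move=> nx; rewrite /dismantling_count; move: (leqnn n).
have : forall k, (k <= n)%N -> (\prod_(j < k) (j.+1 * (2 ^ (n - j.+1)).+1 ^ D))%:R <=
    2 `^ (k%:R * x + D%:R * (k%:R * n%:R - k%:R * (k%:R - 1) / 2)).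
  elim=> [_|k IH kn].
    by rewrite big_ord0 [X in 2 `^ X](_ : _ = 0) ?powRr0 // mulr0n; ring.
  rewrite big_ord_recr natrM /= natrM natrX.
  have k1 : (k.+1)%:R <= 2 `^ x :> R by apply: le_trans nx; rewrite ler_nat.
  have p1 : ((2 ^ (n - k.+1)).+1)%:R <= 2 `^ (n%:R - k%:R) :> R.
    rewrite -natrB; last exact: ltnW.
    by rewrite pow2_nat ler_nat -(subnSK kn) expnS mul2n -addnn -addn1 leq_add2l expn_gt0.
  have p2 := exp_le_pow2 D (ler0n _ _) p1.
  have p0 : 0 <= ((2 ^ (n - k.+1)).+1)%:R ^+ D :> R by exact: exprn_ge0.
  have p3 := mul_le_pow2 (ler0n R _) p0 k1 p2.
  apply: le_trans (mul_le_pow2 (ler0n R _) (mulr_ge0 (ler0n R _) p0) (IH (ltnW kn)) p3) _.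
  rewrite le_eqVlt; apply/orP; left; apply/eqP; congr (_ `^ _).
  by rewrite -[k.+1%:R]natr1; field.
by apply.
Qed.

Lemma bernoulli_sub q (N : nat) : 0 < q < 1 -> 1 - N%:R * q <= (1 - q) ^+ N.
Proof.
move=> /andP[q0 q1]; elim: N => [|N IH]; first by rewrite mul0r subr0 expr0.
have p0 : 0 <= 1 - q by rewrite subr_ge0 ltW.
rewrite exprS; apply: le_trans (ler_wpM2l p0 IH); rewrite -[N.+1%:R]natr1.
have : 0 <= N%:R * q * q by rewrite !mulr_ge0 // ltW.
by lra.
Qed.

Lemma bottleneck_bound (D : nat) eta : (0 < D)%N -> 0 < eta ->
  exists C M : R, 1 <= M /\ forall q, 0 < q < 1 -> M <= theta q ->
  exists2 n : nat, n%:R <= theta q / D%:R &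
  forall N : nat, (N <= (D * 2 ^ n).+1 ^ D)%N ->
    N%:R * (dismantling_count D n)%:R * q ^+ n / (1 - q) ^+ N <=
    2 `^ (- (theta q ^+ 2 / (2 * D%:R)) + eta * theta q ^+ 2 + C * theta q).
Proof.
move=> D0 e0; have [C0 C00 HC0] := nat_le_pow2_eps e0.
have DR : 0 < D%:R :> R by rewrite ltr0n.
have D1 : 1 <= D%:R :> R by rewrite ler1n.
pose T : R := 2 + 2 * D%:R.
exists (1 + C0 + D%:R / 2 + D%:R * T ^+ 2 / 2), (1 + (2 * D%:R ^+ 2 + 1)).
split; first by rewrite lerDl addr_ge0 // mulr_ge0 // exprn_ge0.
move=> q hq; set th := theta q => thM.
have q0 : 0 < q by case/andP: hq.
have D20 : 0 <= D%:R ^+ 2 :> R by exact: sqr_ge0.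
have th1 : 1 <= th by lra.
have th0 : 0 <= th by lra.
(* The correction 2 D^2 + 1 ensures that the box has at most 1 / (2 q) sites, so that it has no
   vacancy with probability at least 1/2. At leading order n = theta / D also minimizes D n^2 / 2 -
   n theta, with value - theta^2 / (2 D). *)
pose u := (th - 2 * D%:R ^+ 2 - 1) / D%:R.
have u0 : 0 <= u by rewrite divr_ge0 ?(ltW DR) //; lra.
have /andP[n1 n2] := truncn_itv u0.
set n := Num.truncn u in n1 n2.
have uE : u = th / D%:R - 2 * D%:R - D%:R^-1 by rewrite /u; field; rewrite gt_eqF.
have Di : D%:R^-1 <= 1 :> R by rewrite invf_le1.
have Di0 : 0 <= D%:R^-1 :> R by rewrite invr_ge0 ltW.
have nle : n%:R <= th / D%:R by lra.
have nge : th / D%:R - n%:R <= T.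
  by move: n2; rewrite -[n.+1%:R]natr1 /T uE; lra.
exists n => // N NN.
have n0 : 0 <= n%:R :> R by [].
have thD : th / D%:R <= th by rewrite ler_pdivrMr // ler_peMr.
have NB : N%:R <= 2 `^ (th - 1).
  apply: (@le_trans _ _ (2 `^ (D%:R * (2 * D%:R + n%:R)))); last first.
    apply: ler_pow2; have : n%:R * D%:R <= th - 2 * D%:R ^+ 2 - 1 by rewrite -ler_pdivlMr.
    by lra.
  apply: (@le_trans _ _ (((D * 2 ^ n).+1)%:R ^+ D)); first by rewrite -natrX ler_nat.
  apply: exp_le_pow2 => //.
  apply: (@le_trans _ _ ((2 * D)%:R * (2 ^ n)%:R)).
    rewrite -natrM ler_nat; have : (0 < 2 ^ n)%N by rewrite expn_gt0.
    by move: (2 ^ n)%N => e; move: D0; clear; nia.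
  apply: mul_le_pow2 => //; last by rewrite pow2_nat.
  by apply: le_trans (natr_le_pow2 _ _) _; rewrite natrM.
have NQ : N%:R * q <= 2^-1.
  rewrite -{1}(pow2_theta hq) -/th.
  apply: le_trans (ler_wpM2r (pow2_ge0 _) NB) _; rewrite -pow2D.
  rewrite (_ : th - 1 + - th = - 1); last by ring.
  by rewrite pow2N powRr1.
have pN : 2^-1 <= (1 - q) ^+ N by apply: le_trans (bernoulli_sub N hq); lra.
have pN0 : 0 < (1 - q) ^+ N by apply: lt_le_trans pN.
have i2 : ((1 - q) ^+ N)^-1 <= 2 `^ 1.
  by rewrite powRr1 // -[leRHS]invrK lef_pV2 ?posrE.
have qn : q ^+ n <= 2 `^ (n%:R * - th).
  by apply: exp_le_pow2; [exact: ltW | rewrite pow2_theta].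
have cn := dismantling_count_bound D (HC0 n).
have b1 := mul_le_pow2 (ler0n _ _) (ler0n _ _) NB cn.
have b2 := mul_le_pow2 (mulr_ge0 (ler0n _ _) (ler0n _ _)) (exprn_ge0 n (ltW q0)) b1 qn.
have b30 : 0 <= N%:R * (dismantling_count D n)%:R * q ^+ n.
  by rewrite !mulr_ge0 // exprn_ge0 // ltW.
have ip0 : 0 <= ((1 - q) ^+ N)^-1 by rewrite invr_ge0 ltW.
have b3 := mul_le_pow2 b30 ip0 b2 i2.
apply: (le_trans b3); apply: ler_pow2.
have tE : n%:R = th / D%:R - (th / D%:R - n%:R) by ring.
set t := th / D%:R - n%:R in tE nge.
have t0 : 0 <= t by rewrite subr_ge0.
have sqt : t ^+ 2 <= T ^+ 2 by rewrite !expr2; exact: ler_pM.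
have main : D%:R * (n%:R * n%:R - n%:R * (n%:R - 1) / 2) + n%:R * - th =
    - (th ^+ 2 / (2 * D%:R)) + D%:R * t ^+ 2 / 2 + D%:R * n%:R / 2.
  by rewrite tE; field; rewrite gt_eqF.
have nth : n%:R <= th by exact: le_trans thD.
have m1 : eta * (n%:R * n%:R) <= eta * th ^+ 2.
  by rewrite ler_wpM2l ?(ltW e0) // expr2 ler_pM.
have m2 : C0 * n%:R <= C0 * th by rewrite ler_wpM2l.
have m3 : D%:R * n%:R <= D%:R * th by rewrite ler_wpM2l // ltW.
have m4 : D%:R * t ^+ 2 <= D%:R * T ^+ 2 * th.
  apply: (@le_trans _ _ (D%:R * T ^+ 2)); first by rewrite ler_wpM2l // ltW.
  by rewrite ler_peMr // mulr_ge0 ?sqr_ge0 // ltW.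
by move: main m1 m2 m3 m4; clear; lra.
Qed.

Lemma calH_lower (d D : nat) beta lambda : (0 < D)%N -> (D <= d)%N ->
  0 <= beta -> D = d \/ 1 <= beta -> 0 < lambda -> calH d beta lambda ->
  D%:R^-1 <= lambda.
Proof.
move=> D0 Dd b0 Db l0 H; rewrite leNgt; apply/negP => lD.
have DR : 0 < D%:R :> R by rewrite ltr0n.
pose l1 := (lambda + D%:R^-1) / 2.
pose eps := l1 / lambda - 1.
have eps0 : 0 < eps by rewrite subr_gt0 ltr_pdivlMr // mul1r /l1; lra.
have epsE : (1 + eps) * lambda = l1.
  by rewrite /eps addrCA subrr addr0 divfK // gt_eqF.
pose eta := (D%:R^-1 - l1) / 4.
have eta0 : 0 < eta by rewrite divr_gt0 // subr_gt0 /l1; lra.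
have [q1 q10 Hq] := H 1 eps (lexx _) eps0.
have [C [M [M1 HM]]] := bottleneck_bound D0 eta0.
have etaE : 4 * eta = D%:R^-1 - l1 by rewrite /eta mulrC divfK // pnatr_eq0.
have etalt : - (D%:R^-1 / 2) + eta < - (l1 / 2) - eta / 2 by lra.
have [M' M'1 HM'] := @quadratic_dominates R (- (D%:R^-1 / 2) + eta) (- (l1 / 2) - eta / 2) C
  etalt.
have [q2 q20 Hq2] := small_theta (Num.max M M').
pose q := Num.min q1 (Num.min q2 2^-1).
have hq : 0 < q < 1.
  by rewrite !lt_min q10 q20 invr_gt0 ltr0n /= !gt_min invf_lt1 // ltr1n !orbT.
have := Hq2 q hq; rewrite !ge_min lexx !orbT ge_max => /(_ isT)/andP[MQ MQ'].
have [n nth HN] := HM q hq MQ.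
have th0 : 0 <= theta q by rewrite normr_ge0.
have Lo : outstretched beta 1 q (corner d D n).
  have X1 : 1 <= 2 `^ (beta * theta q) :> R.
    by rewrite -[leLHS](powRr0 2); apply: ler_pow2; rewrite mulr_ge0.
  move=> i j; rewrite mul1r; case: Db => [De|b1].
    by rewrite !ffunE De !ltn_ord divff ?pnatr_eq0 // gtn_eqF // leq_max orbT.
  rewrite ler_pdivrMr ?ltr0n ?leq_max ?orbT //.
  apply: (@le_trans _ _ (2 `^ (beta * theta q))); last first.
    by rewrite ler_peMr ?pow2_ge0 // ler1n leq_max orbT.
  apply: (@le_trans _ _ (2 `^ n%:R)).
    rewrite pow2_nat ler_nat ffunE geq_max expn_gt0 andbT.
    by case: ifP => //; rewrite leq0n.
  apply: ler_pow2; apply: (le_trans nth); apply: (@le_trans _ _ (theta q)).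
    by rewrite ler_pdivrMr // ler_peMr // ler1n.
  by rewrite ler_peMl.
have qq1 : q <= q1 by rewrite ge_min lexx.
have [V [VL oV LV gV]] := Hq q hq qq1 (corner d D n) Lo.
have [f nf Hf] := box_bottleneck hq D0 Dd VL oV LV.
have vf := variance_gt0 hq nf.
have := le_trans (gap_variance hq f) Hf; rewrite ler_pM2r // => g1.
have g2 := HN _ (card_box Dd VL oV).
have := le_trans gV (le_trans g1 g2) => /le_pow2.
rewrite epsE; have := HM' _ MQ'.
have : 0 < eta * theta q ^+ 2 by rewrite mulr_gt0 // exprn_gt0 // theta_gt0.
have -> : theta q ^+ 2 / (2 * D%:R) = D%:R^-1 / 2 * theta q ^+ 2 by field; rewrite gt_eqF.
by clear; lra.
Qed.

End LowerBounds.

(** * The East process on the integers *)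

Section EastOnZ.
Variable R : realType.
Implicit Types (q : R).

Lemma depends_on_extend (A W : {fset int}) (f : (int -> bool) -> R) w :
  depends_on A f -> (A `<=` W)%fset ->
  f w = restrict_to f [ffun x : W => w (val x)].
Proof.
move=> Af /fsubsetP AW; apply: Af => x xA; rewrite /extend.
by rewrite insubT ?AW // => xW; rewrite ffunE.
Qed.

Lemma sub_window (A : {fset int}) : (A `<=` window A)%fset.
Proof. exact: fsubsetUl. Qed.

Lemma extend_val (W : {fset int}) (w : cfg W) (x : W) : extend w (val x) = w x.
Proof. by rewrite /extend valK. Qed.

Lemma restrict_nonconstant (A : {fset int}) (f : (int -> bool) -> R) :
  depends_on A f -> nonconstant f -> nonconstant (restrict_to (W := window A) f).
Proof.
move=> Af [w [w' ne]].
exists [ffun x : window A => w (val x)], [ffun x : window A => w' (val x)].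
by rewrite -!(depends_on_extend _ Af (sub_window A)).
Qed.

Lemma eastZ_indep (W : {fset int}) (x : W) b w :
  eastZ_constraint x (set_at x b w) = eastZ_constraint x w.
Proof.
rewrite /eastZ_constraint /extend; case: insubP => [y _ yx|//].
rewrite set_at_neq //; apply/eqP => e; move: yx; rewrite e => /eqP.
by rewrite eq_sym subr_eq addrC -subr_eq subrr.
Qed.

Lemma dirichlet_eastZ_ge0 q (W : {fset int}) (f : cfg W -> R) : 0 < q < 1 ->
  0 <= dirichlet q (@eastZ_constraint W) f.
Proof. by move=> hq; apply: dirichlet_ge0 => // x b w; rewrite eastZ_indep. Qed.

Lemma gamma1_le q (A : {fset int}) (f : (int -> bool) -> R) (a : R) : 0 < q < 1 ->
  depends_on A f -> nonconstant f ->
  dirichlet q (@eastZ_constraint (window A)) (restrict_to f) <=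
    a * variance q (restrict_to (W := window A) f) ->
  gamma1 q <= a.
Proof.
move=> hq Af nf H.
have vf : 0 < variance q (restrict_to (W := window A) f).
  by apply: variance_gt0 => //; exact: restrict_nonconstant.
apply: (@le_trans _ _ (dirichlet q (@eastZ_constraint (window A)) (restrict_to f) /
   variance q (restrict_to (W := window A) f))); last by rewrite ler_pdivrMr.
apply: ge_inf; last by exists A, f.
exists 0 => _ [A' [f' [_ _ ->]]]; apply: divr_ge0.
  exact: dirichlet_eastZ_ge0.
exact: (variance_ge0 hq).
Qed.

Lemma gamma1_upper (eta : R) : 0 < eta -> exists C M : R, forall q, 0 < q < 1 ->
  M <= theta q ->
  gamma1 q <= 2 `^ (- (theta q ^+ 2 / 2) + eta * theta q ^+ 2 + C * theta q).
Proof.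
move=> e0; have [C [M [_ HM]]] := bottleneck_bound (isT : 0 < 1)%N e0.
exists C, M => q hq Mq; have [n _ Hn] := HM q hq Mq.
pose V : {fset site 1} := box (corner 1 1 n).
have V_mem (x : site 1) : (x \in V) = (x ord0 <= 2 ^ n)%N.
  rewrite mem_box; apply/forallP/idP => [/(_ ord0)|h i]; first by rewrite ffunE.
  by rewrite (ord1 i) ffunE.
have oV : origin 1 \in V by rewrite V_mem ffunE.
have cV : corner 1 1 n \in V by rewrite V_mem ffunE.
have VL : {subset V <= box (corner 1 1 n)} by [].
have [f nf Hf] := box_bottleneck hq (ltnSn 0) (leqnn 1) VL oV cV.
pose A : {fset int} := [fset Posz ((x : site 1) ord0) | x in V]%fset.
have AV (x : V) : Posz (val x ord0) \in A by apply/imfsetP; exists (val x); rewrite //= valP.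
have WV (x : V) : Posz (val x ord0) \in window A by rewrite (fsubsetP (sub_window A)).
pose iota (x : V) : window A := [` WV x]%fset.
have iota_inj : injective iota.
  move=> x y /(congr1 val) /= [] e; apply/val_inj/ffunP => i.
  by rewrite (ord1 i).
pose F (w : int -> bool) : R := f [ffun x : V => w (Posz (val x ord0))].
have FA : depends_on A F.
  by move=> w w' ww'; congr f; apply/ffunP => x; rewrite !ffunE ww'.
have Fpull : restrict_to (W := window A) F = fun w => f (pull iota w).
  apply: funext => w; congr f; apply/ffunP => x; rewrite !ffunE.
  by rewrite -(extend_val w (iota x)).
have nF : nonconstant F.
  have [v [v' ne]] := nf.
  pose ext (v : cfg V) : int -> bool :=
    fun z => if [pick x : V | Posz (val x ord0) == z] is Some x then v x else true.
  have extE (u : cfg V) : [ffun x : V => ext u (Posz (val x ord0))] = u.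
    apply/ffunP => x; rewrite ffunE /ext; case: pickP => [y /eqP[e]|/(_ x)].
      by congr (u _); apply/val_inj/ffunP => i; rewrite (ord1 i).
    by rewrite eqxx.
  by exists (ext v), (ext v'); rewrite /F !extE.
apply: (gamma1_le hq FA nF); rewrite Fpull variance_pull //.
apply: le_trans (_ : dirichlet q (@east_constraint 1 V) f <= _); last first.
  apply: (le_trans Hf); apply: ler_wpM2r; first exact: variance_ge0.
  have := Hn _ (card_box (leqnn 1) VL oV).
  by rewrite mulr1.
(* A vacancy at x - 1 on the line is one in the segment, except at x = 0, where the segment imposes
   no constraint. *)
apply: dirichlet_pull => // x w cxw; left.
have [x0|x0] := posnP (val x ord0).
  apply/orP; left; apply/eqP/ffunP => i; rewrite (ord1 i) x0 ffunE //.
pose y : site 1 := [ffun _ => (val x ord0).-1].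
have xn : (val x ord0 <= 2 ^ n)%N by rewrite -V_mem; exact: valP.
have yV : y \in V by rewrite V_mem ffunE (leq_trans (leq_pred _) xn).
apply/orP; right; apply/existsP; exists [` yV]%fset; apply/existsP; exists ord0.
apply/andP; split.
  by apply/eqP/ffunP => i; rewrite (ord1 i) /= !ffunE eqxx addn1 prednK.
rewrite ffunE -extend_val; move: cxw; rewrite /eastZ_constraint /=.
by rewrite ffunE -{1}(prednK x0) -addn1 PoszD addrK.
Qed.

(** In one dimension the first site of [V] above a hole is frozen; its state would be a nonconstant
    function with zero Dirichlet form. *)
Lemma line_full q (B : nat) (V : {fset site 1}) : 0 < q < 1 ->
  {subset V <= box [ffun _ => B]} -> origin 1 \in V -> [ffun _ => B] \in V ->
  0 < gap q V -> forall k, (k <= B)%N -> [ffun _ => k] \in V.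
Proof.
move=> hq VB oV BV g0 k kB; apply/negPn/negP => kV.
pose P j := (k < j)%N && ([ffun _ : 'I_1 => j] \in V).
have exP : exists j, P j.
  exists B; rewrite /P BV andbT ltn_neqAle kB andbT.
  by apply: contraNneq kV => ->.
case: (ex_minnP exP) => j /andP[kj jV] jmin.
pose y : V := [` jV]%fset.
have cy w : ~~ east_constraint y w.
  rewrite /east_constraint negb_or; apply/andP; split.
    by apply/eqP => /ffunP/(_ ord0); rewrite /= !ffunE => j0; rewrite j0 in kj.
  apply/existsPn => z; apply/existsPn => i; rewrite negb_and; apply/orP; left.
  apply/eqP => /ffunP/(_ ord0); rewrite /= !ffunE (ord1 i) eqxx addn1 => jz.
  have zE : val z = [ffun _ => j.-1].
    by apply/ffunP => l; rewrite (ord1 l) ffunE jz.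
  have zV : [ffun _ : 'I_1 => j.-1] \in V by rewrite -zE; exact: valP.
  have [kj1|kj1] := ltnP k j.-1.
    have := jmin j.-1; rewrite /P kj1 zV => /(_ isT).
    by move: kj; clear; lia.
  move: kV; rewrite (_ : k = j.-1) ?zV //; apply/eqP; rewrite eqn_leq kj1 andbT.
  by move: kj; clear; lia.
pose f (w : cfg V) : R := (w y)%:R.
have nf : nonconstant f.
  by exists [ffun=> true], [ffun=> false]; rewrite /f !ffunE oner_neq0.
have D0 : dirichlet q (@east_constraint 1 V) f = 0.
  rewrite /dirichlet big1 // => x _; rewrite -[RHS](@mean_cst R V q); apply: eq_mean => w.
  have [->|xy] := eqVneq x y; first by rewrite (negPf (cy w)) mul0r.
  rewrite (_ : variance_at q x f w = 0) ?mulr0 // /variance_at /mean_at /f.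
  by rewrite !set_at_neq 1?eq_sym //; case: (w y); rewrite /=; ring.
have := gap_variance hq f; rewrite D0 leNgt mulr_gt0 //.
exact: variance_gt0.
Qed.

(** Division by [gamma1] requires it to be nonzero. [calH_one] in dimension 1 bounds the gap of a
    segment uniformly in its length, and every local function on the line can be translated into a
    segment. *)
Lemma gamma1_pos : exists M : R, forall q, 0 < q < 1 -> M <= theta q -> 0 < gamma1 q.
Proof.
have [q1 q10 H] := @calH_one R 1 (ltnSn 0) 0 1 1 (lexx _) ltr01.
exists (theta (Num.min q1 2^-1)) => q hq Mq.
have hq1 : 0 < Num.min q1 (2^-1 : R) < 1.
  by rewrite lt_min q10 invr_gt0 ltr0n /= gt_min invf_lt1 // ltr1n orbT.
have qq1 : q <= q1.
  apply: (@le_trans _ _ (Num.min q1 2^-1)); last by rewrite ge_min lexx.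
  by rewrite -(pow2_theta hq) -(pow2_theta hq1); apply: ler_pow2; rewrite lerN2.
set g := 2 `^ (- ((1 + 1) * 1 * theta q ^+ 2 / 2)) in H.
have g0 : 0 < 2 `^ (- ((1 + 1) * 1 * theta q ^+ 2 / 2)) :> R by exact: pow2_gt0.
apply: (lt_le_trans g0); apply: lb_le_inf.
  pose f (w : int -> bool) : R := (w 0)%:R.
  exists (dirichlet q (@eastZ_constraint (window [fset 0%R]%fset)) (restrict_to f) /
     variance q (restrict_to (W := window [fset 0%R]%fset) f)).
  exists [fset 0%R]%fset, f; split=> //.
    by move=> w w' ww'; rewrite /f ww' // inE.
  by exists (fun _ => true), (fun _ => false); rewrite /f oner_neq0.
move=> _ [A [f [Af nf ->]]].
set W := window A; pose f' : cfg W -> R := restrict_to f.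
have vf : 0 < variance q f' by apply: variance_gt0 => //; exact: restrict_nonconstant.
rewrite ler_pdivlMr //.
pose B := (\sum_(z <- enum_fset W) `|z|)%N.
have WB (z : W) : (`|val z| <= B)%N.
  by rewrite /B (big_rem (val z)) ?leq_addr //=; exact: valP.
have shiftK (z : W) : Posz `|val z + Posz B| = val z + Posz B.
  by have := WB z; move: (val z : int) (B); clear; lia.
have [V [VL oV LV gV]] := H q hq qq1 [ffun _ => (2 * B)%N]
  (ltac:(move=> i j; rewrite !ffunE mul0r powRr0 mulr1 divff // gt_eqF // ltr0n leq_max orbT)).
have full := line_full hq VL oV LV (lt_le_trans g0 gV).
have zV (z : W) : [ffun _ : 'I_1 => `|(val z + Posz B)%R|%N] \in V.
  by apply: full; have := WB z; move: (val z : int) (B); clear; lia.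
pose iota (z : W) : V := [` zV z]%fset.
have iota_inj : injective iota.
  move=> z z' /(congr1 val) /ffunP/(_ ord0); rewrite /= !ffunE => e.
  apply: val_inj; have := shiftK z; rewrite e shiftK => /addIr; exact.
have h := gap_variance hq (fun w : cfg V => f' (pull iota w)).
rewrite (variance_pull q iota_inj) in h.
apply: (@le_trans _ _ (gap q V * variance q f')).
  by rewrite ler_wpM2r // ltW.
apply: (le_trans h); apply: dirichlet_pull => // x w.
have [xA|xA] := boolP (val x \in A); last first.
  move=> _; right=> b v; apply: Af => z zA; rewrite /extend.
  case: insubP => // u _ uz; rewrite set_at_neq //.
  by apply: contraNneq xA => <-; rewrite uz.
(* As x - 1 also belongs to the window, the translate of [x] is not the origin of the segment: its
   constraint there is the one of the line. *)
have x1W : val x - 1 \in W.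
  by rewrite inE; apply/orP; right; apply/imfsetP; exists (val x).
have x1B := WB [` x1W]%fset; rewrite /= in x1B.
move=> /orP[/eqP/ffunP/(_ ord0)|/existsP[y /existsP[i /andP[/eqP e wy]]]].
  rewrite /= !ffunE => x0; exfalso.
  by move: x0 x1B; move: (val x : int) (B); clear; lia.
left; rewrite /eastZ_constraint /=.
rewrite (_ : val x - 1 = val [` x1W]%fset) // extend_val ffunE.
suff -> : iota [` x1W]%fset = y by [].
apply: val_inj; apply/ffunP => l; rewrite (ord1 l) /= ffunE.
move/ffunP: e => /(_ ord0); rewrite /= !ffunE (ord1 i) eqxx addn1 => e.
by move: e x1B; move: (val x : int) (val y ord0 : nat) (B); clear; lia.
Qed.

End EastOnZ.

(** * Dirichlet eigenvalue and conclusion *)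

Section DirichletEigenvalue.
Variables (R : realType) (q : R).
Hypothesis hq : 0 < q < 1.

(* Cauchy-Schwarz against the indicator of a one at [x]. *)
Lemma mean_le_variance (S : finType) (x : S) (g : cfg S -> R) :
  (forall w : cfg S, ~~ w x -> g w = 0) -> q * mean q (fun w => g w ^+ 2) <= variance q g.
Proof.
move=> g0; have [q0 q1] := andP hq.
set m := mean q g; pose chi (w : cfg S) : R := (w x)%:R.
have mchi : mean q chi = 1 - q.
  rewrite -(mean_mean_at q x chi) -[RHS](@mean_cst R S q); apply: eq_mean => w.
  by rewrite /mean_at /chi !ffunE eqxx mulr1 mulr0 addr0.
have p0 : 0 < 1 - q by rewrite subr_gt0.
have expand a : mean q (fun w => (g w - a * chi w) ^+ 2) =
    mean q (fun w => g w ^+ 2) - 2 * a * mean q g + a ^+ 2 * mean q chi.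
  rewrite -!meanZ -meanB -meanD; apply: eq_mean => w.
  rewrite /chi; case wx: (w x) => /=; first by ring.
  by rewrite g0 ?wx //; ring.
have : 0 <= mean q (fun w => (g w - m / (1 - q) * chi w) ^+ 2).
  by apply: mean_ge0 => // w; exact: sqr_ge0.
rewrite expand mchi -/m.
set s := mean q _ => h.
have : 0 <= (1 - q) * (s - 2 * (m / (1 - q)) * m + (m / (1 - q)) ^+ 2 * (1 - q)).
  by apply: mulr_ge0 => //; exact: ltW.
have -> : (1 - q) * (s - 2 * (m / (1 - q)) * m + (m / (1 - q)) ^+ 2 * (1 - q)) =
   (1 - q) * s - m ^+ 2 by field; exact: lt0r_neq0.
by rewrite /variance -/m -/s; lra.
Qed.

(** Freeze the configuration outside [V]. Since [V] contains x_Lambda, [mean_le_variance] applies to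
    the remaining function; a constraint satisfied inside [V] is satisfied in the box, so the energy
    only grows. *)
Lemma lambdaD_ge d (L : site d) (V : {fset site d}) :
  {subset V <= box L} -> L \in V -> 0 <= gap q V -> q * gap q V <= lambdaD q L.
Proof.
move=> VL LV g0; have [q0 q1] := andP hq.
have Lbox : L \in box L by rewrite mem_box; apply/forallP.
apply: lb_le_inf.
  pose f (w : cfg (box L)) : R := (w [` Lbox]%fset)%:R.
  exists (dirichlet q (@east_constraint d (box L)) f / mean q (fun w => f w ^+ 2)), f => //.
  split; first by exists [ffun=> true]; rewrite /f ffunE oner_neq0.
  move=> x w xL; rewrite /f (_ : [` Lbox]%fset = x); last exact: val_inj.
  by case: (w x).
move=> _ [f [[w0 fw0] fL] <-].
have f2 : 0 < mean q (fun w => f w ^+ 2).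
  rewrite /mean (bigD1 w0) //=; apply: ltr_pwDl.
    by apply: mulr_gt0; [exact: mu_gt0 | rewrite exprn_even_gt0].
  apply: sumr_ge0 => w _; apply: mulr_ge0; last exact: sqr_ge0.
  by apply: ltW; exact: mu_gt0.
rewrite ler_pdivlMr //.
pose iota (x : V) : box L := [` VL _ (valP x)]%fset.
have iota_inj : injective iota by move=> x y /(congr1 val) /= /val_inj.
have v0 (S : finType) x (g : cfg S -> R) w := variance_at_ge0 x g w hq.
have block (w : cfg (box L)) : q * gap q V * mean q (fun v => f (glue iota w v) ^+ 2) <=
    \sum_(x : V) mean q (fun v =>
      (east_constraint (iota x) (glue iota w v))%:R * variance_at q (iota x) f (glue iota w v)).
  rewrite mulrAC mulrC.
  apply: (@le_trans _ _ (gap q V * variance q (fun v => f (glue iota w v)))).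
    apply: ler_wpM2l => //; apply: (@mean_le_variance _ [` LV]%fset) => v vL.
    apply: (fL (iota [` LV]%fset)) => //; by rewrite glue_iota.
  apply: (le_trans (gap_variance hq _)); apply: ler_sum => x _.
  apply: ler_mean => // v.
  have -> : variance_at q x (fun v => f (glue iota w v)) v =
      variance_at q (iota x) f (glue iota w v).
    by rewrite /variance_at /mean_at !glue_set_at.
  apply: ler_wpM2r => //; rewrite ler_nat.
  case cx : (@east_constraint d V x v) => //.
  rewrite lt0b; move: cx => /orP[e|/existsP[y /existsP[i /andP[e vy]]]].
    by apply/orP; left.
  apply/orP; right; apply/existsP; exists (iota y); apply/existsP; exists i.
  by rewrite glue_iota // vy andbT.
rewrite -(mean_glue q iota_inj (fun w => f w ^+ 2)) -meanZ.
apply: (@le_trans _ _ (mean q (fun w => \sum_(x : V) mean q (fun v =>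
      (east_constraint (iota x) (glue iota w v))%:R * variance_at q (iota x) f (glue iota w v))))).
  by apply: ler_mean => // w; exact: block.
rewrite mean_sum.
under eq_bigr do rewrite (mean_glue q iota_inj (fun w => (east_constraint _ w)%:R * variance_at q _ f w)).
rewrite /dirichlet [leRHS](bigID (fun y => y \in iota @: predT)) /= big_imset /=; last first.
  by move=> x x' _ _; exact: iota_inj.
rewrite lerDl; apply: sumr_ge0 => y _; apply: mean_ge0 => // w.
exact: mulr_ge0.
Qed.

End DirichletEigenvalue.

(** * Existence of the minimum and the ratio of eigenvalues *)

Section Minimum.
Variables (R : realType) (d : nat).
Hypothesis d0 : (0 < d)%N.
Implicit Types (beta lambda : R).

Lemma admissible_lbound beta : 0 <= beta -> lbound (admissible d beta) d%:R^-1.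
Proof.
by move=> b0 lambda [l0 H]; apply: (calH_lower d0 (leqnn d) b0 _ l0 H); left.
Qed.

(** The factor 1 + eps in [calH] makes the admissible set closed from above: an admissible value
    below (1 + delta) m serves for m, because delta = min(1, eps) / 3 gives (1 + delta)^2 <= 1 +
    eps. *)
Lemma admissible_inf beta : 0 <= beta ->
  is_minimum (admissible d beta) (inf (admissible d beta)).
Proof.
move=> b0; set A := admissible d beta; set m := inf A.
have A1 : A 1 by split; [exact: ltr01 | exact: calH_one].
have lbA := admissible_lbound b0.
have hA : has_inf A by split; [exists 1 | exists d%:R^-1].
have m0 : 0 < m.
  apply: (@lt_le_trans _ _ d%:R^-1); first by rewrite invr_gt0 ltr0n.
  by apply: lb_le_inf => //; exists 1.
split; last by move=> x Ax; apply: ge_inf => //; exists d%:R^-1.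
split=> // kappa eps k1 e0.
pose delta := Num.min 1 eps / 3.
have delta0 : 0 < delta by rewrite divr_gt0 // lt_min ltr01.
have delta1 : delta <= 3^-1 by rewrite /delta ler_pdivrMr // mulVf ?pnatr_eq0 // ge_min lexx.
have deltaE : 3 * delta <= eps.
  by rewrite /delta mulrC divfK ?pnatr_eq0 // ge_min lexx orbT.
have [lambda [l0 Hl] lm] := inf_adherent (mulr_gt0 m0 delta0) hA.
have [q0 q00 H] := Hl kappa delta k1 delta0.
exists q0 => // q hq qq0 L oL; have [V [VL oV LV gV]] := H q hq qq0 L oL.
exists V; split=> //; apply: le_trans gV; apply: ler_pow2.
rewrite lerN2 ler_pM2r ?invr_gt0 // ler_wpM2r ?sqr_ge0 //.
apply: (@le_trans _ _ ((1 + delta) * (m + m * delta))).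
  apply: ler_wpM2l; first by apply: addr_ge0 => //; exact: ltW.
  exact: ltW.
rewrite (_ : m + m * delta = (1 + delta) * m); last by ring.
rewrite mulrA; apply: ler_wpM2r; first exact: ltW.
have : delta * delta <= delta * 3^-1 by apply: ler_wpM2l => //; exact: ltW.
by move: deltaE delta0; clear; lra.
Qed.

Lemma phi_minimum beta : 0 <= beta -> is_minimum (admissible d beta) (phi d beta).
Proof. by move=> b0; apply: xgetPex; exists (inf (admissible d beta)); exact: admissible_inf. Qed.

Lemma phi_eq beta lambda : 0 <= beta -> 0 < lambda -> calH d beta lambda ->
  lbound (admissible d beta) lambda -> phi d beta = lambda.
Proof.
move=> b0 l0 Hl lb; have [Am lbm] := phi_minimum b0.
by apply/le_anti; rewrite lbm // lb.
Qed.

Lemma dirichlet_ratio beta lambda kappa (B : R) : 0 < lambda < 1 ->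
  calH d beta lambda -> 1 <= kappa ->
  exists2 q0 : R, 0 < q0 & forall q, 0 < q < 1 -> q <= q0 ->
  forall L : site d, outstretched beta kappa q L -> B <= lambdaD q L / gamma1 q.
Proof.
move=> /andP[l0 l1] Hl k1.
(* This choice turns (1 + eps) lambda into (1 + lambda) / 2, so the ratio gains the exponent (1 -
   lambda) / 4 in theta^2, of which the bound on [gamma1] loses only half. *)
have e0 : 0 < (1 - lambda) / (2 * lambda).
  by apply: divr_gt0; [rewrite subr_gt0 | exact: mulr_gt0].
have [q0 q00 H] := Hl kappa _ k1 e0.
have eta0 : 0 < (1 - lambda) / 8 by apply: divr_gt0 => //; rewrite subr_gt0.
have [C [M1 HM1]] := gamma1_upper eta0.
have [M2 HM2] := gamma1_pos R.
have eta1 : (1 - lambda) / 8 < (1 - lambda) / 4 by move: l1; clear; lra.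
(* The 2 pays for the factor q in [lambdaD_ge] and for B <= 2^theta. *)
have [M3 _ HM3] := quadratic_dominates (C + 2) eta1.
pose k := Num.bound `|B|.
have [q1 q10 Hq1] := small_theta (Num.max (Num.max M1 M2) (Num.max M3 k%:R)).
exists (Num.min q0 q1); first by rewrite lt_min q00.
move=> q hq; rewrite le_min => /andP[qq0 qq1] L oL.
have := Hq1 q hq qq1; rewrite !ge_max => /andP[/andP[t1 t2] /andP[t3 tk]].
have [V [VL oV LV gV]] := H q hq qq0 L oL.
have g1 := HM1 q hq t1; have g1pos := HM2 q hq t2; have g3 := HM3 _ t3.
rewrite ler_pdivlMr //; move: (hq) => /andP[qpos _].
have gV0 : 0 <= gap q V by apply: le_trans gV; exact: pow2_ge0.
apply: le_trans (lambdaD_ge hq VL LV gV0).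
apply: (@le_trans _ _ (q * 2 `^ (- ((1 + (1 - lambda) / (2 * lambda)) * lambda * theta q ^+ 2 / 2)))); last first.
  by apply: ler_wpM2l => //; exact: ltW.
have -> : (1 + (1 - lambda) / (2 * lambda)) * lambda = (1 + lambda) / 2.
  by field; exact: lt0r_neq0.
rewrite -{2}(pow2_theta hq) -pow2D.
have Bt : B <= 2 `^ theta q.
  apply: (@le_trans _ _ k%:R).
    by apply: (le_trans (ler_norm B)); apply: ltW; apply: archi_boundP; exact: normr_ge0.
  by apply: (le_trans (natr_le_pow2 _ k)); exact: ler_pow2.
apply: (@le_trans _ _ (2 `^ theta q * gamma1 q)); first by apply: ler_wpM2r => //; exact: ltW.
apply: (@le_trans _ _ (2 `^ theta q *
    2 `^ (- (theta q ^+ 2 / 2) + (1 - lambda) / 8 * theta q ^+ 2 + C * theta q))).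
  by apply: ler_wpM2l => //; exact: pow2_ge0.
rewrite -pow2D; apply: ler_pow2.
by move: g3; clear; set t := theta q; move: (t ^+ 2) => u; lra.
Qed.

End Minimum.

Theorem proposition3p6 (R : realType) (d : nat) (hd : (2 <= d)%N) :
  [/\ (forall beta : R, 0 <= beta ->
         is_minimum (admissible d beta) (phi d beta)),
      phi d (0 : R) = d%:R^-1,
      (forall beta : R, 0 < beta < 1 -> phi d beta < 1),
      (forall beta : R, 1 <= beta -> phi d beta = 1) &
      (forall (beta kappa : R) (L : R -> site d),
         0 <= beta < 1 -> 1 <= kappa ->
         (forall q : R, 0 < q < 1 -> outstretched beta kappa q (L q)) ->
         (fun q : R => lambdaD q (L q) / gamma1 q) q @[q --> 0^'+] --> +oo)].
Proof.
have d0 : (0 < d)%N by exact: leq_trans hd.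
have inv_d0 : 0 < (d%:R^-1 : R) by rewrite invr_gt0 ltr0n.
split.
- by move=> beta; exact: phi_minimum.
- apply: phi_eq => //; first exact: calH_zero.
  exact: admissible_lbound.
- move=> beta /andP[b0 b1].
  have [lambda /andP[l0 l1] Hl] : exists2 lambda : R, 0 < lambda < 1 & calH d beta lambda.
    by apply: calH_below_one => //; rewrite b0.
  have [_ lb] := phi_minimum d0 (ltW b0).
  by apply: le_lt_trans l1; exact: lb.
- move=> beta b1; have b0 : 0 <= beta by exact: le_trans b1.
  apply: phi_eq => //; first exact: calH_one.
  move=> lambda [l0 Hl]; rewrite -[1]invr1.
  by apply: (calH_lower (ltnSn 0) d0 b0 _ l0 Hl); right.
move=> beta kappa L /andP[b0 b1] k1 oL.
have [lambda l01 Hl] : exists2 lambda : R, 0 < lambda < 1 & calH d beta lambda.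
  move: b0; rewrite le_eqVlt => /predU1P[<-|b0].
    exists d%:R^-1; last exact: calH_zero.
    by rewrite inv_d0 invf_lt1 ?ltr1n ?ltr0n.
  by apply: calH_below_one => //; rewrite b0.
apply/cvgryPge => B; have [q0 q00 H] := dirichlet_ratio B l01 Hl k1.
near=> q.
have hq : 0 < q < 1.
  by apply/andP; split; near: q; [exact: nbhs_right_gt | exact: nbhs_right_lt].
apply: H => //; last exact: oL.
by near: q; exact: nbhs_right_le.
Unshelve. all: by end_near.
Qed.
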